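(* Let $(R,\mathfrak m)$ be a Cohen-Macaulay local ring of dimension $d$ with canonical module $\omega_R$. Let $I$ and $J$ be ideals of $R$. (a) If $0:_{\omega_R}I=J\omega_R$ and $R/I$ is a maximal Cohen-Macaulay $R$-module, then $\delta^i_R(J\omega_R)=0$ for all $i\geq 1$. (b) If $0:_{\omega_R}I=J\omega_R$, $0:_{\omega_R}J=I\omega_R$, $R/I$ is a maximal Cohen-Macaulay $R$-module, and $\operatorname{G-dim}_{R/J}(\omega_R/J\omega_R)<\infty$, then $\delta^i_R(I\omega_R)=0$ for all $i\geq 1$.
   Context: All rings are commutative Noetherian, $(R,\mathfrak m)$ local means with maximal ideal $\mathfrak m$, and all modules are finitely generated. $0:_{\omega_R}I=\{u\in\omega_R : Iu=0\}$. For a finitely generated $R$-module $M$, $M^{\mathrm{cm}}$ denotes the sum of all submodules $\phi(L)$ of $M$, where $L$ ranges over all maximal Cohen-Macaulay $R$-modules with no non-zero free direct summand and $\phi$ ranges over all $R$-linear homomorphisms $L\to M$. The delta invariant is $\delta_R(M)=\mu_R(M/M^{\mathrm{cm}})$, where $\mu_R$ is the minimal number of generators. The higher delta invariants are $\delta^i_R(M)=\delta_R(\Omega^i_R(M))$, where $\Omega^i_R(M)$ is the $i$-th syzygy of $M$ in its minimal free resolution. A finitely generated module $M$ over a ring $S$ is totally reflexive if the natural map $M\to \operatorname{Hom}_S(\operatorname{Hom}_S(M,S),S)$ is an isomorphism and $\operatorname{Ext}^i_S(M,S)=0=\operatorname{Ext}^i_S(\operatorname{Hom}_S(M,S),S)$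 for all $i>0$. The Gorenstein dimension $\operatorname{G-dim}_S(M)$ is the least $n$ for which there is an exact sequence $0\to G_n\to\cdots\to G_0\to M\to 0$ with each $G_i$ totally reflexive, and $\infty$ if no such finite sequence exists. *)

(* Defs.v *)
From HB Require Import structures.
From mathcomp Require Import all_boot all_order all_algebra.
From mathcomp Require Import generic_quotient ring_quotient.
From mathcomp Require Import boolp classical_sets functions.

Set Implicit Arguments.
Unset Strict Implicit.
Unset Printing Implicit Defensive.

Import GRing.Theory.
Local Open Scope ring_scope.
Local Open Scope quotient_scope.

(* Modules are taken over comPzRingType, where 0 = 1 is allowed, because the
   quotient of R by an ideal that may be improper is used as a base ring.
   The ideals of R are the submodules of R^o; they need not be proper. *)

(** * Submodules and quotient modules *)

(* MathComp's submodClosed is stated for semimodules and does not extend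
   zmodClosed, over which quotients are taken; hence this record. *)
Record submodule (R : pzRingType) (M : lmodType R) := Submodule {
  submod_pred :> {pred M};
  submod_closed : GRing.subsemimod_closed submod_pred
}.

HB.instance Definition _ (R : pzRingType) (M : lmodType R) (N : submodule M) :=
  GRing.isSubmodClosed.Build R M (submod_pred N) (submod_closed N).

Local Notation "{ 'quot' N }" := (@Quotient.quot _ (submod_pred N)) : type_scope.

Section SubmoduleType.
Variables (R : comPzRingType) (M : lmodType R) (N : submodule M).

Definition sub_mod := {x : M | x \in N}.

HB.instance Definition _ := SubChoice.on sub_mod.
HB.instance Definition _ := [SubChoice_isSubLmodule of sub_mod by <:].

End SubmoduleType.

Section QuotientModule.
Variables (R : comPzRingType) (M : lmodType R) (N : submodule M).

Definition quot_mod := {quot N}.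

HB.instance Definition _ := GRing.Zmodule.on quot_mod.

Definition quot_scale (a : R) (u : quot_mod) : quot_mod :=
  \pi_{quot N} (a *: (repr (u : {quot N}))).

Lemma pi_scale a x :
  quot_scale a (\pi_{quot N} x) = \pi_{quot N} (a *: x).
Proof.
apply/eqP; rewrite /quot_scale -Quotient.idealrBE -scalerBr rpredZ //.
by rewrite Quotient.idealrBE reprK.
Qed.

Let quot_scalerA a b u :
  quot_scale a (quot_scale b u) = quot_scale (a * b) u.
Proof. by rewrite {2 3}/quot_scale pi_scale scalerA. Qed.

Let quot_scale1r : left_id 1 quot_scale.
Proof. by move=> u; rewrite /quot_scale scale1r; exact: reprK. Qed.

Let quot_scalerDr : right_distributive quot_scale +%R.
Proof.
move=> a; elim/quotW => x; elim/quotW => y.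
have -> : \pi_{quot N} x + \pi_{quot N} y = \pi_{quot N} (x + y) :> quot_mod.
  by rewrite piE.
by rewrite !pi_scale scalerDr; apply/esym; rewrite piE.
Qed.

Let quot_scalerDl u : {morph quot_scale^~ u : a b / a + b}.
Proof. by move=> a b; rewrite /quot_scale scalerDl piE. Qed.

HB.instance Definition _ := GRing.Zmodule_isLmodule.Build R quot_mod
  quot_scalerA quot_scale1r quot_scalerDr quot_scalerDl.

End QuotientModule.

(* smul M A is the submodule A M of the finite sums of products a *: x with a in A. *)
Section IdealProduct.
Variables (R : comPzRingType) (M : lmodType R) (A : {pred R}).

Definition smul_pred : {pred M} := fun u =>
  `[< exists2 s : seq (R * M), {in s, forall p, p.1 \in A}
        & u = \sum_(p <- s) p.1 *: p.2 >].

Lemma smul_closed : GRing.subsemimod_closed smul_pred.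
Proof.
split; first split.
- by apply/asboolP; exists [::] => //; rewrite big_nil.
- move=> u v /asboolP[s sA ->] /asboolP[t tA ->]; apply/asboolP.
  exists (s ++ t); last by rewrite big_cat.
  by move=> p; rewrite mem_cat => /orP[/sA|/tA].
- move=> a u /asboolP[s sA ->]; apply/asboolP.
  exists [seq (p.1, a *: p.2) | p <- s].
    by move=> _ /mapP[p ps ->]; exact: (sA p ps).
  rewrite big_map scaler_sumr; apply: eq_bigr => p _ /=.
  by rewrite !scalerA mulrC.
Qed.

Definition smul : submodule M := Submodule smul_closed.

Lemma mem_smul a x : a \in A -> a *: x \in smul.
Proof.
move=> aA; apply/asboolP; exists [:: (a, x)]; last by rewrite big_seq1.
by move=> p; rewrite inE => /eqP ->.
Qed.

End IdealProduct.

Section QuotientRing.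
Variables (R : comPzRingType) (J : submodule R^o).

Definition quot_ring := {quot J}.

HB.instance Definition _ := GRing.Zmodule.on quot_ring.

Lemma quot_ringW (P : quot_ring -> Prop) :
  (forall a : R, P (\pi_{quot J} (a : R^o))) -> forall x, P x.
Proof.
by move=> Pa x; rewrite -[x](reprK (x : {quot J})); exact: Pa.
Qed.

Definition quot_one : quot_ring := \pi_{quot J} (1 : R^o).
Definition quot_mul (x y : quot_ring) : quot_ring :=
  \pi_{quot J} ((repr (x : {quot J}) : R) * (repr (y : {quot J}) : R) : R^o).

Lemma pi_mul (a b : R) :
  quot_mul (\pi_{quot J} (a : R^o)) (\pi_{quot J} (b : R^o))
  = \pi_{quot J} (a * b : R^o).
Proof.
apply/eqP; rewrite /quot_mul -Quotient.idealrBE.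
set a' := repr _; set b' := repr _.
have aJ : a' - (a : R^o) \in J by rewrite Quotient.idealrBE reprK.
have bJ : b' - (b : R^o) \in J by rewrite Quotient.idealrBE reprK.
have /(rpredD (rpredZ (b' : R) aJ)) := rpredZ a bJ.
suff -> : (b' : R) *: (a' - (a : R^o)) + a *: (b' - (b : R^o))
        = (a' : R) * (b' : R) - a * b :> R by [].
rewrite /GRing.scale /= !mulrBr [in X in X + _]mulrC.
by rewrite [(b' : R) * a]mulrC addrA subrK.
Qed.

Let quot_mulA : associative quot_mul.
Proof.
move=> x y z; elim/quot_ringW: x => x; elim/quot_ringW: y => y; elim/quot_ringW: z => z.
by rewrite !pi_mul mulrA.
Qed.

Let quot_mulC : commutative quot_mul.
Proof.
by move=> x y; elim/quot_ringW: x => x; elim/quot_ringW: y => y; rewrite !pi_mul mulrC.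
Qed.

Let quot_mul1 : left_id quot_one quot_mul.
Proof. by move=> x; elim/quot_ringW: x => x; rewrite pi_mul mul1r. Qed.

Let quot_mulDl : left_distributive quot_mul +%R.
Proof.
move=> x y z; elim/quot_ringW: x => x; elim/quot_ringW: y => y; elim/quot_ringW: z => z.
have piD (a b : R^o) :
    \pi_{quot J} a + \pi_{quot J} b = \pi_{quot J} (a + b) :> quot_ring.
  by rewrite piE.
by rewrite piD !pi_mul piD; congr (\pi_{quot J} _); exact: mulrDl.
Qed.

HB.instance Definition _ := GRing.Zmodule_isComPzRing.Build quot_ring
  quot_mulA quot_mulC quot_mul1 quot_mulDl.

End QuotientRing.

(* M / J M as a module over R / J. *)
Section ReductionModulo.
Variables (R : comPzRingType) (J : submodule R^o) (M : lmodType R).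

Definition red_mod := {quot (smul M J)}.

HB.instance Definition _ := GRing.Zmodule.on red_mod.

Lemma red_modW (P : red_mod -> Prop) :
  (forall x : M, P (\pi_{quot (smul M J)} x)) -> forall u, P u.
Proof.
by move=> Px u; rewrite -[u](reprK (u : {quot (smul M J)})); exact: Px.
Qed.

Definition red_scale (a : quot_ring J) (u : red_mod) : red_mod :=
  \pi_{quot (smul M J)}
    ((repr (a : {quot J}) : R) *: repr (u : {quot (smul M J)})).

Lemma pi_red_scale (a : R) (x : M) :
  red_scale (\pi_{quot J} (a : R^o)) (\pi_{quot (smul M J)} x)
  = \pi_{quot (smul M J)} (a *: x).
Proof.
apply/eqP; rewrite /red_scale -Quotient.idealrBE.
set a' := repr _; set x' := repr _.
have aJ : a' - (a : R^o) \in J by rewrite Quotient.idealrBE reprK.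
have xJ : x' - x \in smul M J by rewrite Quotient.idealrBE reprK.
have -> : (a' : R) *: x' - a *: x = ((a' : R) - a) *: x' + a *: (x' - x).
  by rewrite scalerBl scalerBr addrA subrK.
exact: rpredD (mem_smul x' aJ) (rpredZ a xJ).
Qed.

Let red_piD (x y : M) : \pi_{quot (smul M J)} x + \pi_{quot (smul M J)} y
  = \pi_{quot (smul M J)} (x + y) :> red_mod.
Proof. by rewrite piE. Qed.

Let red_scalerA a b u : red_scale a (red_scale b u) = red_scale (a * b) u.
Proof.
elim/quot_ringW: a => a; elim/quot_ringW: b => b; elim/red_modW: u => x.
rewrite [in LHS]pi_red_scale [in LHS]pi_red_scale scalerA -pi_red_scale.
by rewrite -pi_mul.
Qed.

Let red_scale1r : left_id 1 red_scale.
Proof. by move=> x; elim/red_modW: x => x; rewrite pi_red_scale scale1r. Qed.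

Let red_scalerDr : right_distributive red_scale +%R.
Proof.
move=> a x y; elim/quot_ringW: a => a; elim/red_modW: x => x; elim/red_modW: y => y.
by rewrite red_piD !pi_red_scale red_piD scalerDr.
Qed.

Let red_scalerDl u : {morph red_scale^~ u : a b / a + b}.
Proof.
elim/red_modW: u => x; move=> a b; elim/quot_ringW: a => a; elim/quot_ringW: b => b.
have -> : \pi_{quot J} a + \pi_{quot J} b = \pi_{quot J} (a + b) :> quot_ring J.
  by rewrite piE.
by rewrite !pi_red_scale red_piD scalerDl.
Qed.

HB.instance Definition _ := GRing.Zmodule_isLmodule.Build (quot_ring J) red_mod
  red_scalerA red_scale1r red_scalerDr red_scalerDl.

End ReductionModulo.

(* The submodule 0 :_M I. *)
Definition colon (R : comPzRingType) (M : lmodType R) (I : {pred R}) :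
    {pred M} :=
  fun u => `[< forall a, a \in I -> a *: u = 0 >].
Arguments colon {R} M I.

Section KernelImage.
Variables (R : comPzRingType) (M N : lmodType R) (f : {linear M -> N}).

Definition ker_pred : {pred M} := fun x => f x == 0.

Lemma ker_closed : GRing.subsemimod_closed ker_pred.
Proof.
split; first split; rewrite /ker_pred.
- by rewrite unfold_in linear0.
- by move=> x y; rewrite !unfold_in linearD => /eqP-> /eqP->; rewrite addr0.
- by move=> a x; rewrite !unfold_in linearZ /= => /eqP->; rewrite scaler0.
Qed.

Definition ker : submodule M := Submodule ker_closed.

Definition im_pred : {pred N} := fun y => `[< exists x, y = f x >].

Lemma im_closed : GRing.subsemimod_closed im_pred.
Proof.
split; first split.
- by apply/asboolP; exists 0; rewrite linear0.
- move=> _ _ /asboolP[x ->] /asboolP[y ->].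
  by apply/asboolP; exists (x + y); rewrite linearD.
- by move=> a _ /asboolP[x ->]; apply/asboolP; exists (a *: x); rewrite linearZ.
Qed.

Definition im : submodule N := Submodule im_closed.

End KernelImage.

Section Preimage.
Variables (R : comPzRingType) (M N : lmodType R) (f : {linear M -> N}).
Variable P : submodule N.

Definition preim_pred : {pred M} := fun x => f x \in P.

Lemma preim_closed : GRing.subsemimod_closed preim_pred.
Proof.
split; first split.
- by have := rpred0 P; rewrite -(linear0 f).
- by move=> x y /= xP yP; have := rpredD (xP : f x \in P) yP; rewrite -linearD.
- by move=> a x xP; have := rpredZ a (xP : f x \in P); rewrite -linearZ.
Qed.

Definition preim_sub : submodule M := Submodule preim_closed.

End Preimage.

Definition exact_at (A B : Type) (C : zmodType) (f : A -> B) (g : B -> C) :=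
  forall b, g b = 0 <-> exists a, b = f a.

(** * The module of homomorphisms *)

Section Hom.
Variables (R : comPzRingType) (M N : lmodType R).

Definition hom_pred : {pred M -> N} := fun f => `[< linear f >].

Lemma hom_closed : GRing.subsemimod_closed hom_pred.
Proof.
split; first split.
- by apply/asboolP => a x y /=; rewrite scaler0 addr0.
- move=> f g /asboolP lf /asboolP lg; apply/asboolP => a x y.
  by rewrite !addrfctE lf lg scalerDr addrACA.
- move=> b f /asboolP lf; apply/asboolP => a x y.
  by rewrite !scalrfctE lf scalerDr !scalerA mulrC.
Qed.

Definition hom := sub_mod (Submodule hom_closed).

HB.instance Definition _ := GRing.Lmodule.on hom.

End Hom.

Section HomFunctor.
Variables (R : comPzRingType) (L M N : lmodType R) (d : {linear L -> M}).

Lemma hom_comp_subproof (f : hom M N) : val f \o d \in @hom_pred R L N.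
Proof.
apply/asboolP => a x y /=; rewrite linearP.
exact: (asboolW (valP f)).
Qed.

Definition hom_comp (f : hom M N) : hom L N :=
  exist _ (val f \o d) (hom_comp_subproof f).

Lemma hom_comp_linear : linear hom_comp.
Proof. by move=> a f g; apply: val_inj. Qed.

HB.instance Definition _ :=
  GRing.isLinear.Build R (hom M N) (hom L N) *:%R hom_comp hom_comp_linear.

End HomFunctor.

Section Biduality.
Variables (R : comPzRingType) (M : lmodType R).

Lemma bidual_subproof (x : M) :
  (fun f : hom M R^o => val f x) \in @hom_pred R (hom M R^o) R^o.
Proof. by apply/asboolP => a f g. Qed.

Definition bidual (x : M) : hom (hom M R^o) R^o :=
  exist _ (fun f : hom M R^o => val f x) (bidual_subproof x).

End Biduality.

(** * Generators, minimal free resolutions and Ext *)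

Section Generators.
Variables (R : comPzRingType) (M : lmodType R).

Definition generates n (g : 'I_n -> M) : Prop :=
  forall x, exists c : 'rV[R]_n, x = \sum_i c 0 i *: g i.

Definition generated_by n : bool := `[< exists g : 'I_n -> M, generates g >].

Definition fin_gen : Prop := exists n, generated_by n.

(* The value 0 for a module that is not finitely generated is a dummy. *)
Definition mu : nat :=
  if pselect fin_gen is left h then ex_minn h else 0.

Definition min_gens : 'I_mu -> M := xget (fun=> 0) [set g | generates g].

Definition cover (c : 'rV[R]_mu) : M := \sum_i c 0 i *: min_gens i.

Lemma cover_linear : linear cover.
Proof.
move=> a c c'; rewrite /cover scaler_sumr -big_split; apply: eq_bigr => i _ /=.
by rewrite !mxE scalerDl scalerA.
Qed.

HB.instance Definition _ :=
  GRing.isLinear.Build R 'rV[R]_mu M *:%R cover cover_linear.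

Definition syz1 : lmodType R := sub_mod (ker cover).

End Generators.

Section Resolution.
Variables (R : comPzRingType) (M : lmodType R).

(* Covering M, then each successive kernel, by a free module on a generating
   family of least cardinality gives a free resolution of M when R is
   Noetherian and M is finitely generated; if moreover R is local, it is the
   minimal free resolution. *)
Definition syz (i : nat) : lmodType R := iter i (@syz1 R) M.

Definition res (i : nat) : lmodType R := 'rV[R]_(mu (syz i)).

Definition res_diff i (c : res i.+1) : res i :=
  \val (cover c : sub_mod (ker (@cover R (syz i)))).

Lemma res_diff_linear i : linear (@res_diff i).
Proof. by move=> a c c'; rewrite /res_diff linearP. Qed.

HB.instance Definition _ i :=
  GRing.isLinear.Build R (res i.+1) (res i) *:%R (@res_diff i)
    (@res_diff_linear i).

Variable N : lmodType R.

Definition coboundary (i : nat) : submodule (hom (res i) N) :=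
  match i with
  | 0 => im (\0 : {linear hom (res 0) N -> hom (res 0) N})
  | j.+1 => im (@hom_comp R _ _ N (@res_diff j) :
                  {linear hom (res j) N -> hom (res j.+1) N})
  end.

Definition cocycle (i : nat) : submodule (hom (res i) N) :=
  ker (@hom_comp R _ _ N (@res_diff i) :
         {linear hom (res i) N -> hom (res i.+1) N}).

Definition Ext (i : nat) : lmodType R :=
  quot_mod (preim_sub (\val : {linear sub_mod (cocycle i) -> hom (res i) N})
                      (coboundary i)).

End Resolution.
Arguments Ext {R} M N i.

Definition Ext_vanishes (R : comPzRingType) (M N : lmodType R) (i : nat) :=
  forall x : Ext M N i, x = 0.

(** * Gorenstein dimension *)

Section GDim.
Variable R : comPzRingType.
Implicit Type M : lmodType R.

Definition totally_reflexive M : Prop :=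
  [/\ fin_gen M, bijective (@bidual R M),
      forall i, (0 < i)%N -> Ext_vanishes M R^o i
    & forall i, (0 < i)%N -> Ext_vanishes (hom M R^o) R^o i].

(* 0 -> G n -> ... -> G 0 -> M -> 0 is exact, continued by zero modules. *)
Definition has_Gres M (n : nat) : Prop :=
  exists (G : nat -> lmodType R) (d : forall i, {linear G i.+1 -> G i})
         (e : {linear G 0 -> M}),
    [/\ forall i, (i <= n)%N -> totally_reflexive (G i),
        forall i, (n < i)%N -> forall x : G i, x = 0,
        forall x, exists y, e y = x,
        exact_at (d 0) e
      & forall i, exact_at (d i.+1) (d i)].

(* None stands for infinity. *)
Definition Gdim M : option nat :=
  if pselect (exists n, `[< has_Gres M n >]) is left h then Some (ex_minn h)
  else None.

End GDim.

(** * Local algebra *)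

Section LocalAlgebra.
Variable R : comNzRingType.
Implicit Types (M E L : lmodType R) (m : submodule R^o).

Definition noetherian : Prop :=
  forall I : submodule R^o, fin_gen (sub_mod I).

Definition maximal_ideal m : Prop :=
  (1 : R^o) \notin m /\
  forall I : submodule R^o,
    {subset m <= I} -> (1 : R^o) \notin I -> {subset I <= m}.

Definition local_ring m : Prop :=
  maximal_ideal m /\ forall n, maximal_ideal n -> n =i m.

Definition annihilator M : {pred R} := fun a => `[< forall u : M, a *: u = 0 >].

(* A strictly increasing chain of n.+1 primes containing ann M. *)
Definition prime_chain M n (p : nat -> prime_idealr R) : Prop :=
  {subset annihilator M <= (p 0 : {pred R})} /\
  forall i, (i < n)%N ->
    {subset (p i : {pred R}) <= (p i.+1 : {pred R})} /\
    exists2 a : R, a \in (p i.+1 : {pred R}) & a \notin (p i : {pred R}).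

(* The Krull dimension of M, that is, of R / ann M, is equal to n. *)
Definition is_dim M n : Prop :=
  (exists p, prime_chain M n p) /\
  forall k p, prime_chain M k p -> (k <= n)%N.

Definition regular_seq M (s : seq R) : Prop :=
  (forall i, (i < size s)%N -> forall u : quot_mod (smul M [in take i s]),
     s`_i *: u = 0 -> u = 0) /\
  exists u : quot_mod (smul M [in s]), u != 0.

Definition is_depth m M n : Prop :=
  (exists s, [/\ size s = n, {subset s <= (m : {pred R})} & regular_seq M s]) /\
  forall s, {subset s <= (m : {pred R})} -> regular_seq M s -> (size s <= n)%N.

(* is_depth forces M to be nonzero: the zero module is not Cohen-Macaulay. *)
Definition CM m M : Prop :=
  fin_gen M /\ exists n, is_dim M n /\ is_depth m M n.

Definition MCM m M : Prop :=
  CM m M /\ exists n, is_dim M n /\ is_dim R^o n.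

Definition injective_mod E : Prop :=
  forall (A B : lmodType R) (f : {linear A -> B}) (g : {linear A -> E}),
    injective f -> exists h : {linear B -> E}, forall x, h (f x) = g x.

Definition fin_inj_dim M : Prop :=
  exists (n : nat) (E : nat -> lmodType R) (e : {linear M -> E 0})
         (d : forall i, {linear E i -> E i.+1}),
    [/\ forall i, injective_mod (E i),
        forall i, (n < i)%N -> forall x : E i, x = 0,
        injective e,
        exact_at e (d 0)
      & forall i, exact_at (d i) (d i.+1)].

(* Ext^n(k, M), with k = R / m and n = depth M, is isomorphic to k^r, that is,
   it is of dimension r over k. *)
Definition is_type m M r : Prop :=
  exists2 n, is_depth m M n &
    exists f : {linear {ffun 'I_r -> quot_mod m} -> Ext (quot_mod m) M n},
      bijective f.

Definition canonical_module m M : Prop :=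
  [/\ MCM m M, is_type m M 1 & fin_inj_dim M].

(** * Delta invariants *)

Definition no_free_summand L : Prop :=
  forall n (N : lmodType R) (f : {linear ('rV[R]_n * N)%type -> L}),
    bijective f -> n = 0.

Section Delta.
Variables (m : submodule R^o) (M : lmodType R).

Definition in_MCM_image (y : M) : Prop :=
  exists (L : lmodType R) (phi : {linear L -> M}) (z : L),
    [/\ MCM m L, no_free_summand L & y = phi z].

Definition cm_pred : {pred M} := fun x =>
  `[< exists2 s : seq M, {in s, forall y, in_MCM_image y}
        & x = \sum_(y <- s) y >].

Lemma cm_closed : GRing.subsemimod_closed cm_pred.
Proof.
split; first split.
- by apply/asboolP; exists [::] => //; rewrite big_nil.
- move=> u v /asboolP[s sA ->] /asboolP[t tA ->]; apply/asboolP.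
  exists (s ++ t); last by rewrite big_cat.
  by move=> p; rewrite mem_cat => /orP[/sA|/tA].
- move=> a u /asboolP[s sA ->]; apply/asboolP.
  exists [seq a *: y | y <- s]; last by rewrite big_map scaler_sumr.
  move=> _ /mapP[y /sA[L [phi [z [Lcm Lf ->]]]] ->].
  by exists L, phi, (a *: z); split=> //; rewrite linearZ.
Qed.

Definition cm_part : submodule M := Submodule cm_closed.

Definition delta : nat := mu (quot_mod cm_part).

End Delta.

Definition delta_i m (i : nat) M : nat := delta m (syz M i).

End LocalAlgebra.

(* Main.v *)
From HB Require Import structures.
From mathcomp Require Import all_boot all_order all_algebra.
From mathcomp Require Import generic_quotient ring_quotient.
From mathcomp Require Import boolp classical_sets functions.
From mathcomp Require Import ring.
Require Import Defs.

(** Let d be the dimension of R, and let every module be finitely generated.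

    The statement is about depth only: if a module N has depth at least d,
    then all delta^i(N) with i >= 1 vanish (delta_i_eq0). Its syzygies again
    have depth at least d, so each of them is zero or maximal Cohen-Macaulay
    (depth_ge_MCM), and a positive syzygy L, contained in m F with F the free
    cover of N or of a syzygy of N, has no non-zero free summand. Indeed, let e
    generate a summand isomorphic to R and reduce everything modulo a sequence
    x of length d which is regular on R and on the cokernel F / L. Then L / xL
    still embeds in F / xF, and R / xR contains c <> 0 with m c = 0, because
    depth R = d. As e lies in m F, the image of c e in F / xF is 0; but c e is
    not 0 in the summand R / xR of L / xL (minimal_syzygy_retract).

    It remains to bound the depth of J omega and of I omega from below.
    Suppose that J omega = 0 :_omega I, which is Hom (R / I, omega), and that
    Ext^i (R / I, omega) = 0 for all i > 0. For x in m regular on omega, the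
    equality J omega = 0 :_omega I is inherited by omega / x omega, since
    homomorphisms R / I -> omega / x omega lift to omega; moreover
    x t in 0 :_omega I forces t in 0 :_omega I, so that x is regular on J omega
    and on omega / J omega, and both quotients by x are the corresponding
    modules of omega / x omega. By induction J omega and omega / J omega have
    depth at least d (depth_ge_colon).

    The vanishing of Ext^i (R / K, omega) whenever R / K has depth at least d
    is extS_zero_quotient. Reduce R and R / K by a common regular sequence of
    length d. Then R_d = R / xR has a non-zero socle, each element of m is
    nilpotent on it since dim R = d, and Ext^i (R_d, omega) = 0 for i > d
    because R_d has projective dimension at most d. From the finite injective
    dimension of omega, the vanishing of Ext^i (N, omega) for all cyclic
    modules N over R_d is pushed down to every i > d: it holds for the residue
    field, which embeds in R_d, and then for the others by Noetherian induction
    on annihilators. Nakayama's lemma for Ext lifts the vanishing back from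
    R_d / K R_d to R / K.

    This gives the first part. For the second one, omega / J omega also has
    depth at least d, and it is of finite Gorenstein dimension over S = R / J.
    This forces depth S >= d (Gres_depth_ge), which is half of the
    Auslander-Bridger formula. Dualizing a resolution by totally reflexive
    modules G_i gives a complex of modules N_i = Hom (G_i, S) with
    Ext^j (N_i, S) = 0 for j > 0 whose dual resolves M = omega / J omega, and
    this persists with S replaced by a quotient T = S / xS and M by M / xM, for
    x regular on both. If T had a non-zero socle, the complex N would be exact
    in positive degrees (dual_res_cycles), and M would be the dual of its
    lowest cycles, hence would have a non-zero socle too. So as long as M has
    positive depth, so has T. Then R / J has depth at least d and the previous
    arguments apply with I and J exchanged. *)

Set Implicit Arguments.
Unset Strict Implicit.
Unset Printing Implicit Defensive.

Import GRing.Theory.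
Local Open Scope ring_scope.
Local Open Scope quotient_scope.

(** * Linear maps, submodules and quotients *)

Section LinearAlgebra.
Variable A : comPzRingType.
Implicit Types (B E K L M N P Q T U V W : lmodType A).

(** Linear maps are produced through this existence statement, so that no
    structure has to be declared for maps built inside proofs. *)
Lemma linear_ex U V (f : U -> V) : linear f -> exists g : {linear U -> V}, g =1 f.
Proof.
move=> Hf; pose H := GRing.isLinear.Build A U V *:%R f Hf.
pose g : {linear U -> V} := HB.pack f H.
by exists g.
Qed.

Definition onto (U V : Type) (f : U -> V) := forall v, exists u, f u = v.

Lemma ker0_injective U V (f : {linear U -> V}) :
  (forall u, f u = 0 -> u = 0) -> injective f.
Proof.
by move=> H u v E; apply/subr0_eq/H; rewrite linearB E subrr.
Qed.

Lemma injective_ker0 U V (f : {linear U -> V}) u : injective f -> f u = 0 -> u = 0.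
Proof. by move=> H E; apply: H; rewrite E linear0. Qed.

Lemma factor_onto U V P (p : {linear U -> V}) (f : {linear U -> P}) : onto p ->
  (forall u, p u = 0 -> f u = 0) -> exists g : {linear V -> P}, forall u, g (p u) = f u.
Proof.
move=> ps H.
have [s ss] := choice ps.
have E u u' : p u = p u' -> f u = f u'.
  by move=> e; apply/subr0_eq; rewrite -linearB H // linearB e subrr.
have [|g gE] := @linear_ex V P (f \o s).
  by move=> a u v /=; rewrite -linearP; apply: E; rewrite linearP !ss.
by exists g => u; rewrite gE /=; apply: E; rewrite ss.
Qed.

Lemma factor_injective U V P (j : {linear U -> V}) (f : {linear P -> V}) : injective j ->
  (forall x, exists u, f x = j u) -> exists g : {linear P -> U}, forall x, j (g x) = f x.
Proof.
move=> ji H.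
have [s ss] := choice H.
have [|g gE] := @linear_ex P U s; last by exists g => x; rewrite gE -ss.
by move=> a x y; apply: ji; rewrite linearP -!ss linearP.
Qed.

(** Statements take arbitrary short exact sequences instead of kernels and
    quotients, which makes them invariant under isomorphism. *)
Record ses L M N (i : {linear L -> M}) (p : {linear M -> N}) : Prop := Ses {
  ses_inj : injective i;
  ses_onto : onto p;
  ses_exact : exact_at i p }.

Lemma ses_comp L M N (i : {linear L -> M}) (p : {linear M -> N}) :
  ses i p -> forall x, p (i x) = 0.
Proof. by case=> _ _ H x; apply/H; exists x. Qed.

Definition incl M (N : submodule M) : sub_mod N -> M := \val.
HB.instance Definition _ M (N : submodule M) := GRing.Linear.on (@incl M N).

Arguments incl {M} N.

Lemma incl_inj M (N : submodule M) : injective (incl N).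
Proof. exact: val_inj. Qed.

Lemma incl_in M (N : submodule M) u : incl N u \in N.
Proof. exact: (valP u). Qed.

Lemma incl_ex M (N : submodule M) u : u \in N -> exists v : sub_mod N, incl N v = u.
Proof. by move=> uN; exists (exist _ u uN). Qed.

Lemma mem_ker M N (f : {linear M -> N}) u : (u \in ker f) = (f u == 0).
Proof. by []. Qed.

Lemma mem_im M N (f : {linear M -> N}) v : v \in im f <-> exists u, v = f u.
Proof. by split=> /asboolP. Qed.

Lemma ker_ses M N (p : {linear M -> N}) : onto p -> ses (incl (ker p)) p.
Proof.
move=> ps; split=> // b; split; first by move/eqP => /(@incl_ex _ (ker p)) [v <-]; exists v.
by case=> v ->; apply/eqP; exact: (incl_in v).
Qed.

Definition qmap M (N : submodule M) : M -> quot_mod N :=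
  fun u => \pi_(@Quotient.quot _ (submod_pred N)) u.

Arguments qmap {M} N.

Lemma qmap_linear M (N : submodule M) : linear (qmap N).
Proof.
move=> a u v; have -> : a *: qmap N u = qmap N (a *: u) by exact: pi_scale.
have piD x y : qmap N x + qmap N y = qmap N (x + y) by rewrite /qmap [LHS]piE.
by rewrite piD.
Qed.
HB.instance Definition _ M (N : submodule M) :=
  GRing.isLinear.Build A M (quot_mod N) *:%R (@qmap M N) (@qmap_linear M N).

Lemma qmap_onto M (N : submodule M) : onto (qmap N).
Proof. by move=> v; exists (repr (v : @Quotient.quot _ (submod_pred N))); exact: reprK. Qed.

Lemma qmap_eq0 M (N : submodule M) u : (qmap N u = 0) <-> u \in N.
Proof.
rewrite -{2}[u]subr0 Quotient.idealrBE; split=> [E|/eqP E].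
  by apply/eqP; rewrite -/(qmap N u) E -[RHS]/(qmap N 0) linear0.
by rewrite -(linear0 (qmap N)); exact: E.
Qed.

Lemma qmap_ses M (N : submodule M) : ses (incl N) (qmap N).
Proof.
split; [exact: incl_inj|exact: qmap_onto|move=> u; split].
  by move=> /qmap_eq0 /incl_ex [v <-]; exists v.
by case=> v ->; apply/qmap_eq0; exact: incl_in.
Qed.

End LinearAlgebra.

Arguments incl {A M} N.
Arguments qmap {A M} N.

(** * Finitely generated and Noetherian modules *)

Section FiniteGeneration.
Variable A : comPzRingType.
Implicit Types (B E K L M N P Q T U V W : lmodType A).

Lemma linear_of_gens M n (g : 'I_n -> M) :
  exists f : {linear 'rV[A]_n -> M}, forall c, f c = \sum_i c 0 i *: g i.
Proof.
apply: linear_ex => a c c'; rewrite scaler_sumr -big_split; apply: eq_bigr => i _ /=.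
by rewrite !mxE scalerDl scalerA.
Qed.

Lemma linear_delta M n (f : {linear 'rV[A]_n -> M}) c :
  f c = \sum_i c 0 i *: f (delta_mx 0 i).
Proof.
rewrite {1}[c]row_sum_delta linear_sum; apply: eq_bigr => i _.
by rewrite linearZ.
Qed.

Lemma fgP M : fin_gen M <-> exists n (f : {linear 'rV[A]_n -> M}), onto f.
Proof.
split=> [[n /asboolP [g gg]]|[n [f fs]]].
  have [f fE] := linear_of_gens g; exists n, f => u; have [c ->] := gg u.
  by exists c; rewrite fE.
exists n; apply/asboolP; exists (fun i => f (delta_mx 0 i)) => u.
by have [c <-] := fs u; exists c; rewrite -linear_delta.
Qed.

Lemma fg_rV n : fin_gen 'rV[A]_n.
Proof. by apply/fgP; exists n, idfun => u; exists u. Qed.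

Definition projective P := forall E Q (p : {linear E -> Q}) (f : {linear P -> Q}),
  onto p -> exists g : {linear P -> E}, forall x, p (g x) = f x.

Lemma projective_free n : projective 'rV[A]_n.
Proof.
move=> E Q p f ps.
have [e eE] := choice (fun i => ps (f (delta_mx 0 i)) : exists _, _).
have [g gE] := linear_of_gens e; exists g => c.
rewrite gE linear_sum linear_delta; apply: eq_bigr => i _.
by rewrite linearZ /= eE.
Qed.

Lemma projective_regular : projective (A^o : lmodType A).
Proof.
move=> E Q p f ps; have [e eE] := ps (f (1 : A)).
have [|g gE] := @linear_ex A (A^o : lmodType A) E (fun a : A => a *: e).
  by move=> a b c; rewrite scalerDl scalerA.
exists g => a; rewrite gE linearZ /= eE -linearZ; congr (f _); exact: mulr1.
Qed.

Lemma fg_surj M N (f : {linear M -> N}) : onto f -> fin_gen M -> fin_gen N.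
Proof.
move=> fs /fgP [n [g gs]]; apply/fgP; exists n, (f \o g) => v.
by have [u <-] := fs v; have [c <-] := gs u; exists c.
Qed.

Lemma fg_ext L M N (i : {linear L -> M}) (p : {linear M -> N}) :
  onto p -> (forall u, p u = 0 -> exists v, u = i v) ->
  fin_gen L -> fin_gen N -> fin_gen M.
Proof.
move=> ps ex /fgP [n [f fs]] /fgP [k [g gs]].
have [h hE] := projective_free g ps.
apply/fgP; have [|F FE] := @linear_ex A 'rV[A]_(n + k) M
    (fun c => i (f (lsubmx c)) + h (rsubmx c)).
  by move=> a c c'; rewrite !linearP /= scalerDr addrACA.
exists (n + k)%N, F => u.
have [d dE] := gs (p u).
have [|l lE] := ex (u - h d); first by rewrite linearB hE dE subrr.
have [c cE] := fs l.
by exists (row_mx c d); rewrite FE row_mxKl row_mxKr cE -lE subrK.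
Qed.

(** This is the ascending chain condition in the form in which it passes to
    submodules, quotients and extensions. *)
Definition noethM M := forall N : submodule M, fin_gen (sub_mod N).

Lemma noeth_surj M N (f : {linear M -> N}) : onto f -> noethM M -> noethM N.
Proof.
move=> fs nM U.
have [|g gE] := @factor_injective A _ _ _ (incl U) (f \o incl (preim_sub f U)) (@incl_inj A N U).
  move=> x; have /= := incl_in x; rewrite unfold_in /= => /incl_ex [u uE].
  by exists u; rewrite /= uE.
apply: (fg_surj (f := g)) (nM (preim_sub f U)) => v.
have [u uE] := fs (incl U v).
have /incl_ex [w wE] : u \in preim_sub f U by rewrite unfold_in /= uE incl_in.
by exists w; apply: (@incl_inj A); rewrite gE /= wE.
Qed.

Lemma noeth_ext L M N (i : {linear L -> M}) (p : {linear M -> N}) :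
  ses i p -> noethM L -> noethM N -> noethM M.
Proof.
move=> [ii ps ex] nL nN U.
have [|j jE] := @factor_injective A _ _ _ (incl U) (i \o incl (preim_sub i U)) (@incl_inj A M U).
  move=> x; have /= := incl_in x; rewrite unfold_in /= => /incl_ex [u uE].
  by exists u; rewrite /= uE.
pose V := im (p \o incl U).
have [|q qE] := @factor_injective A _ _ _ (incl V) (p \o incl U) (@incl_inj A N V).
  move=> x; have : p (incl U x) \in V by apply/mem_im; exists x.
  by case/incl_ex => v vE; exists v.
apply: (fg_ext (i := j) (p := q)) (nL _) (nN _).
  move=> v; have /mem_im [u uE] := incl_in v; exists u.
  by apply: (@incl_inj A); rewrite qE -uE.
move=> u qu; have : p (incl U u) = 0 by rewrite -[LHS]/((p \o incl U) u) -qE qu linear0.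
case/ex => l lE.
have /incl_ex [w wE] : l \in preim_sub i U by rewrite unfold_in /= -lE incl_in.
by exists w; apply: (@incl_inj A); rewrite jE /= wE.
Qed.

Lemma noeth_fg M : noethM M -> fin_gen M.
Proof.
move=> nM; pose U := ker (\0 : {linear M -> M}).
apply: (fg_surj (f := incl U)) (nM U) => u.
by have /incl_ex : u \in U by exact/eqP.
Qed.

Lemma noeth_sub L M (i : {linear L -> M}) : injective i -> noethM M -> noethM L.
Proof.
move=> ii nM U.
pose W := im (i \o incl U).
have [||g gE] := @factor_injective A _ _ _ (i \o incl U) (incl W).
- by move=> u v /= /ii /incl_inj.
- by move=> x; have /mem_im [u uE] := incl_in x; exists u.
apply: (fg_surj (f := g)) (nM W) => u.
have /incl_ex [w wE] : i (incl U u) \in W by apply/mem_im; exists u.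
by exists w; apply: (@incl_inj A); apply: ii; exact: etrans (gE w) wE.
Qed.

Definition zero_mod M := forall u : M, u = 0.

Lemma fg_zero M : zero_mod M -> fin_gen M.
Proof. by move=> z; apply/fgP; exists 0, \0 => u; exists 0; rewrite [RHS]z. Qed.

Lemma noeth_zero M : zero_mod M -> noethM M.
Proof.
move=> z N; apply: fg_zero => u; apply: (@incl_inj A).
exact: etrans (z _) (esym (z _)).
Qed.

Lemma rV_ses n : exists (i : {linear 'rV[A]_n -> 'rV[A]_n.+1})
  (p : {linear 'rV[A]_n.+1 -> A^o}), ses i p.
Proof.
rewrite -add1n.
have [|i iE] := @linear_ex A 'rV[A]_n 'rV[A]_(1 + n) (fun c => row_mx 0 c).
  by move=> a c c'; rewrite scale_row_mx add_row_mx scaler0 addr0.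
have [|p pE] := @linear_ex A 'rV[A]_(1 + n) (A^o) (fun c => lsubmx c 0 0).
  by move=> a c c'; rewrite !mxE.
exists i, p; split.
- move=> c c' E; have : rsubmx (i c : 'rV_(1 + n)) = rsubmx (i c' : 'rV_(1 + n)) by rewrite E.
  by rewrite !iE !row_mxKr.
- move=> a; exists (row_mx a%:M 0); rewrite pE row_mxKl !mxE /=.
  by rewrite mulr1n.
- suff K (c : 'rV_(1 + n)) : p c = 0 <-> exists b, c = i b by exact: K.
  rewrite pE; split=> [c0|[c' ->]].
    exists (rsubmx c); rewrite iE -[LHS]hsubmxK; congr row_mx.
    by apply/rowP => k; rewrite ord1 c0 mxE.
  by rewrite iE row_mxKl mxE.
Qed.

Definition noeth_ring := noethM (A^o : lmodType A).

Hypothesis nA : noeth_ring.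

Lemma noeth_rV n : noethM 'rV[A]_n.
Proof.
elim: n => [|n IH]; first by apply: noeth_zero => u; apply/rowP; case.
have [i [p hs]] := rV_ses n; exact: noeth_ext hs IH nA.
Qed.

Lemma fg_noeth M : fin_gen M -> noethM M.
Proof. by case/fgP => n [f fs]; exact: noeth_surj fs (@noeth_rV n). Qed.

Lemma fg_inj L M (i : {linear L -> M}) : injective i -> fin_gen M -> fin_gen L.
Proof. by move=> ii /fg_noeth nM; apply: noeth_fg; exact: noeth_sub ii nM. Qed.

Lemma fg_sub M (N : submodule M) : fin_gen M -> fin_gen (sub_mod N).
Proof. by move=> /fg_noeth; exact. Qed.

Lemma fg_pair M N : fin_gen M -> fin_gen N -> fin_gen (M * N)%type.
Proof.
move=> fM fN.
have [|i iE] := @linear_ex A M (M * N)%type (fun u => (u, 0)).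
  by move=> a u v; apply: injective_projections; rewrite /= ?scaler0 ?addr0.
have [|p pE] := @linear_ex A (M * N)%type N (fun u => u.2) => //.
apply: (fg_ext (i := i) (p := p)) fM fN.
  by move=> v; exists (0, v); rewrite pE.
by move=> [u v]; rewrite pE /= => ->; exists u; rewrite iE.
Qed.

End FiniteGeneration.

Section NoetherianInduction.
Variable A : comPzRingType.
Implicit Types (M N : lmodType A).

(** Otherwise there would be a strictly increasing sequence of submodules;
    its union would have finitely many generators, all lying in one term of
    the sequence. *)
Lemma noeth_ind M (P : submodule M -> Prop) : noethM M ->
  (forall I : submodule M, (forall I' : submodule M, {subset I <= I'} ->
     (exists2 u, u \in I' & u \notin I) -> P I') -> P I) -> forall I, P I.
Proof.
move=> nM H I0; apply: contrapT => nP0.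
pose X := {I : submodule M | ~ P I}.
have step (I : X) : exists I' : X, {subset sval I <= sval I'} /\
    exists2 u, u \in sval I' & u \notin sval I.
  case: I => I /= nP; apply: contrapT => no; apply: nP; apply: H => I' sub ex.
  by apply: contrapT => nP'; apply: no; exists (exist _ I' nP').
have [f fE] := choice step.
pose J k := sval (iter k f (exist _ I0 nP0)).
have JS k : {subset J k <= J k.+1} by case: (fE (iter k f (exist _ I0 nP0))).
have Jle k l : (k <= l)%N -> {subset J k <= J l}.
  elim: l => [|l IH]; first by rewrite leqn0 => /eqP ->.
  by rewrite leq_eqVlt => /orP [/eqP -> //|/IH s] u /s /JS.
pose up : {pred M} := fun u => `[< exists k, u \in J k >].
have upc : GRing.subsemimod_closed up.
  split; first split.
  - by apply/asboolP; exists 0; exact: rpred0.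
  - move=> u v /asboolP [k uk] /asboolP [l vl]; apply/asboolP; exists (maxn k l).
    by apply: rpredD; [exact: (Jle _ _ (leq_maxl k l))|exact: (Jle _ _ (leq_maxr k l))].
  - by move=> a u /asboolP [k uk]; apply/asboolP; exists k; exact: rpredZ.
have /fgP [n [g gs]] := nM (Submodule upc).
have gen i : exists k, incl (Submodule upc) (g (delta_mx 0 i)) \in J k.
  by have := incl_in (g (delta_mx 0 i)) => /asboolP.
have [h hE] := choice gen.
pose K := \max_i h i.
have all u : u \in Submodule upc -> u \in J K.
  case/incl_ex => v <-; have [c <-] := gs v.
  rewrite linear_delta linear_sum; apply: rpred_sum => i _; rewrite linearZ /=.
  by apply: rpredZ; apply: (Jle (h i)); [exact: leq_bigmax|exact: hE].
case: (fE (iter K f (exist _ I0 nP0))) => _ [u uin /negP]; apply; apply: all.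
by apply/asboolP; exists K.+1.
Qed.

Definition add_cyclic_pred M (N : submodule M) (v : M) : {pred M} :=
  fun u => `[< exists a : A, u - a *: v \in N >].

Lemma add_cyclic_closed M (N : submodule M) v : GRing.subsemimod_closed (add_cyclic_pred N v).
Proof.
split; first split.
- by apply/asboolP; exists 0; rewrite scale0r subr0 rpred0.
- move=> x y /asboolP [a xa] /asboolP [b yb]; apply/asboolP; exists (a + b).
  by rewrite scalerDl opprD addrACA rpredD.
- move=> b x /asboolP [a xa]; apply/asboolP; exists (b * a).
  by rewrite -scalerA -scalerBr rpredZ.
Qed.
Definition add_cyclic M (N : submodule M) v := Submodule (add_cyclic_closed N v).

Lemma add_cyclic_sub M (N : submodule M) v : {subset N <= add_cyclic N v}.
Proof. by move=> u uN; apply/asboolP; exists 0; rewrite scale0r subr0. Qed.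

Lemma add_cyclic_mem M (N : submodule M) v : v \in add_cyclic N v.
Proof. by apply/asboolP; exists 1; rewrite scale1r subrr rpred0. Qed.

(** The last clause is the simplicity of M / Q: any element outside Q
    generates M modulo Q. *)
Lemma maximal_submod M (N : submodule M) : noethM M -> (exists u, u \notin N) ->
  exists Q : submodule M, [/\ {subset N <= Q}, exists v, v \notin Q &
    forall v, v \notin Q -> forall u, exists a : A, u - a *: v \in Q].
Proof.
move=> nM; move: N; apply: (noeth_ind nM) => N IH ne.
case: (pselect (exists2 v, v \notin N & exists u, u \notin add_cyclic N v)) => [[v vN eu]|no].
  case: (IH (add_cyclic N v)) => // [|| Q [s e mx]]; first exact: add_cyclic_sub.
    by exists v => //; exact: add_cyclic_mem.
  by exists Q; split=> // u /(@add_cyclic_sub _ N v) /s.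
exists N; split=> // v vN u; apply: contrapT => nu; apply: no; exists v => //.
by exists u; apply/negP => /asboolP.
Qed.

End NoetherianInduction.

(** Stated over comPzRingType, so that R / J qualifies when J is proper;
    maximality of m enters only as invertibility of the elements outside m. *)
Record noeth_local (A : comPzRingType) (m : submodule A^o) : Prop := NoethLocal {
  local_noeth : noeth_ring A;
  local_proper : (1 : A^o) \notin m;
  local_unit : forall a : A, (a : A^o) \notin m -> exists b : A, b * a = 1 }.

(** * Nakayama's lemma *)

Section Local.
Variables (A : comPzRingType) (m : submodule A^o).
Hypothesis lA : noeth_local m.
Implicit Types (B E K L M N P Q T U V W : lmodType A).

Lemma cancel_unit M (N : submodule M) (a : A) u :
  (a : A^o) \notin m -> a *: u \in N -> u \in N.
Proof.
move=> /(local_unit lA) [b ba] /(rpredZ b); by rewrite scalerA ba scale1r.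
Qed.

Lemma m_mulr (a b : A) : (a : A^o) \in m -> (b * a : A^o) \in m.
Proof. exact: (rpredZ b). Qed.

Lemma m_mull (a b : A) : (a : A^o) \in m -> (a * b : A^o) \in m.
Proof. by rewrite mulrC; exact: m_mulr. Qed.

Lemma m_one_sub (a : A) : (a : A^o) \in m -> (1 - a : A^o) \notin m.
Proof.
move=> am; apply: contra (local_proper lA) => H.
by rewrite -[1](subrK (a : A^o)); exact: rpredD.
Qed.

Lemma cancel_m M (N : submodule M) (a : A) u :
  (a : A^o) \in m -> u - a *: u \in N -> u \in N.
Proof.
move=> /m_one_sub am; rewrite -{1}[u]scale1r -scalerBl; exact: cancel_unit.
Qed.

(** The simple module M / Q is killed by m: if a u were outside Q, then u
    would be b a u modulo Q, and 1 - b a is invertible. *)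
Lemma maximal_submod_m M (Q : submodule M) :
  (forall v, v \notin Q -> forall u, exists a : A, u - a *: v \in Q) ->
  forall (a : A) u, (a : A^o) \in m -> a *: u \in Q.
Proof.
move=> mx a u am; apply: contrapT => /negP no.
have [b] := mx _ no u; rewrite scalerA => H.
by move/negP: no; apply; apply: rpredZ; apply: cancel_m H; exact: m_mulr.
Qed.

(** If N were proper, it would lie in a maximal submodule Q, which contains
    m M, hence M. *)
Lemma nakayama M (N : submodule M) : fin_gen M ->
  (forall u, exists2 v, v \in N & u - v \in smul M m) -> forall u, u \in N.
Proof.
move=> fM H u; apply: contrapT => /negP uN.
have [|Q [NQ [v vQ] mx]] := maximal_submod (fg_noeth (local_noeth lA) fM) (N := N).
  by exists u.
have [w wN /asboolP [s sm E]] := H v; move/negP: vQ; apply.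
rewrite -[v](subrK w) E; apply: rpredD; last exact: NQ.
rewrite big_seq; apply: rpred_sum => -[a t] /sm /= am; exact: (maximal_submod_m mx).
Qed.

Lemma nakayama_mul M (x : A) (N : submodule M) : fin_gen M -> (x : A^o) \in m ->
  (forall u, exists2 v, v \in N & exists t, u - v = x *: t) -> forall u, u \in N.
Proof.
move=> fM xm H; apply: nakayama fM _ => u; have [v vN [t E]] := H u.
by exists v => //; rewrite E; exact: mem_smul.
Qed.

Definition zero_sub M : submodule M := ker (idfun : {linear M -> M}).
Lemma zero_subP M (u : M) : (u \in zero_sub M) = (u == 0). Proof. by []. Qed.

Lemma nakayama0 M (x : A) : fin_gen M -> (x : A^o) \in m ->
  (forall u : M, exists t, u = x *: t) -> zero_mod M.
Proof.
move=> fM xm H u; apply/eqP; rewrite -zero_subP; apply: (nakayama_mul fM xm) => {}u.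
exists 0; first exact: rpred0.
by have [t ->] := H u; exists t; rewrite subr0.
Qed.

(** The quotient of M by a maximal submodule containing N is the residue
    field, which maps onto the submodule generated by the socle element c. *)
Lemma residue_hom M T (N : submodule M) (c : T) : fin_gen M ->
  (exists u, u \notin N) -> (forall a : A, (a : A^o) \in m -> a *: c = 0) ->
  exists h : {linear M -> T}, [/\ forall u, u \in N -> h u = 0,
    exists v, h v = c & forall (a : A) u, (a : A^o) \in m -> a *: h u = 0].
Proof.
move=> fM ne mc.
have [Q [NQ [v vQ] mx]] := maximal_submod (fg_noeth (local_noeth lA) fM) ne.
have [|p pE] := @linear_ex A (sub_mod Q * A^o)%type M (fun z => incl Q z.1 + z.2 *: v).
  by move=> a [x b] [y d] /=; rewrite linearP scalerDl scalerDr !scalerA addrACA.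
have [|f fE] := @linear_ex A (sub_mod Q * A^o)%type T (fun z => z.2 *: c).
  by move=> a [x b] [y d] /=; rewrite scalerDl !scalerA.
have ps : onto p.
  move=> u; have [a /incl_ex [q qE]] := mx v vQ u; exists (q, a : A^o).
  by rewrite pE /= qE subrK.
have [|h hE] := factor_onto (f := f) ps.
  move=> [q a]; rewrite pE fE /= => /eqP; rewrite addrC addr_eq0 => /eqP E.
  case: (boolP ((a : A^o) \in m)) => [/mc //|/cancel_unit].
  move=> /(_ _ Q v); rewrite E => H; move/negP: vQ; case; apply: H.
  by rewrite rpredN incl_in.
exists h; split.
- move=> u /NQ /incl_ex [q <-]; have := hE (q, 0); rewrite pE fE /= scale0r addr0 => ->.
  by rewrite scale0r.
- by exists v; have := hE (0, 1 : A^o); rewrite pE fE /= linear0 add0r !scale1r.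
- move=> a u am; have [z <-] := ps u; rewrite hE fE scalerA mulrC -scalerA mc //.
  by rewrite scaler0.
Qed.

End Local.

(** * Regular elements and reduction *)

Section Regular.
Variable A : comPzRingType.
Implicit Types (x y z : A) (B E F K L M N P Q R T U V W Y : lmodType A).

Definition regular_on (x : A) M := forall u : M, x *: u = 0 -> u = 0.

(** The map q identifies Q with M / xM. Quotients are handled up to
    isomorphism in this way, which avoids comparing iterated quotients such
    as (M / xM) / z(M / xM) and (M / zM) / x(M / zM). *)
Record is_reduction (x : A) M Q (q : {linear M -> Q}) : Prop := IsReduction {
  reduction_onto : onto q;
  reduction_ker : forall u, q u = 0 <-> exists v, u = x *: v }.

Lemma reduction_ex (x : A) M : exists Q (q : {linear M -> Q}), is_reduction x q.
Proof.
have [f fE] : exists f : {linear M -> M}, forall u, f u = x *: u.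
  by apply: linear_ex => a u v; rewrite scalerDr !scalerA mulrC.
exists (quot_mod (im f)), (qmap (im f)); split; first exact: qmap_onto.
move=> u; split=> [/qmap_eq0 /mem_im [v ->]|[v ->]]; first by exists v.
by apply/qmap_eq0/mem_im; exists v.
Qed.

Lemma reduction_mul x M Q (q : {linear M -> Q}) v : is_reduction x q -> q (x *: v) = 0.
Proof. by move=> h; apply/(reduction_ker h); exists v. Qed.

Lemma reduction_map x M N Q R (q : {linear M -> Q}) (r : {linear N -> R}) (f : {linear M -> N}) :
  is_reduction x q -> is_reduction x r -> exists g : {linear Q -> R}, forall u, g (q u) = r (f u).
Proof.
move=> hq hr; have [|g gE] := factor_onto (f := r \o f) (reduction_onto hq); last by exists g.
by move=> u /(reduction_ker hq) [v ->] /=; rewrite linearZ reduction_mul.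
Qed.

Lemma reduction_swap x z M Q W V (q : {linear M -> Q}) (w : {linear M -> W}) (v : {linear Q -> V}) :
  is_reduction x q -> is_reduction z w -> is_reduction z v ->
  exists2 g : {linear W -> V}, is_reduction x g & forall u, g (w u) = v (q u).
Proof.
move=> hq hw hv; have [g gE] := reduction_map q hw hv; exists g => //; split=> [t|].
  have [s <-] := reduction_onto hv t; have [u <-] := reduction_onto hq s.
  by exists (w u); rewrite gE.
move=> t; have [u <-] := reduction_onto hw t; rewrite gE; split; last first.
  case=> t'; have [u' <-] := reduction_onto hw t'.
  rewrite -linearZ => /eqP; rewrite -subr_eq0 -linearB => /eqP /(reduction_ker hw) [s].
  move=> /eqP; rewrite subr_eq => /eqP ->.
  by rewrite (linearD q) (reduction_mul u' hq) addr0 linearZ /= (reduction_mul _ hv).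
move=> /(reduction_ker hv) [s]; have [u' <-] := reduction_onto hq s.
rewrite -linearZ => /eqP; rewrite -subr_eq0 -linearB => /eqP /(reduction_ker hq) [s'].
move=> /eqP; rewrite subr_eq => /eqP ->; exists (w s').
by rewrite linearD linearZ reduction_mul // addr0.
Qed.

(** Together with reduction_swap, this permutes the regular sequence x, z. *)
Lemma regular_swap x z M Q W (q : {linear M -> Q}) (w : {linear M -> W}) :
  is_reduction x q -> is_reduction z w -> regular_on x M -> regular_on z Q -> regular_on x W.
Proof.
move=> hq hw rM rQ t; have [u <-] := reduction_onto hw t; rewrite -linearZ.
move=> /(reduction_ker hw) [v E].
have /(reduction_ker hq) [v' vE] : q v = 0 by apply: rQ; rewrite -linearZ -E reduction_mul.
apply/(reduction_ker hw); exists v'; apply/subr0_eq/rM.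
by rewrite scalerBr E vE !scalerA mulrC subrr.
Qed.

(** Reduction modulo x keeps a short exact sequence exact as soon as x is
    regular on the cokernel, which is the vanishing of Tor_1 (N, A / x). *)
Lemma ses_reduction x L M N L' M' N' (i : {linear L -> M}) (p : {linear M -> N})
    (l : {linear L -> L'}) (q : {linear M -> M'}) (r : {linear N -> N'}) :
  ses i p -> regular_on x N -> is_reduction x l -> is_reduction x q -> is_reduction x r ->
  exists i' p', [/\ @ses A L' M' N' i' p', forall u, i' (l u) = q (i u)
    & forall u, p' (q u) = r (p u)].
Proof.
move=> hs rN hl hq hr.
have [i' iE] := reduction_map i hl hq; have [p' pE] := reduction_map p hq hr.
exists i', p'; split=> //; split.
- apply: ker0_injective => t; have [u <-] := reduction_onto hl t.
  rewrite iE => /(reduction_ker hq) [v E].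
  have /(ses_exact hs) [w wE] : p v = 0 by apply: rN; rewrite -linearZ -E (ses_comp hs).
  apply/(reduction_ker hl); exists w; apply: (ses_inj hs).
  by rewrite E wE linearZ.
- move=> t; have [s <-] := reduction_onto hr t; have [u <-] := ses_onto hs s.
  by exists (q u); rewrite pE.
- move=> t; have [u <-] := reduction_onto hq t; rewrite pE; split; last first.
    case=> s; have [v <-] := reduction_onto hl s; rewrite iE => /eqP.
    rewrite -subr_eq0 -linearB => /eqP /(reduction_ker hq) [y] /eqP; rewrite subr_eq => /eqP ->.
    by rewrite linearD (ses_comp hs) addr0 linearZ reduction_mul.
  move=> /(reduction_ker hr) [n]; have [y <-] := ses_onto hs n; rewrite -linearZ => /eqP.
  rewrite -subr_eq0 -linearB => /eqP /(ses_exact hs) [s] /eqP; rewrite subr_eq => /eqP ->.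
  by exists (l s); rewrite linearD reduction_mul // addr0 iE.
Qed.

End Regular.

(** * Depth *)

Section Depth.
Variables (A : comPzRingType) (m : submodule A^o).
Hypothesis lA : noeth_local m.
Implicit Types (x y z : A) (B E F K L M N P Q R T U V W Y : lmodType A).

Definition socfree M := forall u : M, (forall a : A, (a : A^o) \in m -> a *: u = 0) -> u = 0.

Section Avoidance.
Variable M : lmodType A.

(** The annihilator of w is maximal among annihilators of non-zero elements;
    it is then an associated prime. *)
Definition maxann (w : M) := w <> 0 /\ forall v : M, v <> 0 ->
  (forall a : A, a *: w = 0 -> a *: v = 0) -> forall a : A, a *: v = 0 -> a *: w = 0.

Lemma orbit_map (u : M) : exists f : {linear A^o -> M}, forall a : A, f a = a *: u.
Proof. by apply: linear_ex => a b c; rewrite scalerDl scalerA. Qed.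

Lemma maxann_ex (u : M) : u <> 0 ->
  exists2 w, maxann w & forall a : A, a *: u = 0 -> a *: w = 0.
Proof.
suff H (I : submodule A^o) : forall u : M, u <> 0 ->
    (forall a : A, (a : A^o) \in I <-> a *: u = 0) ->
    exists2 w, maxann w & forall a : A, a *: u = 0 -> a *: w = 0.
  move=> u0; have [f fE] := orbit_map u; apply: (H (ker f)) u0 _ => a.
  by rewrite mem_ker fE; split=> /eqP.
move: I; apply: (noeth_ind (local_noeth lA)) => I IH {}u u0 uI.
case: (pselect (maxann u)) => [mu|nmu]; first by exists u.
have [v [v0 uv [b bv bu]]] : exists v : M, [/\ v <> 0,
    forall a : A, a *: u = 0 -> a *: v = 0 & exists2 b : A, b *: v = 0 & b *: u <> 0].
  apply: contrapT => no; apply: nmu; split=> // v v0 uv a av; apply: contrapT => au.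
  by apply: no; exists v; split=> //; exists a.
have [f fE] := orbit_map v.
suff [w mw vw] : exists2 w, maxann w & forall a : A, a *: v = 0 -> a *: w = 0.
  by exists w => // a /uv /vw.
apply: (IH (ker f)) v0 _.
- by move=> a /uI /uv; rewrite -fE mem_ker => ->.
- exists (b : A^o); first by rewrite mem_ker fE bv.
  by apply/negP => /uI.
- by move=> a; rewrite mem_ker fE; split=> /eqP.
Qed.

Lemma maxann_prime w (a b : A) : maxann w -> a *: w <> 0 -> b *: w <> 0 -> (a * b) *: w <> 0.
Proof.
move=> [w0 mw] aw bw abw; apply: aw; apply: (mw (b *: w)) => //.
- by move=> c cw; rewrite scalerA mulrC -scalerA cw scaler0.
- by rewrite scalerA.
Qed.

(** Each annihilator contributes an element outside the prime ideal ann w,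
    and the product of these elements is still outside. *)
Lemma maxann_prod w (s : seq M) : maxann w ->
  (forall u, u \in s -> exists2 c : A, c *: u = 0 & c *: w <> 0) ->
  exists2 y : A, y *: w <> 0 & forall u, u \in s -> y *: u = 0.
Proof.
move=> mw; elim: s => [|v s IH] H; first by exists 1 => //; rewrite scale1r; case: mw.
have [u us|y yw ys] := IH; first by apply: H; rewrite inE us orbT.
have [c cv cw] := H v (mem_head _ _).
exists (y * c); first exact: maxann_prime.
move=> u; rewrite inE => /orP [/eqP ->|us]; first by rewrite -scalerA cv scaler0.
by rewrite mulrC -scalerA ys // scaler0.
Qed.

Lemma maxann_sym u v (x : A) : maxann u -> maxann v -> x *: u <> 0 -> x *: v = 0 ->
  exists2 c : A, c *: u = 0 & c *: v <> 0.
Proof.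
move=> [_ mu] [v0 _] xu xv; apply: contrapT => no; apply: xu; apply: (mu v) => // a au.
by apply: contrapT => av; apply: no; exists a.
Qed.

(** Prime avoidance for the ideal m and the primes ann u with u in s. Such
    primes, being maximal annihilators, are equal or incomparable, so an
    element x of ann u avoiding the others can be corrected by an element of
    m and of the other primes that is not in ann u. *)
Lemma maxann_avoid (s : seq M) : socfree M -> (forall u, u \in s -> maxann u) ->
  exists2 x : A, (x : A^o) \in m & forall u, u \in s -> x *: u <> 0.
Proof.
move=> sf; elim: s => [|u s IH] H; first by exists 0 => //; exact: rpred0.
have [v vs|x xm xs] := IH; first by apply: H; rewrite inE vs orbT.
have mu : maxann u by apply: H; exact: mem_head.
case: (pselect (x *: u = 0)) => [xu|]; last first.
  by exists x => // v; rewrite inE => /orP [/eqP ->|/xs].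
have [v vs|y yu ys] := @maxann_prod u s mu.
  by apply: (maxann_sym (x := x)) => //; [apply: H; rewrite inE vs orbT|exact: xs].
have [a am au] : exists2 a : A, (a : A^o) \in m & a *: u <> 0.
  apply: contrapT => no; case: mu => u0 _; apply: u0; apply: sf => a am.
  by apply: contrapT => au; apply: no; exists a.
(* y kills the members of s but not u, and a in m does not kill u either *)
exists (x + a * y); first by apply: rpredD => //; exact: (m_mull _ am).
move=> v; rewrite inE scalerDl => /orP [/eqP ->|vs].
  by rewrite xu add0r; exact: maxann_prime.
by rewrite -[(a * y) *: v]scalerA ys // scaler0 addr0; exact: xs.
Qed.

(** Maximal annihilators are finite in number: the submodule generated by
    all w as in maxann is generated by finitely many of them, and then the
    intersection of their annihilators lies in ann w for each w. *)
Lemma maxann_fin : fin_gen M -> exists2 s : seq M, forall u, u \in s -> maxann u &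
  forall w, maxann w -> forall a : A, (forall u, u \in s -> a *: u = 0) -> a *: w = 0.
Proof.
move=> fM; have nM := fg_noeth (local_noeth lA) fM.
suff H (N : submodule M) : forall s : seq M, (forall u, u \in s -> maxann u) ->
    (forall a : A, (forall u, u \in s -> a *: u = 0) -> forall u, u \in N -> a *: u = 0) ->
    exists2 s : seq M, forall u, u \in s -> maxann u &
    forall w, maxann w -> forall a : A, (forall u, u \in s -> a *: u = 0) -> a *: w = 0.
  apply: (H (zero_sub M) [::]) => // a _ u; rewrite zero_subP => /eqP ->; exact: scaler0.
move: N; apply: (noeth_ind nM) => N IH s sm sN.
case: (pselect (exists2 w, maxann w & w \notin N)) => [[w mw wN]|no]; last first.
  exists s => // w mw a /sN; apply; apply: contrapT => wN; apply: no.
  by exists w => //; exact/negP.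
apply: (IH (add_cyclic N w) _ _ (w :: s)); first exact: add_cyclic_sub.
- by exists w => //; exact: add_cyclic_mem.
- by move=> u; rewrite inE => /orP [/eqP ->|/sm].
move=> a as0 u /asboolP [b]; have aw := as0 w (mem_head _ _).
move/sN => /(_ a); rewrite scalerBr scalerA mulrC -scalerA aw scaler0 subr0; apply.
by move=> v vs; apply: as0; rewrite inE vs orbT.
Qed.

(** Zero divisors on M lie in maximal annihilators. By maxann_fin finitely
    many of these matter, none contains m, and an element of m avoiding them
    is regular. *)
Lemma regular_ex : fin_gen M -> socfree M -> exists2 x : A, (x : A^o) \in m & regular_on x M.
Proof.
move=> /maxann_fin [s sm sw] sf; have [x xm xs] := maxann_avoid sf sm.
exists x => // v xv; apply: contrapT => /maxann_ex [w mw /(_ x xv) xw].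
have [u us|y yw ys] := @maxann_prod w s mw; last by apply: yw; exact: sw.
by apply: (maxann_sym (x := x)) => //; [exact: sm|exact: xs].
Qed.

End Avoidance.

Lemma regular_socfree M (x : A) : (x : A^o) \in m -> regular_on x M -> socfree M.
Proof. by move=> xm xr u H; apply: xr; exact: H. Qed.

(** The single-module case applied to the direct sum. *)
Lemma regular_ex2 M N : fin_gen M -> fin_gen N -> socfree M -> socfree N ->
  exists x : A, [/\ (x : A^o) \in m, regular_on x M & regular_on x N].
Proof.
move=> fM fN sM sN; have [|x xm xr] := regular_ex (fg_pair fM fN).
  move=> [u v] H; congr (_, _); [apply: sM|apply: sN] => a am.
    by have := congr1 fst (H a am).
  by have := congr1 snd (H a am).
exists x; split=> // u xu.
  by have := congr1 fst (xr (u, 0) (injective_projections (_, _) 0 xu (scaler0 _ _))).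
by have := congr1 snd (xr (0, u) (injective_projections (_, _) 0 (scaler0 _ _) xu)).
Qed.

Lemma regular_ex3 M N P : fin_gen M -> fin_gen N -> fin_gen P ->
  socfree M -> socfree N -> socfree P ->
  exists x : A, [/\ (x : A^o) \in m, regular_on x M, regular_on x N & regular_on x P].
Proof.
move=> fM fN fP sM sN sP.
have [y [ym yM yN]] := regular_ex2 fM fN sM sN.
have [|x [xm xMN xP]] := regular_ex2 (fg_pair fM fN) fP _ sP.
  apply: (regular_socfree ym) => -[u v] E; congr (_, _); [apply: yM|apply: yN].
    by have := congr1 fst E.
  by have := congr1 snd E.
exists x; split=> // u xu.
  by have := congr1 fst (xMN (u, 0) (injective_projections (_, _) 0 xu (scaler0 _ _))).
by have := congr1 snd (xMN (0, u) (injective_projections (_, _) 0 (scaler0 _ _) xu)).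
Qed.

(** Quotients are not required to be non-zero, so the zero module has every
    depth. *)
Fixpoint depth_ge (n : nat) M : Prop :=
  if n is n'.+1 then exists x : A, [/\ (x : A^o) \in m, regular_on x M &
    exists Q (q : {linear M -> Q}), is_reduction x q /\ depth_ge n' Q]
  else True.

Lemma depth_ge_socfree n M : depth_ge n.+1 M -> socfree M.
Proof. by case=> x [xm xr _]; exact: regular_socfree xm xr. Qed.

Lemma depth_ge_zero n M : zero_mod M -> depth_ge n M.
Proof.
elim: n M => // n IH M z; exists 0; split; [exact: rpred0|by move=> u|].
have [Q [q hq]] := reduction_ex 0 M; exists Q, q; split=> //; apply: IH => v.
by have [u <-] := reduction_onto hq v; rewrite [u]z linear0.
Qed.

Lemma reduction_fg x M Q (q : {linear M -> Q}) : is_reduction x q -> fin_gen M -> fin_gen Q.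
Proof. by move=> h; apply: fg_surj (reduction_onto h). Qed.

(** M / xM and M / yM have isomorphic socles, both being Ext^1 of the
    residue field into M: if m u lies in xM and y u = x v, then m v lies in
    yM. *)
Lemma soc_exchange x y M Q R (q : {linear M -> Q}) (r : {linear M -> R}) :
  (x : A^o) \in m -> (y : A^o) \in m -> regular_on x M -> regular_on y M ->
  is_reduction x q -> is_reduction y r ->
  socfree R -> socfree Q.
Proof.
move=> xm ym xr yr hq hr sR t; have [u <-] := reduction_onto hq t => H.
have K (a : A) : (a : A^o) \in m -> exists v, a *: u = x *: v.
  by move=> /H; rewrite -linearZ => /(reduction_ker hq).
have [v vE] := K y ym.
have /(reduction_ker hr) [v' v'E] : r v = 0.
  apply: sR => a /K [w wE]; rewrite -linearZ; apply/(reduction_ker hr); exists w.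
  have scC (b c : A) (t' : M) : b *: (c *: t') = c *: (b *: t') by rewrite !scalerA mulrC.
  apply/subr0_eq/xr; rewrite scalerBr scC -vE scC wE [y *: _]scC.
  by rewrite subrr.
apply/(reduction_ker hq); exists v'; apply/subr0_eq/yr.
by rewrite scalerBr vE v'E !scalerA mulrC subrr.
Qed.

(** All maximal regular sequences have the same length. If y starts a
    sequence of length n + 2 and x is regular, then M / xM has no socle by
    exchange, so some z is regular on both M / xM and M / yM; the claim for
    M / yM and then for M / zM allows y to be replaced by x. *)
Lemma depth_ge_reduction n M x Q (q : {linear M -> Q}) : fin_gen M -> depth_ge n.+1 M ->
  (x : A^o) \in m -> regular_on x M -> is_reduction x q -> depth_ge n Q.
Proof.
elim: n M x Q q => // n IH M x Q q fM [y [ym yM [R [r [hr dR]]]]] xm xM hq.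
have sR := depth_ge_socfree dR.
have sQ := soc_exchange xm ym xM yM hq hr sR.
(* z is regular on both quotients, so it can follow either x or y *)
have [z [zm zQ zR]] := regular_ex2 (reduction_fg hq fM) (reduction_fg hr fM) sQ sR.
have [W [w hw]] := reduction_ex z M.
have [R' [r' hr']] := reduction_ex z R; have [V [v hv]] := reduction_ex z Q.
have dR' := IH _ _ _ _ (reduction_fg hr fM) dR zm zR hr'.
have [g hg _] := reduction_swap hr hw hr'.
have dW : depth_ge n.+1 W.
  by exists y; split=> //; [exact: regular_swap hr hw yM zR|exists R', g].
have [h hh _] := reduction_swap hq hw hv.
exists z; split=> //; exists V, v; split=> //.
exact: IH (reduction_fg hw fM) dW xm (regular_swap hq hw xM zQ) hh.
Qed.

(** Depth of a syzygy: a common regular element keeps the sequence exact. *)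
Lemma depth_ge_ker n L F N (i : {linear L -> F}) (p : {linear F -> N}) :
  ses i p -> fin_gen F -> depth_ge n F -> depth_ge n N -> depth_ge n L.
Proof.
elim: n L F N i p => // n IH L F N i p hs fF dF dN.
have fN := fg_surj (ses_onto hs) fF.
have [x [xm xF xN]] := regular_ex2 fF fN (depth_ge_socfree dF) (depth_ge_socfree dN).
have [L' [l hl]] := reduction_ex x L; have [F' [f hf]] := reduction_ex x F.
have [N' [r hr]] := reduction_ex x N.
have [i' [p' [hs' _ _]]] := ses_reduction hs xN hl hf hr.
exists x; split=> // [u xu|].
  by apply: (injective_ker0 (ses_inj hs)); apply: xF; rewrite -linearZ xu linear0.
exists L', l; split=> //; apply: IH hs' (reduction_fg hf fF) _ _.
  exact: depth_ge_reduction dF xm xF hf.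
exact: depth_ge_reduction dN xm xN hr.
Qed.

Lemma depth_ge_ext n L F N (i : {linear L -> F}) (p : {linear F -> N}) :
  ses i p -> fin_gen L -> fin_gen N -> depth_ge n L -> depth_ge n N -> depth_ge n F.
Proof.
elim: n L F N i p => // n IH L F N i p hs fL fN dL dN.
have [x [xm xL xN]] := regular_ex2 fL fN (depth_ge_socfree dL) (depth_ge_socfree dN).
have [L' [l hl]] := reduction_ex x L; have [F' [f hf]] := reduction_ex x F.
have [N' [r hr]] := reduction_ex x N.
have [i' [p' [hs' _ _]]] := ses_reduction hs xN hl hf hr.
exists x; split=> // [u xu|].
  have pu : p u = 0 by apply: xN; rewrite -linearZ xu linear0.
  case/(ses_exact hs): pu xu => v ->; rewrite -linearZ => /(injective_ker0 (ses_inj hs)).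
  by move=> /xL ->; rewrite linear0.
exists F', f; split=> //; apply: IH hs' (reduction_fg hl fL) (reduction_fg hr fN) _ _.
  exact: depth_ge_reduction dL xm xL hl.
exact: depth_ge_reduction dN xm xN hr.
Qed.

Lemma depth_ge_rV n k : depth_ge n (A^o : lmodType A) -> depth_ge n 'rV[A]_k.
Proof.
move=> dA; elim: k => [|k IH]; first by apply: depth_ge_zero => u; apply/rowP; case.
have [i [p hs]] := rV_ses A k; apply: depth_ge_ext hs _ _ IH dA.
  by apply: noeth_fg; exact: noeth_rV (local_noeth lA) _.
by apply: noeth_fg; exact: local_noeth lA.
Qed.

(** The reason why a syzygy L in m F has no free summand when N is deep.
    Here e is the generator of a summand, Y (equal to A before any
    reduction) is the summand with projection r, and the maps psi j embed Y
    as the coordinates of F. Reducing modulo a regular element of both Y and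
    N preserves all hypotheses. At the end, a socle element b r(e) of Y
    would make b e vanish in F, hence in L. *)
Lemma minimal_syzygy_retract n L F N Y (i : {linear L -> F}) (p : {linear F -> N})
    (e : L) (r : {linear L -> Y}) k (a : 'I_k -> A) (psi : 'I_k -> {linear Y -> F}) :
  ses i p -> fin_gen F -> fin_gen Y -> (forall y : Y, exists b : A, y = b *: r e) ->
  (forall j, (a j : A^o) \in m) -> i e = \sum_j a j *: psi j (r e) ->
  depth_ge n Y -> depth_ge n N -> depth_ge n.+1 Y.
Proof.
elim: n L F N Y i p e r psi => [|n IH] L F N Y i p e r psi hs fF fY gY am iE dY dN.
  have [|x xm xY] := regular_ex fY.
    move=> y my; have [b bE] := gY y.
    suff /(injective_ker0 (ses_inj hs)) be : i (b *: e) = 0 by rewrite bE -linearZ be linear0.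
    rewrite linearZ /= iE scaler_sumr big1 // => j _.
    have -> : b *: (a j *: psi j (r e)) = psi j (a j *: (b *: r e)).
      by rewrite !linearZ /= !scalerA mulrC.
    by rewrite -bE my // linear0.
  exists x; split=> //; have [Q [q hq]] := reduction_ex x Y; by exists Q, q.
have fN := fg_surj (ses_onto hs) fF.
have [x [xm xY xN]] := regular_ex2 fY fN (depth_ge_socfree dY) (depth_ge_socfree dN).
have [L' [l hl]] := reduction_ex x L; have [F' [f hf]] := reduction_ex x F.
have [N' [t ht]] := reduction_ex x N; have [Y' [y hy]] := reduction_ex x Y.
have [i' [p' [hs' iE' _]]] := ses_reduction hs xN hl hf ht.
have [r' rE] := reduction_map r hl hy.
have [psi' psiE] := choice (fun j => reduction_map (psi j) hy hf).
exists x; split=> //; exists Y', y; split=> //.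
apply: (IH L' F' N' Y' i' p' (l e) r' psi') => //.
- exact: reduction_fg hf fF.
- exact: reduction_fg hy fY.
- move=> v; have [u <-] := reduction_onto hy v; have [b ->] := gY u.
  by exists b; rewrite linearZ rE.
- rewrite iE' iE linear_sum; apply: eq_bigr => j _.
  by rewrite linearZ /= rE psiE.
- exact: depth_ge_reduction dY xm xY hy.
- exact: depth_ge_reduction dN xm xN ht.
Qed.

End Depth.

(** * Vanishing of Ext *)

Section Extensions.
Variable A : comPzRingType.
Implicit Types (B C D E F K L M N P Q R T U V W X Y Z : lmodType A).

Lemma linear_pair X Y Z (f : {linear X -> Z}) (g : {linear Y -> Z}) :
  exists h : {linear (X * Y)%type -> Z}, forall z, h z = f z.1 + g z.2.
Proof. by apply: linear_ex => a u v; rewrite !linearP scalerDr addrACA. Qed.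

Lemma linear_copair X Y Z (f : {linear Z -> X}) (g : {linear Z -> Y}) :
  exists h : {linear Z -> (X * Y)%type}, forall z, h z = (f z, g z).
Proof. by apply: linear_ex => a u v; rewrite !linearP. Qed.

Lemma linear_diff X Y (f g : {linear X -> Y}) :
  exists h : {linear X -> Y}, forall z, h z = f z - g z.
Proof. by apply: linear_ex => a u v; rewrite (linearP f) (linearP g) opprD scalerBr addrACA. Qed.

Lemma linear_scale x X : exists f : {linear X -> X}, forall u, f u = x *: u.
Proof. by apply: linear_ex => a u v; rewrite scalerDr !scalerA mulrC. Qed.

Lemma reduction_ses x M Q (q : {linear M -> Q}) : regular_on x M -> is_reduction x q ->
  exists2 f : {linear M -> M}, forall u, f u = x *: u & ses f q.
Proof.
move=> rx hq; have [f fE] := linear_scale x M; exists f => //; split.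
- by apply: ker0_injective => u; rewrite fE; exact: rx.
- exact: reduction_onto hq.
- move=> u; split=> [/(reduction_ker hq) [v ->]|[v ->]]; first by exists v; rewrite fE.
  by rewrite fE reduction_mul.
Qed.

Lemma ker_ex M N (p : {linear M -> N}) : onto p -> exists K (k : {linear K -> M}), ses k p.
Proof. by move=> ps; exists (sub_mod (ker p)), (incl (ker p)); exact: ker_ses. Qed.

(** The three clauses say that W is the fibre product of f and g, without
    choosing a model. *)
Record is_pullback X Y Q W (f : {linear X -> Q}) (g : {linear Y -> Q})
    (a : {linear W -> X}) (b : {linear W -> Y}) : Prop := IsPullback {
  pullback_comm : forall w, f (a w) = g (b w);
  pullback_univ : forall u v, f u = g v -> exists w, a w = u /\ b w = v;
  pullback_sep : forall w, a w = 0 -> b w = 0 -> w = 0 }.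

Lemma pullback_ex X Y Q (f : {linear X -> Q}) (g : {linear Y -> Q}) :
  exists W (a : {linear W -> X}) (b : {linear W -> Y}), is_pullback f g a b.
Proof.
have [|d dE] := @linear_ex A (X * Y)%type Q (fun z => f z.1 - g z.2).
  by move=> c u v; rewrite (linearP f) (linearP g) opprD scalerBr addrACA.
exists (sub_mod (ker d)).
have [a aE] := @linear_ex A (sub_mod (ker d)) X (fun w => (incl (ker d) w).1) (fun _ _ _ => erefl).
have [b bE] := @linear_ex A (sub_mod (ker d)) Y (fun w => (incl (ker d) w).2) (fun _ _ _ => erefl).
exists a, b; split.
- move=> w; rewrite aE bE; apply/subr0_eq; rewrite -dE; apply/eqP; exact: (incl_in w).
- move=> u v E; have /incl_ex [w wE] : (u, v) \in ker d.
    by rewrite mem_ker dE E subrr.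
  by exists w; rewrite aE bE wE.
- move=> w; rewrite aE bE => a0 b0; apply: (@incl_inj A).
  by rewrite linear0; apply: injective_projections.
Qed.

Lemma pullback_sym X Y Q W (f : {linear X -> Q}) (g : {linear Y -> Q})
    (a : {linear W -> X}) (b : {linear W -> Y}) : is_pullback f g a b -> is_pullback g f b a.
Proof.
move=> [ab un sep]; split=> // [v u /esym /un [w [wu wv]]|w b0 a0]; first by exists w.
exact: sep.
Qed.

(** A pullback of a surjection has the same kernel. *)
Lemma pullback_ses X Y Q W B (f : {linear X -> Q}) (g : {linear Y -> Q})
    (a : {linear W -> X}) (b : {linear W -> Y}) (j : {linear B -> Y}) :
  is_pullback f g a b -> ses j g ->
  exists t : {linear B -> W}, ses t a /\ forall u, b (t u) = j u.
Proof.
move=> [ab un sep] hs.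
have [c cE] := linear_copair a b; have [d dE] := linear_copair (\0 : {linear B -> X}) j.
have [||t tE] := factor_injective (j := c) (f := d).
- by apply: ker0_injective => w; rewrite cE => -[/sep].
- move=> u; have [|w [aw bw]] := un 0 (j u); first by rewrite (ses_comp hs) linear0.
  by exists w; rewrite cE dE aw bw.
have ta u : a (t u) = 0 by have := congr1 fst (tE u); rewrite cE dE.
have tb u : b (t u) = j u by have := congr1 snd (tE u); rewrite cE dE.
exists t; split=> //; split.
- by apply: ker0_injective => u tu; apply: (injective_ker0 (ses_inj hs)); rewrite -tb tu linear0.
- by move=> v; have [y yE] := ses_onto hs (f v); have [w [<- _]] := un _ _ (esym yE); exists w.
- move=> w; split=> [aw|[u ->] //].
  have /(ses_exact hs) [u uE] : g (b w) = 0 by rewrite -ab aw linear0.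
  by exists u; apply/subr0_eq/sep; rewrite linearB ?ta ?tb ?aw ?uE subrr.
Qed.

Lemma fg_cover N : fin_gen N ->
  exists n K (k : {linear K -> 'rV[A]_n}) (p : {linear 'rV[A]_n -> N}), ses k p.
Proof.
case/fgP => n [p ps]; exists n, (sub_mod (ker p)), (incl (ker p)), p; exact: ker_ses.
Qed.

Lemma ses_fac_l L M N Z (i : {linear L -> M}) (p : {linear M -> N}) (f : {linear Z -> M}) :
  ses i p -> (forall z, p (f z) = 0) -> exists g : {linear Z -> L}, forall z, i (g z) = f z.
Proof. by move=> hs H; apply: factor_injective (ses_inj hs) _ => z; apply/(ses_exact hs). Qed.

Lemma ses_fac_r L M N Z (i : {linear L -> M}) (p : {linear M -> N}) (f : {linear M -> Z}) :
  ses i p -> (forall z, f (i z) = 0) -> exists g : {linear N -> Z}, forall z, g (p z) = f z.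
Proof.
by move=> hs H; apply: factor_onto (ses_onto hs) _ => u /(ses_exact hs) [v ->].
Qed.

Lemma projective_pair P Q : projective P -> projective Q -> projective (P * Q)%type.
Proof.
move=> pP pQ E R p f ps.
have [i iE] := linear_copair (idfun : {linear P -> P}) (\0 : {linear P -> Q}).
have [j jE] := linear_copair (\0 : {linear Q -> P}) (idfun : {linear Q -> Q}).
have [g gE] := pP _ _ p (f \o i) ps; have [h hE] := pQ _ _ p (f \o j) ps.
have [k kE] := linear_pair g h; exists k => -[u v].
rewrite kE linearD /= gE hE /= -linearD iE jE; congr (f _).
by apply: injective_projections; rewrite /= ?addr0 ?add0r.
Qed.

Section Target.
Variable T : lmodType A.

(** Vanishing of Ext^1 (N, T), in a form that mentions no resolution: maps
    to T extend along any extension with cokernel N. *)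
Definition ext1_zero N := forall B C (i : {linear B -> C}) (p : {linear C -> N}), ses i p ->
  forall g : {linear B -> T}, exists h : {linear C -> T}, forall b, h (i b) = g b.

(** Vanishing of Ext^(i+1) (N, T), by dimension shifting along all
    projective presentations at once. That one presentation suffices is
    extS_zero_shift. *)
Fixpoint extS_zero (i : nat) N : Prop :=
  if i is i'.+1 then forall K P (k : {linear K -> P}) (p : {linear P -> N}),
    projective P -> ses k p -> extS_zero i' K
  else ext1_zero N.

(** Any extension C of N by B receives a map from the presentation P, and C
    is the pushout of P and B along K. *)
Lemma ext1_zero_presentation K P N (k : {linear K -> P}) (p : {linear P -> N}) :
  projective P -> ses k p ->
  (forall g : {linear K -> T}, exists h : {linear P -> T}, forall b, h (k b) = g b) -> ext1_zero N.
Proof.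
move=> pP hs H B C j q hq g.
have [phi phiE] := pP _ _ q p (ses_onto hq).
have [psi psiE] : exists psi : {linear K -> B}, forall z, j (psi z) = (phi \o k) z.
  by apply: ses_fac_l hq _ => z /=; rewrite phiE (ses_comp hs).
have [h0 h0E] := H (g \o psi).
have [s sE] := linear_pair j phi; have [f fE] := linear_pair g h0.
have [||h hE] := factor_onto (p := s) (f := f).
- move=> c; have [y yE] := ses_onto hs (q c).
  have /(ses_exact hq) [b bE] : q (c - phi y) = 0 by rewrite linearB phiE yE subrr.
  by exists (b, y); rewrite sE /= -bE subrK.
- move=> [b y]; rewrite sE fE /= => E.
  have /(ses_exact hs) [z zE] : p y = 0.
    by have := congr1 q E; rewrite linearD (ses_comp hq) add0r phiE linear0.
  have : j (b + psi z) = 0 by rewrite linearD psiE /= -zE.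
  move/(injective_ker0 (ses_inj hq)) => bz.
  by rewrite zE h0E /= -linearD bz linear0.
by exists h => b; have := hE (b, 0); rewrite sE fE /= !linear0 !addr0.
Qed.

(** Pulling E back along f gives an extension of N by T; extending the
    identity of T splits it. *)
Lemma ext1_zero_lift N E Q (j : {linear T -> E}) (q : {linear E -> Q}) (f : {linear N -> Q}) :
  ext1_zero N -> ses j q -> exists g : {linear N -> E}, forall u, q (g u) = f u.
Proof.
move=> eN hq; have [W [b [a pb]]] := pullback_ex f q.
have [t [ht ta]] := pullback_ses pb hq.
have [r rE] := eN _ _ _ _ ht idfun.
have [d dE] := linear_diff a (j \o r).
have [|g gE] := ses_fac_r (f := d) ht; first by move=> z; rewrite dE /= rE ta subrr.
exists g => u; have [w <-] := ses_onto ht u.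
by rewrite gE dE linearB /= (ses_comp hq) subr0 (pullback_comm pb).
Qed.

Lemma projective_split L M P (i : {linear L -> M}) (p : {linear M -> P}) :
  projective P -> ses i p ->
  exists (s : {linear P -> M}) (r : {linear M -> L}), [/\ forall u, p (s u) = u,
    forall u, r (i u) = u & forall u, i (r u) + s (p u) = u].
Proof.
move=> pP hs; have [s sE] := pP _ _ p idfun (ses_onto hs).
have [d dE] := linear_diff (idfun : {linear M -> M}) (s \o p).
have [|r rE] := ses_fac_l (f := d) hs; first by move=> z; rewrite dE linearB /= sE subrr.
exists s, r; split=> // u; last by rewrite rE dE /= subrK.
by apply: (ses_inj hs); rewrite rE dE /= (ses_comp hs) linear0 subr0.
Qed.

Lemma projective_kernel L M P (i : {linear L -> M}) (p : {linear M -> P}) :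
  projective P -> projective M -> ses i p -> projective L.
Proof.
move=> pP pM hs; have [s [r [_ ri _]]] := projective_split pP hs.
move=> E Q q f qs; have [g gE] := pM _ _ q (f \o r) qs.
by exists (g \o i) => u /=; rewrite gE /= ri.
Qed.

Lemma extS_zero_proj i P : projective P -> extS_zero i P.
Proof.
elim: i P => [|i IH] P pP.
  move=> B C j q hs g; have [s [r [_ ri _]]] := projective_split pP hs.
  by exists (g \o r) => b /=; rewrite ri.
move=> K P' k p pP' hs; apply: IH; exact: projective_kernel pP pP' hs.
Qed.

Lemma ses_split B C K W P (a : {linear B -> C}) (b : {linear C -> K})
    (j : {linear K -> W}) (q : {linear W -> P}) : projective P -> ses a b -> ses j q ->
  exists a' b', @ses A B (C * P)%type W a' b' /\ forall u, a' u = (a u, 0).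
Proof.
move=> pP hab hjq; have [s [r [qs rj rs]]] := projective_split pP hjq.
have [a' aE] := linear_copair a (\0 : {linear B -> P}).
have [b' bE] := linear_pair (j \o b) s.
exists a', b'; split=> //; split.
- by apply: ker0_injective => u; rewrite aE => -[/(injective_ker0 (ses_inj hab))].
- move=> w; have [c cE] := ses_onto hab (r w).
  by exists (c, q w); rewrite bE /= cE rs.
- move=> [c y]; rewrite bE /=; split=> [E|[u]]; last first.
    by rewrite aE => -[-> ->]; rewrite (ses_comp hab) !linear0 addr0.
  have y0 : y = 0 by have := congr1 q E; rewrite linearD (ses_comp hjq) add0r qs linear0.
  move: E; rewrite y0 linear0 addr0 => /(injective_ker0 (ses_inj hjq)) /(ses_exact hab) [u ->].
  by exists u; rewrite aE.
Qed.

(** Here K is a direct summand of W, with complement P; adding P to an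
    extension or a projective presentation of K gives one of W with the same
    kernel. *)
Lemma extS_zero_split i K W P (j : {linear K -> W}) (q : {linear W -> P}) :
  projective P -> ses j q -> extS_zero i W -> extS_zero i K.
Proof.
case: i => [|i] pP hs eW.
  move=> B C a b hab g; have [a' [b' [hab' aE]]] := ses_split pP hab hs.
  have [h hE] := eW _ _ _ _ hab' g.
  have [c cE] := linear_copair (idfun : {linear C -> C}) (\0 : {linear C -> P}).
  by exists (h \o c) => u /=; rewrite cE /= -aE hE.
move=> K1 P1 a b pP1 hab; have [a' [b' [hab' aE]]] := ses_split pP hab hs.
by apply: eW hab'; exact: projective_pair.
Qed.

(** Extend first to the preimage of N' in C, then to C. *)
Lemma ext1_zero_ext N' N N'' (i : {linear N' -> N}) (p : {linear N -> N''}) :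
  ses i p -> ext1_zero N' -> ext1_zero N'' -> ext1_zero N.
Proof.
move=> hs e' e'' B C a b hab g.
have pbs : onto (p \o b).
  by move=> v; have [u <-] := ses_onto hs v; have [c <-] := ses_onto hab u; exists c.
have [Z [k hk]] := ker_ex pbs.
have [a1 a1E] : exists a1 : {linear B -> Z}, forall u, k (a1 u) = a u.
  by apply: ses_fac_l hk _ => u /=; rewrite (ses_comp hab) linear0.
have [b1 b1E] : exists b1 : {linear Z -> N'}, forall u, i (b1 u) = (b \o k) u.
  by apply: ses_fac_l hs _ => u; exact: (ses_comp hk).
have h1 : ses a1 b1; first split.
- by apply: ker0_injective => u au; apply: (injective_ker0 (ses_inj hab)); rewrite -a1E au linear0.
- move=> v; have [c cE] := ses_onto hab (i v).
  have /(ses_exact hk) [w wE] : (p \o b) c = 0 by rewrite /= cE (ses_comp hs).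
  by exists w; apply: (ses_inj hs); rewrite b1E /= -wE.
- move=> w; split=> [bw|[u ->]].
    have /(ses_exact hab) [u uE] : b (k w) = 0 by rewrite -[LHS]/((b \o k) w) -b1E bw linear0.
    by exists u; apply: (ses_inj hk); rewrite a1E uE.
  by apply: (ses_inj hs); rewrite b1E /= a1E (ses_comp hab) linear0.
have [g1 g1E] := e' _ _ _ _ h1 g; have [h hE] := e'' _ _ _ _ hk g1.
by exists h => u; rewrite -a1E hE g1E.
Qed.

Lemma pair_ses X Y : exists (i : {linear X -> (X * Y)%type}) (p : {linear (X * Y)%type -> Y}),
  [/\ ses i p, forall u, i u = (u, 0) & forall z, p z = z.2].
Proof.
have [i iE] := linear_copair (idfun : {linear X -> X}) (\0 : {linear X -> Y}).
have [p pE] := @linear_ex A (X * Y)%type Y snd (fun _ _ _ => erefl).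
exists i, p; split=> //; split.
- by apply: ker0_injective => u; rewrite iE => -[].
- by move=> v; exists (0, v); rewrite pE.
- by move=> [u v]; rewrite pE /=; split=> [->|[w]]; [exists u; rewrite iE|rewrite iE => -[]].
Qed.

(** The kernel of P2 -> K contains the kernel L of P2 -> K x P, with
    quotient P; so L is a summand of it. *)
Lemma extS_zero_addproj i K P : extS_zero i K -> projective P -> extS_zero i (K * P)%type.
Proof.
case: i => [|i] eK pP.
  have [j [q [hs _ _]]] := pair_ses K P; apply: ext1_zero_ext hs eK _; exact: (@extS_zero_proj 0).
move=> L P2 a b pP2 hs.
have [f fE] := @linear_ex A (K * P)%type K fst (fun _ _ _ => erefl).
have [g gE] := @linear_ex A (K * P)%type P snd (fun _ _ _ => erefl).
have fs : onto (f \o b).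
  by move=> u; have [c cE] := ses_onto hs (u, 0); exists c; rewrite /= fE cE.
have [Z [k hk]] := ker_ex fs.
have [a1 a1E] : exists a1 : {linear L -> Z}, forall u, k (a1 u) = a u.
  by apply: ses_fac_l hk _ => u /=; rewrite (ses_comp hs) linear0.
suff h1 : ses a1 (g \o (b \o k)) by exact: extS_zero_split pP h1 (eK _ _ _ _ pP2 hk).
split.
- by apply: ker0_injective => u au; apply: (injective_ker0 (ses_inj hs)); rewrite -a1E au linear0.
- move=> v; have [c cE] := ses_onto hs (0, v).
  have /(ses_exact hk) [w wE] : (f \o b) c = 0 by rewrite /= fE cE.
  by exists w; rewrite /= -wE cE gE.
- move=> w; split=> [E|[u ->]]; last by rewrite /= a1E (ses_comp hs) linear0.
  have /(ses_exact hs) [u uE] : b (k w) = 0.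
    apply: injective_projections; last by move: E; rewrite /= gE.
    by have := ses_comp hk w; rewrite /= fE.
  by exists u; apply: (ses_inj hk); rewrite a1E uE.
Qed.

(** Schanuel's lemma. For two presentations of N with kernels K and K', the
    sequence K' -> K x P' -> P, whose second map is induced by a lifting of
    P' -> N to P, is exact, so that K' is a direct summand of K x P'. *)
Lemma extS_zero_shift i K P N (k : {linear K -> P}) (p : {linear P -> N}) :
  projective P -> ses k p -> extS_zero i K -> extS_zero i.+1 N.
Proof.
move=> pP hs eK K' P' k' p' pP' hs'.
have [s sE] := pP' _ _ p p' (ses_onto hs).
have [b bE] := linear_pair k s.
have [t tE] : exists t : {linear K' -> K}, forall u, k (t u) = (s \o k') u.
  by apply: ses_fac_l hs _ => u /=; rewrite sE (ses_comp hs').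
have [nt ntE] := linear_diff (\0 : {linear K' -> K}) t.
have [a aE] := linear_copair nt k'.
apply: (extS_zero_split (j := a) (q := b)) pP _ (extS_zero_addproj eK pP'); split.
- by apply: ker0_injective => u; rewrite aE => -[_ /(injective_ker0 (ses_inj hs'))].
- move=> y; have [z zE] := ses_onto hs' (p y).
  have /(ses_exact hs) [w wE] : p (y - s z) = 0 by rewrite linearB sE zE subrr.
  by exists (w, z); rewrite bE /= -wE subrK.
- move=> [w z]; rewrite bE /=; split=> [E|[u]]; last first.
    by rewrite aE => -[-> ->]; rewrite ntE sub0r linearN tE addNr.
  have /(ses_exact hs') [u uE] : p' z = 0.
    by rewrite -sE; have := congr1 p E; rewrite linearD (ses_comp hs) add0r linear0.
  exists u; rewrite aE uE ntE sub0r; congr (_, _); apply: (ses_inj hs).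
  by apply/eqP; rewrite linearN tE -addr_eq0 /= -uE; apply/eqP.
Qed.

Lemma horseshoe N' N N'' (i : {linear N' -> N}) (p : {linear N -> N''})
    K' P' (k' : {linear K' -> P'}) (p' : {linear P' -> N'})
    K'' P'' (k'' : {linear K'' -> P''}) (p'' : {linear P'' -> N''}) :
  ses i p -> projective P'' -> ses k' p' -> ses k'' p'' ->
  exists K (k : {linear K -> (P' * P'')%type}) (q : {linear (P' * P'')%type -> N})
    (a : {linear K' -> K}) (b : {linear K -> K''}), ses k q /\ ses a b.
Proof.
move=> hs pP'' h' h''.
have [s sE] := pP'' _ _ p p'' (ses_onto hs).
have [q qE] := linear_pair (i \o p') s.
have qs : onto q.
  move=> n; have [y yE] := ses_onto h'' (p n).
  have /(ses_exact hs) [n' n'E] : p (n - s y) = 0 by rewrite linearB sE yE subrr.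
  have [z zE] := ses_onto h' n'.
  by exists (z, y); rewrite qE /= zE -n'E subrK.
have [Z [k hk]] := ker_ex qs.
have [c cE] := linear_copair k' (\0 : {linear K' -> P''}).
have [a aE] : exists a : {linear K' -> Z}, forall u, k (a u) = c u.
  by apply: ses_fac_l hk _ => u /=; rewrite cE qE /= (ses_comp h') !linear0 addr0.
have [d dE] := @linear_ex A (P' * P'')%type P'' snd (fun _ _ _ => erefl).
have [b bE] : exists b : {linear Z -> K''}, forall u, k'' (b u) = (d \o k) u.
  apply: ses_fac_l h'' _ => u /=; rewrite dE -sE.
  have := congr1 p (ses_comp hk u); rewrite qE linearD /= (ses_comp hs) add0r => ->.
  exact: linear0.
exists (Z), k, q, a, b; split=> //; split.
- apply: ker0_injective => u au; apply: (injective_ker0 (ses_inj h')).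
  by have := congr1 fst (aE u); rewrite cE au linear0.
- move=> v; have /(ses_exact hs) [n' n'E] : p (s (k'' v)) = 0 by rewrite sE (ses_comp h'').
  have [z zE] := ses_onto h' n'.
  have /(ses_exact hk) [w wE] : q (- z, k'' v) = 0.
    by rewrite qE /= !linearN /= zE -n'E addNr.
  by exists w; apply: (ses_inj h''); rewrite bE /= dE -wE.
- move=> w; split=> [bw|[u ->]]; last first.
    by apply: (ses_inj h''); rewrite bE /= dE aE cE linear0.
  have w2 : (k w).2 = 0 by rewrite -dE -[LHS]/((d \o k) w) -bE bw linear0.
  have := ses_comp hk w; rewrite qE w2 linear0 addr0 /=.
  move=> /(injective_ker0 (ses_inj hs)) /(ses_exact h') [u uE].
  exists u; apply: (ses_inj hk); rewrite aE cE; apply: injective_projections => //=.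
Qed.

(** The kernel of P -> N'' is an extension of N' by the kernel of P -> N. *)
Lemma cover_ses N' N N'' P (i : {linear N' -> N}) (p : {linear N -> N''}) (c : {linear P -> N}) :
  ses i p -> onto c -> exists K (k : {linear K -> P}) K'' (k'' : {linear K'' -> P})
    (a : {linear K -> K''}) (b : {linear K'' -> N'}),
    [/\ ses k c, ses k'' (p \o c), ses a b, forall u, k'' (a u) = k u
      & forall u, i (b u) = c (k'' u)].
Proof.
move=> hs cs; have [Z [k hk]] := ker_ex cs.
have pcs : onto (p \o c).
  by move=> v; have [u <-] := ses_onto hs v; have [w <-] := cs u; exists w.
have [Z2 [k2 hk2]] := ker_ex pcs.
have [a aE] : exists a : {linear Z -> Z2},
    forall u, k2 (a u) = k u.
  by apply: ses_fac_l hk2 _ => u /=; rewrite (ses_comp hk) linear0.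
have [b bE] : exists b : {linear Z2 -> N'}, forall u, i (b u) = (c \o k2) u.
  by apply: ses_fac_l hs _ => u; exact: (ses_comp hk2 u).
exists _, k, _, k2, a, b; split=> //; split.
- by apply: ker0_injective => u au; apply: (injective_ker0 (ses_inj hk)); rewrite -aE au linear0.
- move=> n; have [y yE] := cs (i n).
  have /(ses_exact hk2) [w wE] : (p \o c) y = 0 by rewrite /= yE (ses_comp hs).
  by exists w; apply: (ses_inj hs); rewrite bE /= -wE.
- move=> w; split=> [bw|[u ->]].
    have /(ses_exact hk) [u uE] : c (k2 w) = 0 by rewrite -[LHS]/((c \o k2) w) -bE bw linear0.
    by exists u; apply: (ses_inj hk2); rewrite aE.
  by apply: (ses_inj hs); rewrite bE /= aE (ses_comp hk) linear0.
Qed.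

Hypothesis nA : noeth_ring A.

(** From Ext^(i+1) (N'') -> Ext^(i+1) (N) -> Ext^(i+1) (N'). *)
Lemma extS_zero_ext i N' N N'' (j : {linear N' -> N}) (p : {linear N -> N''}) :
  ses j p -> fin_gen N' -> fin_gen N'' -> extS_zero i N' -> extS_zero i N'' -> extS_zero i N.
Proof.
elim: i N' N N'' j p => [|i IH] N' N N'' j p hs f' f'' e' e''; first exact: ext1_zero_ext hs e' e''.
have [n' [K' [k' [p' h']]]] := fg_cover f'; have [n'' [K'' [k'' [p'' h'']]]] := fg_cover f''.
have [K [k [q [a [b [hk hab]]]]]] := horseshoe hs (@projective_free _ _) h' h''.
apply: (extS_zero_shift (projective_pair (@projective_free _ _) (@projective_free _ _)) hk).
apply: IH hab _ _ (e' _ _ _ _ (@projective_free _ _) h') (e'' _ _ _ _ (@projective_free _ _) h'').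
  exact: (fg_inj nA (ses_inj h') (@fg_rV A _)).
exact: (fg_inj nA (ses_inj h'') (@fg_rV A _)).
Qed.

(** From Ext^(i+1) (N) -> Ext^(i+1) (N') -> Ext^(i+2) (N''). For i = 0 an
    extension of N' is pulled back to the kernel K2 of a free cover of N'',
    where it splits by hypothesis; the splitting can be corrected to vanish
    on the kernel K of P -> N, as Ext^1 (N) = 0. *)
Lemma extS_zero_sub i N' N N'' (j : {linear N' -> N}) (p : {linear N -> N''}) :
  ses j p -> fin_gen N -> extS_zero i N -> extS_zero i.+1 N'' -> extS_zero i N'.
Proof.
elim: i N' N N'' j p => [|i IH] N' N N'' j p hs fN eN e''.
  have [n [K0 [k0 [c hc]]]] := fg_cover fN.
  have [K [k [K2 [k2 [a [r [hk hk2 har ak rj]]]]]]] := cover_ses hs (ses_onto hc).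
  have eK2 : ext1_zero K2 by exact: e'' (@projective_free _ _) hk2.
  move=> B C s t hst g.
  have [W [w1 [w2 pb]]] := pullback_ex r t.
  have [BW [h1 BW2]] := pullback_ses pb hst.
  have [KW [h2 KW1]] := pullback_ses (pullback_sym pb) har.
  have [G GE] := eK2 _ _ _ _ h1 g.
  have [H HE] := eN _ _ _ _ hk (G \o KW).
  have [dd ddE] := linear_diff G (H \o (k2 \o w1)).
  have [|h hE] := ses_fac_r (f := dd) h2.
    by move=> z; rewrite ddE /= KW1 ak HE subrr.
  by exists h => b; rewrite -BW2 hE ddE /= (ses_comp h1) (linear0 k2) (linear0 H) subr0 GE.
have f' := fg_inj nA (ses_inj hs) fN; have f'' := fg_surj (ses_onto hs) fN.
have [n' [K' [k' [p' h']]]] := fg_cover f'; have [n'' [K'' [k'' [p'' h'']]]] := fg_cover f''.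
have [K [k [q [a [b [hk hab]]]]]] := horseshoe hs (@projective_free _ _) h' h''.
apply: (extS_zero_shift (@projective_free _ _) h').
have pP := projective_pair (@projective_free A n') (@projective_free A n'').
apply: IH hab _ (eN _ _ _ _ pP hk) (e'' _ _ _ _ (@projective_free _ _) h'').
apply: (fg_inj nA (ses_inj hk)).
by apply: (fg_pair) => //; exact: fg_rV.
Qed.

(** From Ext^(i+1) (N') -> Ext^(i+2) (N'') -> Ext^(i+2) (N). *)
Lemma extS_zero_quot i N' N N'' (j : {linear N' -> N}) (p : {linear N -> N''}) :
  ses j p -> fin_gen N -> extS_zero i N' -> extS_zero i.+1 N -> extS_zero i.+1 N''.
Proof.
move=> hs fN e' eN; have [n [K0 [k0 [c hc]]]] := fg_cover fN.
have [K [k [K2 [k2 [a [r [hk hk2 har _ _]]]]]]] := cover_ses hs (ses_onto hc).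
apply: extS_zero_shift (@projective_free _ _) hk2 _.
apply: extS_zero_ext har _ _ (eN _ _ _ _ (@projective_free _ _) hk) e'.
  exact: (fg_inj nA (ses_inj hk) (@fg_rV A _)).
exact: (fg_inj nA (ses_inj hs) fN).
Qed.

End Target.
End Extensions.

(** * Ext and its second argument *)

Section ChangeTarget.
Variable A : comPzRingType.
Implicit Types (B C D E F H K L M N P Q R T U V W X Y Z : lmodType A).

Lemma extS_zero_target0 T i N : zero_mod T -> extS_zero T i N.
Proof.
move=> z; elim: i N => [|i IH] N; last by move=> K P k p _ _; exact: IH.
by move=> B C a b _ g; exists \0 => u; rewrite [RHS]z.
Qed.

(** The same notion as injective_mod, over rings in which 0 = 1 is allowed. *)
Definition inj_mod E := forall B C (f : {linear B -> C}) (g : {linear B -> E}),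
  injective f -> exists h : {linear C -> E}, forall x, h (f x) = g x.

(** Dimension shifting in the second argument: T' is a cosyzygy of T. An
    extension of K by T maps to E; this induces K -> T', which extends to P
    and lifts to E. *)
Lemma extS_zero_cosyz T E T' (j : {linear T -> E}) (q : {linear E -> T'}) i N :
  inj_mod E -> ses j q -> extS_zero T' i N -> extS_zero T i.+1 N.
Proof.
move=> iE hq; elim: i N => [|i IH] N eN; last first.
  by move=> K P k p pP hs; apply: IH; exact: eN pP hs.
move=> K P k p pP hs B C a b hab g.
have [G GE] := iE _ _ a (j \o g) (ses_inj hab).
have [|c cE] := ses_fac_r (f := q \o G) hab.
  by move=> z; rewrite /= GE (ses_comp hq).
have [c' c'E] := eN _ _ _ _ hs c.
have [psi psiE] := pP _ _ q c' (ses_onto hq).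
have [d dE] := linear_diff G (psi \o (k \o b)).
have [|h hE] := ses_fac_l (f := d) hq.
  by move=> z; rewrite dE linearB /= psiE c'E cE subrr.
exists h => u; apply: (ses_inj hq).
by rewrite hE dE GE /= (ses_comp hab) (linear0 k) (linear0 psi) subr0.
Qed.

(** Injective dimension less than n, through successive cosyzygies. *)
Fixpoint fin_inj (n : nat) T : Prop :=
  if n is n'.+1 then exists E T' (j : {linear T -> E}) (q : {linear E -> T'}),
    [/\ inj_mod E, ses j q & fin_inj n' T']
  else zero_mod T.

Lemma fin_inj_extS_zero n T i N : fin_inj n T -> (n <= i)%N -> extS_zero T i N.
Proof.
elim: n T i N => [|n IH] T i N; first by move=> z _; exact: extS_zero_target0.
move=> [E [T' [j [q [iE hq fT]]]]]; case: i => // i; rewrite ltnS => ni.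
by apply: extS_zero_cosyz iE hq _; exact: IH.
Qed.

Lemma coker_ses L M N (i : {linear L -> M}) (p : {linear M -> N}) : injective i ->
  exact_at i p -> exists Q (q : {linear M -> Q}) (k : {linear Q -> N}),
    [/\ ses i q, injective k & forall u, k (q u) = p u].
Proof.
move=> ii ex; exists (quot_mod (ker p)), (qmap (ker p)).
have [|k kE] := factor_onto (f := p) (@qmap_onto A M (ker p)).
  by move=> u /qmap_eq0; rewrite mem_ker => /eqP.
exists k; split=> //.
- split=> //; first exact: qmap_onto.
  move=> u; split=> [/qmap_eq0|E]; first by rewrite mem_ker => /eqP /ex.
  by apply/qmap_eq0; rewrite mem_ker; apply/eqP/ex.
- apply: ker0_injective => v; have [u <-] := @qmap_onto A M (ker p) v.
  by rewrite kE => E; apply/qmap_eq0; rewrite mem_ker E.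
Qed.

(** The cosyzygies of an injective resolution that is eventually zero. *)
Lemma fin_inj_res n (E : nat -> lmodType A) (d : forall i, {linear E i -> E i.+1}) :
  (forall i, inj_mod (E i)) -> (forall i, (n < i)%N -> forall x : E i, x = 0) ->
  (forall i, exact_at (d i) (d i.+1)) ->
  forall T k j (e : {linear T -> E j}), injective e -> exact_at e (d j) ->
  (n < j + k)%N -> fin_inj k T.
Proof.
move=> iE z ex T k; elim: k T => [|k IH] T j e ei ee lt.
  by move=> u; apply: ei; rewrite linear0; apply: z; rewrite addn0 in lt.
have [Q [q [f [hs fi fE]]]] := coker_ses ei ee.
exists (E j), Q, e, q; split=> //.
apply: (IH Q j.+1 f) => //; last by rewrite addSnnS.
move=> b; split=> [/ex [a ->]|[v ->]]; first by exists (q a); rewrite fE.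
have [u <-] := ses_onto hs v; rewrite fE; apply/ex; by exists u.
Qed.

(** From Ext^(i+1) (N, T1) -> Ext^(i+1) (N, T2) -> Ext^(i+2) (N, T). *)
Lemma extS_zero_target T T1 T2 (j : {linear T -> T1}) (q : {linear T1 -> T2}) i N :
  noeth_ring A -> ses j q -> fin_gen N ->
  extS_zero T1 i N -> extS_zero T i.+1 N -> extS_zero T2 i N.
Proof.
move=> nA hq; elim: i N => [|i IH] N fN e1 e.
  have [n [K [k [p hs]]]] := fg_cover fN.
  apply: (ext1_zero_presentation (@projective_free _ _) hs) => g.
  have [g' g'E] := ext1_zero_lift g (e _ _ _ _ (@projective_free _ _) hs) hq.
  have [h hE] := e1 _ _ _ _ hs g'.
  by exists (q \o h) => b /=; rewrite hE g'E.
have [n [K [k [p hs]]]] := fg_cover fN.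
apply: (extS_zero_shift (@projective_free _ _) hs); apply: IH.
- exact: (fg_inj nA (ses_inj hs) (@fg_rV A _)).
- exact: e1 (@projective_free _ _) hs.
- exact: e (@projective_free _ _) hs.
Qed.

Lemma hom_of M N (f : {linear M -> N}) : exists h : hom M N, forall u, val h u = f u.
Proof.
have fP : (f : M -> N) \in @hom_pred A M N by apply/asboolP => a u v; rewrite linearP.
by exists (exist _ (f : M -> N) fP).
Qed.

Lemma of_hom M N (h : hom M N) : exists f : {linear M -> N}, forall u, f u = val h u.
Proof. apply: linear_ex; exact: (asboolW (valP h)). Qed.

Lemma hom_eq M N (h h' : hom M N) : (forall u, val h u = val h' u) -> h = h'.
Proof. by move=> H; apply: val_inj; apply: funext. Qed.

Lemma hom_eval M N u : exists f : {linear hom M N -> N}, forall h, f h = val h u.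
Proof. by apply: linear_ex => a h h'. Qed.

Lemma hom_valD M N (h h' : hom M N) u : val (h + h') u = val h u + val h' u. Proof. by []. Qed.
Lemma hom_valB M N (h h' : hom M N) u : val (h - h') u = val h u - val h' u. Proof. by []. Qed.
Lemma hom_valZ M N a (h : hom M N) u : val (a *: h) u = a *: val h u. Proof. by []. Qed.
Lemma hom_val0 M N u : val (0 : hom M N) u = 0. Proof. by []. Qed.

(** H embeds into the n-th power of T; the power is avoided by peeling off
    one coordinate at a time. *)
Lemma noeth_sep n T H (f : 'I_n -> {linear H -> T}) : noethM T ->
  (forall h, (forall i, f i h = 0) -> h = 0) -> noethM H.
Proof.
move=> nT; elim: n H f => [|n IH] H f sep.
  by apply: noeth_zero => h; apply: sep; case.
have [||q qE] := factor_injective (j := incl (im (f ord0))) (f := f ord0).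
- exact: incl_inj.
- move=> h; have /incl_ex [v vE] : f ord0 h \in im (f ord0) by apply/mem_im; exists h.
  by exists v.
have qs : onto q.
  move=> v; have /mem_im [h hE] := incl_in v; exists h.
  by apply: (@incl_inj A); rewrite qE -hE.
apply: (noeth_ext (ker_ses qs)).
  apply: (IH _ (fun i => f (lift ord0 i) \o incl (ker q))) => h H0.
  apply: (@incl_inj A); rewrite linear0; apply: sep => i.
  have [j ->|->] := unliftP ord0 i; first exact: H0.
  by rewrite -qE; have := incl_in h; rewrite mem_ker => /eqP ->; rewrite linear0.
exact: noeth_sub (@incl_inj A T (im (f ord0))) nT.
Qed.

Lemma fg_hom M N : noeth_ring A -> fin_gen M -> fin_gen N -> fin_gen (hom M N).
Proof.
move=> nA /fgP [n [g gs]] fN; apply: noeth_fg.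
have [f fE] := choice (fun i => hom_eval N (g (delta_mx 0 i))).
apply: (noeth_sep (f := f)) (fg_noeth nA fN) _ => h H; apply: hom_eq => u.
have [c <-] := gs u; have [h' hE] := of_hom h.
rewrite hom_val0 -hE linear_delta linear_sum big1 // => i _.
by rewrite linearZ /= hE -fE H scaler0.
Qed.

End ChangeTarget.

(** * Nakayama's lemma for Ext and modules of finite length *)

Section NakayamaExt.
Variables (A : comPzRingType) (m : submodule A^o).
Hypothesis lA : noeth_local m.
Implicit Types (B C D E F H K L M N P Q R T U V W X Y Z : lmodType A).

Let nA := local_noeth lA.

(** Since Ext^2 (N / xN, T) = 0, multiplication by x is onto on Ext^1 (N,
    T), which is a finitely generated module. Concretely, the kernel K' of P
    -> N / xN is K + xP, a quotient of K x P by the copy (- x u, k u) of K;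
    extending a map g on K along this copy writes g as x times a map on K
    plus the restriction of a map on P. *)
Lemma ext1_zero_nakayama T (x : A) N N' (r : {linear N -> N'}) : fin_gen N -> fin_gen T ->
  (x : A^o) \in m -> regular_on x N -> is_reduction x r -> extS_zero T 1 N' -> ext1_zero T N.
Proof.
move=> fN fT xm xN hr e1; have [n [K [k [c hs]]]] := fg_cover fN.
have rcs : onto (r \o c).
  by move=> v; have [u <-] := reduction_onto hr v; have [w <-] := ses_onto hs u; exists w.
have [K' [k' hk']] := ker_ex rcs.
have eK' := e1 _ _ _ _ (@projective_free _ _) hk'.
have [sx sxE] := linear_scale x 'rV[A]_n.
have [b0 b0E] := linear_pair k sx.
have [b bE] : exists b : {linear (K * 'rV[A]_n)%type -> K'}, forall z, k' (b z) = b0 z.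
  apply: ses_fac_l hk' _ => z /=; rewrite b0E linearD (ses_comp hs) add0r sxE linearZ /=.
  by rewrite (reduction_mul _ hr).
(* K embeds in K x P as the kernel of the map b, which sends (w, f) to k
   w + x f in K' *)
have [nx nxE] := linear_scale (- x) K.
have [a aE] := linear_copair nx k.
have hab : ses a b; first split.
- by apply: ker0_injective => u; rewrite aE => -[_ /(injective_ker0 (ses_inj hs))].
- move=> v; have /(reduction_ker hr) [y yE] : r (c (k' v)) = 0 by exact: (ses_comp hk').
  have [f fE] := ses_onto hs y.
  have /(ses_exact hs) [w wE] : c (k' v - x *: f) = 0 by rewrite linearB linearZ /= fE yE subrr.
  by exists (w, f); apply: (ses_inj hk'); rewrite bE b0E sxE /= -wE subrK.
- move=> [w f]; split=> [bw|[u ->]]; last first.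
    by apply: (ses_inj hk'); rewrite bE b0E aE sxE nxE linear0 linearZ /= scaleNr addNr.
  have E : k w + x *: f = 0 by have := bE (w, f); rewrite bw linear0 b0E sxE.
  have /(ses_exact hs) [u uE] : c f = 0.
    by apply: xN; have := congr1 c E; rewrite linearD (ses_comp hs) add0r linearZ linear0.
  exists u; rewrite aE uE nxE; congr (_, _); apply: (ses_inj hs).
  by apply/eqP; rewrite linearZ /= scaleNr -addr_eq0 -uE E.
pose Res := im (hom_comp (N := T) k).
have fK := fg_inj nA (ses_inj hs) (@fg_rV A n).
have all : forall h, h \in Res.
  apply: (nakayama_mul lA (fg_hom nA fK fT) xm) => h; have [g gE] := of_hom h.
  have [H HE] := eK' _ _ _ _ hab g.
  have [i1 i1E] := linear_copair (idfun : {linear K -> K}) (\0 : {linear K -> 'rV[A]_n}).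
  have [i2 i2E] := linear_copair (\0 : {linear 'rV[A]_n -> K})
    (idfun : {linear 'rV[A]_n -> 'rV[A]_n}).
  have [t tE] := hom_of (H \o i1); have [f fE] := hom_of (H \o i2).
  exists (hom_comp k f); first by apply/mem_im; exists f.
  exists (- t); apply: hom_eq => u; rewrite hom_valB hom_valZ.
  have -> : val (- t) u = - val t u by [].
  have -> : val (hom_comp k f) u = val f (k u) by [].
  rewrite tE fE -gE -HE /= aE nxE i1E i2E /=.
  rewrite scalerN -!linearZ -!linearB /= -linearN; congr (H _).
  by apply: injective_projections; rewrite /= ?scaler0 ?subr0 ?oppr0 ?subrr ?scaleNr.
apply: (ext1_zero_presentation (@projective_free _ _) hs) => g; have [h hE] := hom_of g.
have /mem_im [f fE] := all h; have [f' f'E] := of_hom f.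
by exists f' => w; rewrite f'E -hE fE.
Qed.

Lemma regular_rV (x : A) n : regular_on x (A^o : lmodType A) -> regular_on x 'rV[A]_n.
Proof.
move=> rx c E; apply/rowP => i; rewrite mxE; apply: rx.
by have := congr1 (fun c : 'rV[A]_n => c 0 i) E; rewrite !mxE.
Qed.

(** Higher Ext is reached by passing to a syzygy K of N. For x regular on A,
    the module P / xP has projective dimension at most one, so Ext^(i+1) (K
    / xK) vanishes together with Ext^(i+2) (N / xN). *)
Lemma extS_zero_nakayama T (x : A) i N N' (r : {linear N -> N'}) :
  regular_on x (A^o : lmodType A) ->
  fin_gen N -> fin_gen T ->
  (x : A^o) \in m -> regular_on x N -> is_reduction x r -> extS_zero T i.+1 N' -> extS_zero T i N.
Proof.
move=> xA fN fT xm; elim: i N N' r fN => [|i IH] N N' r fN xN hr eN'.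
  exact: ext1_zero_nakayama fN fT xm xN hr eN'.
have [n [K [k [c hs]]]] := fg_cover fN.
have xP := regular_rV (n := n) xA.
have [K' [k' hk]] := reduction_ex x K; have [P' [p' hp]] := reduction_ex x 'rV[A]_n.
have [i' [c' [hs' _ _]]] := ses_reduction hs xN hk hp hr.
have [f _ hf] := reduction_ses xP hp.
have fK := fg_inj nA (ses_inj hs) (@fg_rV A n).
apply: (extS_zero_shift (@projective_free _ _) hs); apply: (IH K K' k' fK) => //.
  by move=> u xu; apply: (injective_ker0 (ses_inj hs)); apply: xP; rewrite -linearZ xu linear0.
apply: (extS_zero_sub nA hs') eN'; first exact: reduction_fg hp (@fg_rV A n).
apply: (extS_zero_shift (@projective_free _ _) hf); apply: extS_zero_proj.
exact: projective_free.
Qed.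

Lemma extS_zero_reduction T (x : A) i N N' (r : {linear N -> N'}) :
  fin_gen N -> regular_on x N -> is_reduction x r ->
  extS_zero T i N -> extS_zero T i.+1 N -> extS_zero T i.+1 N'.
Proof.
by move=> fN xN hr; have [f _ hf] := reduction_ses xN hr; exact: (extS_zero_quot nA hf fN).
Qed.

Lemma extS_zero_reduction_target T T' (x : A) (r : {linear T -> T'}) i N :
  fin_gen N -> regular_on x T -> is_reduction x r ->
  extS_zero T i N -> extS_zero T i.+1 N -> extS_zero T' i N.
Proof.
by move=> fN xT hr; have [f _ hf] := reduction_ses xT hr; exact: (extS_zero_target nA hf fN).
Qed.

(** N is zero or the residue field, which embeds in Y as the submodule
    generated by the socle element c; the claim then comes from the cokernel
    of N -> Y. *)
Lemma extS_zero_residue T i Y N (c : Y) (u : N) : fin_gen Y -> c <> 0 ->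
  (forall a : A, (a : A^o) \in m -> a *: c = 0) -> (forall v : N, exists a : A, v = a *: u) ->
  (forall a : A, (a : A^o) \in m -> a *: u = 0) ->
  extS_zero T i Y -> (forall Q (q : {linear Y -> Q}), onto q -> extS_zero T i.+1 Q) ->
  extS_zero T i N.
Proof.
move=> fY c0 mc gu mu eY eQ.
case: (pselect (u = 0)) => [u0|u0].
  have zN : zero_mod N by move=> v; have [a ->] := gu v; rewrite u0 scaler0.
  apply: extS_zero_proj => E Q p f ps; exists \0 => v.
  by rewrite [v]zN !linear0.
have unit_u (a : A) : a *: u = 0 -> (a : A^o) \in m.
  move=> au; apply: contrapT => /negP /(local_unit lA) [b ba].
  by apply: u0; rewrite -[u]scale1r -ba -scalerA au scaler0.
have [f fE] := orbit_map u; have [g gE] := orbit_map c.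
have fs : onto f by move=> v; have [a ->] := gu v; exists a; rewrite fE.
have [|h hE] := factor_onto (f := g) fs.
  by move=> a; rewrite fE gE => /unit_u /mc.
have hi : injective h.
  apply: ker0_injective => v; have [a <-] := fs v; rewrite hE gE fE => ac.
  apply: mu; apply: contrapT => /negP /(local_unit lA) [b ba].
  by apply: c0; rewrite -[c]scale1r -ba -scalerA ac scaler0.
have hq : ses h (qmap (im h)); first split=> //.
- exact: qmap_onto.
- by move=> v; split=> [/qmap_eq0 /mem_im|H]; last by apply/qmap_eq0/mem_im.
apply: (extS_zero_sub nA hq fY eY); apply: eQ; exact: qmap_onto.
Qed.

(** Noetherian induction on the annihilator of the generator u. If a in m
    does not kill u, then N is an extension of the cyclic modules N / a u
    and A a u, whose annihilators are larger: one contains a, and the other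
    contains the last power of a not killing u. *)
Lemma extS_zero_nil_cyclic T i Y (c : Y) : fin_gen Y -> c <> 0 ->
  (forall a : A, (a : A^o) \in m -> a *: c = 0) ->
  extS_zero T i Y -> (forall Q (q : {linear Y -> Q}), onto q -> extS_zero T i.+1 Q) ->
  forall N (u : N), (forall v : N, exists a : A, v = a *: u) ->
  (forall a : A, (a : A^o) \in m -> exists k, a ^+ k *: u = 0) -> extS_zero T i N.
Proof.
move=> fY c0 mc eY eQ.
suff H (I : submodule A^o) : forall N (u : N), (forall v : N, exists a : A, v = a *: u) ->
    (forall a : A, (a : A^o) \in m -> exists k, a ^+ k *: u = 0) ->
    (forall a : A, (a : A^o) \in I <-> a *: u = 0) -> extS_zero T i N.
  move=> N u gu nu; have [f fE] := orbit_map u; apply: (H (ker f)) gu nu _ => a.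
  by rewrite mem_ker fE; split=> /eqP.
move: I; apply: (noeth_ind nA) => I IH N u gu nu uI.
case: (pselect (exists2 a : A, (a : A^o) \in m & a *: u <> 0)) => [[a am au]|no]; last first.
  apply: (extS_zero_residue fY c0 mc gu) eY eQ => a am.
  by apply: contrapT => au; apply: no; exists a.
have [k [ak ak1]] : exists k, a ^+ k *: u <> 0 /\ a ^+ k.+1 *: u = 0.
  have exk : exists k, (a ^+ k *: u == 0) by have [k kE] := nu a am; exists k; exact/eqP.
  case: (ex_minnP exk) => -[|k] /eqP kE mn.
    by case: au; rewrite -[u]scale1r -(expr0 a) kE scaler0.
  exists k; split=> // kE0; have := mn k; rewrite kE0 eqxx ltnn => /(_ isT) //.
have [f fE] := orbit_map (a *: u).
have [|j jE] := factor_injective (f := f) (@incl_inj A N (im f)).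
  by move=> b; have /incl_ex [v vE] : f b \in im f by [apply/mem_im; exists b]; exists v.
have hq := qmap_ses (im f).
have js : onto j.
  by move=> v; have /mem_im [b bE] := incl_in v; exists b; apply: (@incl_inj A); rewrite jE.
have jE1 (b : A) : incl (im f) (j b) = b *: (a *: u) by rewrite jE fE.
have jE2 : incl (im f) (j (1 : A^o)) = a *: u by rewrite jE1; exact: scale1r.
have gen1 (v : sub_mod (im f)) : exists b : A, v = b *: j (1 : A^o).
  have [b <-] := js v; exists b; apply: (@incl_inj A).
  by rewrite linearZ /= jE2 jE1.
have [f1 f1E] := orbit_map (j (1 : A^o)).
have [f2 f2E] := orbit_map (qmap (im f) u).
have aq : a *: qmap (im f) u = 0.
  by rewrite -linearZ; apply/qmap_eq0/mem_im; exists (1 : A^o); rewrite fE; exact: esym (scale1r _).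
apply: (extS_zero_ext nA hq).
- by apply: (fg_surj js); exact: noeth_fg.
- by apply: (fg_surj (f := f2)) (noeth_fg nA) => v; have [w <-] := qmap_onto v;
    have [b ->] := gu w; exists b; rewrite f2E linearZ.
- apply: (IH (ker f1)) gen1 _ _.
  + move=> b /uI bu; rewrite mem_ker f1E; apply/eqP/(@incl_inj A).
    by rewrite linearZ /= jE2 scalerA mulrC -scalerA bu scaler0 linear0.
  + exists (a ^+ k : A^o).
      rewrite mem_ker f1E; apply/eqP/(@incl_inj A).
      by rewrite linearZ /= jE2 scalerA -exprSr ak1 linear0.
    by apply/negP => /uI.
  + move=> b /nu [l lE]; exists l; apply: (@incl_inj A).
    by rewrite linearZ /= jE2 scalerA mulrC -scalerA lE scaler0 linear0.
  + by move=> b; rewrite mem_ker f1E; split=> /eqP.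
- apply: (IH (ker f2)) (qmap (im f) u) _ _ _.
  + by move=> b /uI bu; rewrite mem_ker f2E -linearZ bu linear0.
  + exists (a : A^o); first by rewrite mem_ker f2E aq.
    by apply/negP => /uI.
  + by move=> v; have [w <-] := qmap_onto v; have [b ->] := gu w; exists b; rewrite linearZ.
  + by move=> b /nu [l lE]; exists l; rewrite -linearZ lE linear0.
  + by move=> b; rewrite mem_ker f2E; split=> /eqP.
Qed.

(** Descending induction on i from a degree where Ext vanishes altogether.
    This is the proof that the injective dimension is at most the depth of
    the ring, carried out for cyclic modules on which the elements of m are
    nilpotent. *)
Lemma extS_zero_nil_from T n k Y (c : Y) : (forall N i, (n <= i)%N -> extS_zero T i N) ->
  fin_gen Y -> c <> 0 ->
  (forall a : A, (a : A^o) \in m -> a *: c = 0) ->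
  (exists y : Y, (forall v : Y, exists a : A, v = a *: y) /\
    forall a : A, (a : A^o) \in m -> exists l, a ^+ l *: y = 0) ->
  (forall i, (k <= i)%N -> extS_zero T i Y) ->
  forall i, (k <= i)%N -> forall N (u : N), (forall v : N, exists a : A, v = a *: u) ->
  (forall a : A, (a : A^o) \in m -> exists l, a ^+ l *: u = 0) -> extS_zero T i N.
Proof.
move=> big fY c0 mc [y [gy ny]] eY i.
have [l] : exists l, (n <= i + l)%N by exists n; exact: leq_addl.
elim: l i => [|l IH] i nil ki N u gu nu; first by apply: big; rewrite addn0 in nil.
apply: (extS_zero_nil_cyclic fY c0 mc (eY i ki)) gu nu => Q q qs.
apply: (IH i.+1 _ _ Q (q y)); first by rewrite addSnnS.
- exact: leqW.
- by move=> v; have [w <-] := qs v; have [b ->] := gy w; exists b; rewrite linearZ.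
- by move=> a /ny [t tE]; exists t; rewrite -linearZ tE linear0.
Qed.

End NakayamaExt.

(** * Depth of annihilators in a module *)

Section Colon.
Variables (A : comPzRingType) (m : submodule A^o).
Hypothesis lA : noeth_local m.
Implicit Types (B C D E F H K L M N P Q R T U V W X Y Z : lmodType A).

Lemma colonP M (I : {pred A}) (u : M) :
  u \in colon M I <-> forall a : A, a \in I -> a *: u = 0.
Proof. by split=> /asboolP. Qed.

Lemma smul_map M N (f : {linear M -> N}) (J : {pred A}) u : u \in smul M J -> f u \in smul N J.
Proof.
move=> /asboolP [s sJ ->]; rewrite linear_sum big_seq; apply: rpred_sum => p ps.
by rewrite linearZ; apply: mem_smul; exact: sJ.
Qed.

Lemma smul_lift M N (f : {linear M -> N}) (J : {pred A}) v : onto f -> v \in smul N J ->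
  exists2 u, u \in smul M J & f u = v.
Proof.
move=> fs /asboolP [s]; elim: s v => [|[a t] s IH] v sJ ->.
  by exists 0; [exact: rpred0|rewrite linear0 big_nil].
have [|w wJ wE] := IH _ _ erefl; first by move=> p ps; apply: sJ; rewrite inE ps orbT.
have [t' tE] := fs t; exists (a *: t' + w).
  apply: rpredD wJ; apply: mem_smul; exact: (sJ (a, t) (mem_head _ _)).
by rewrite linearD linearZ /= tE wE big_cons.
Qed.

(** Both J T and T / J T reduce well modulo an element x regular on T: 0 :_T
    I is the module of maps A / I -> T, these lift along T -> T / xT because
    Ext^1 (A / I, T) = 0, and x t in 0 :_T I implies t in 0 :_T I. *)
Lemma depth_ge_colon n T (I J : submodule A^o) : fin_gen T -> depth_ge m n T ->
  (forall i, extS_zero T i (quot_mod I)) -> colon T I =i smul T J ->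
  depth_ge m n (sub_mod (smul T J)) /\ depth_ge m n (quot_mod (smul T J)).
Proof.
elim: n T => [//|n IH] T fT [x [xm xT [T' [q [hq dT']]]]] eT cT.
have fQ : fin_gen (quot_mod I).
  apply: (fg_surj (@qmap_onto A (A^o) I)); apply: noeth_fg; exact: local_noeth lA.
have eT' i : extS_zero T' i (quot_mod I).
  exact: (extS_zero_reduction_target lA fQ xT hq (eT i) (eT i.+1)).
(* an element of T' killed by I is a map A / I -> T', which lifts to T *)
have cT' : colon T' I =i smul T' J.
  move=> u; apply/idP/idP; last first.
    case/(smul_lift (reduction_onto hq)) => v; rewrite -cT => /colonP vI <-.
    by apply/colonP => a aI; rewrite -linearZ vI // linear0.
  move/colonP => uI; have [f fE] := orbit_map u.
  have [|g gE] := factor_onto (f := f) (@qmap_onto A (A^o) I).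
    by move=> a /qmap_eq0 aI; rewrite fE uI.
  have [sx _ hs] := reduction_ses xT hq.
  have [h hE] := ext1_zero_lift g (eT 0) hs.
  pose v := h (qmap I (1 : A)).
  have -> : u = q v by rewrite hE gE fE scale1r.
  apply: smul_map; rewrite -cT; apply/colonP => a aI.
  have av : a *: qmap I (1 : A) = 0.
    by rewrite -linearZ; apply/qmap_eq0; have -> : a *: (1 : A^o) = a by exact: mulr1.
  by rewrite /v -linearZ av linear0.
have [dS dQ] := IH T' (reduction_fg hq fT) dT' eT' cT'.
(* x is regular on T / J T *)
have divx t : x *: t \in smul T J -> t \in smul T J.
  rewrite -!cT => /colonP H; apply/colonP => a aI; apply: xT.
  by rewrite scalerA mulrC -scalerA H.
split; exists x; split=> //.
- by move=> u xu; apply: (@incl_inj A); rewrite linear0; apply: xT; rewrite -linearZ xu linear0.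
- have [||r rE] := factor_injective (j := incl (smul T' J)) (f := q \o incl (smul T J)).
  + exact: incl_inj.
  + move=> t; have := smul_map q (incl_in t) => /incl_ex [w wE]; by exists w.
  exists (sub_mod (smul T' J)), r; split=> //; split.
  + move=> w; have [u uJ uE] := smul_lift (reduction_onto hq) (incl_in w).
    have [t tE] := incl_ex uJ; exists t; apply: (@incl_inj A).
    by rewrite rE /= tE uE.
  + move=> t; split=> [rt|[v ->]].
      have /(reduction_ker hq) [w wE] : q (incl (smul T J) t) = 0.
        by rewrite -[LHS]/((q \o incl _) t) -rE rt linear0.
      have /incl_ex [v vE] : w \in smul T J by apply: divx; rewrite -wE incl_in.
      by exists v; apply: (@incl_inj A); rewrite wE linearZ /= vE.
    apply: (@incl_inj A); rewrite rE [RHS]linear0 /=.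
    have -> : incl (smul T J) (x *: v) = x *: incl (smul T J) v by exact: linearZ.
    exact: reduction_mul hq.
- move=> u; have [t <-] := qmap_onto u; rewrite -linearZ => /qmap_eq0 /divx H.
  exact/qmap_eq0.
- have [|r rE] := factor_onto (f := qmap (smul T' J) \o q) (@qmap_onto A T (smul T J)).
    by move=> t /qmap_eq0 tJ; apply/qmap_eq0; exact: smul_map.
  exists (quot_mod (smul T' J)), r; split=> //; split.
  + move=> w; have [u <-] := qmap_onto w; have [t <-] := reduction_onto hq u.
    by exists (qmap (smul T J) t); rewrite rE.
  + move=> w; have [t <-] := qmap_onto w; rewrite rE /=; split.
      move=> /qmap_eq0 /(smul_lift (reduction_onto hq)) [u uJ uE].
      have /(reduction_ker hq) [v vE] : q (t - u) = 0 by rewrite linearB uE subrr.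
      have {}uJ : qmap (smul T J) u = 0 by apply/qmap_eq0.
      exists (qmap (smul T J) v); rewrite -[LHS]subr0 -uJ -linearB vE.
      exact: linearZ.
    case=> v; have [s <-] := qmap_onto v; rewrite -linearZ => /eqP.
    rewrite -subr_eq0 -linearB => /eqP /qmap_eq0 /(smul_map q).
    rewrite linearB (reduction_mul _ hq) subr0 => H; exact/qmap_eq0.
Qed.

End Colon.

(** * Modules of finite Gorenstein dimension *)

Section Dual.
Variables (A : comPzRingType) (m : submodule A^o).
Hypothesis lA : noeth_local m.
Implicit Types (B C D E F H K L M P Q R T U V W X Y Z : lmodType A).
Let nA := local_noeth lA.

Lemma projective_zero Z : zero_mod Z -> projective Z.
Proof. by move=> z E Q p f _; exists \0 => u; rewrite [u]z !linear0. Qed.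

Section Complex.
Variables (N : nat -> lmodType A) (phi : forall i, {linear N i -> N i.+1}) (n : nat).
Hypothesis fN : forall i, fin_gen (N i).
Hypothesis zN : forall i, (n < i)%N -> zero_mod (N i).
Hypothesis phi2 : forall i u, phi i.+1 (phi i u) = 0.

(** If the image of phi i is all of the next cycle module, N i is an
    extension of it by the cycles of degree i. *)
Lemma cycles_ses i : (forall z, exists u, phi i u = incl (ker (phi i.+1)) z) ->
  exists2 q : {linear N i -> sub_mod (ker (phi i.+1))},
    ses (incl (ker (phi i))) q & forall u, incl _ (q u) = phi i u.
Proof.
move=> on; have [||q qE] := factor_injective (j := incl (ker (phi i.+1))) (f := phi i).
- exact: incl_inj.
- move=> u; have /incl_ex [v vE] : phi i u \in ker (phi i.+1) by rewrite mem_ker phi2.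
  by exists v.
exists q => //; split; first exact: incl_inj.
- by move=> z; have [u uE] := on z; exists u; apply: (@incl_inj A); rewrite qE.
- move=> u; split=> [qu|[v ->]].
    have /incl_ex [v <-] : u \in ker (phi i) by rewrite mem_ker -qE qu linear0.
    by exists v.
  by apply: (@incl_inj A); rewrite qE linear0; apply/eqP; exact: (incl_in v).
Qed.

(** The dual of the complex N with values in T is a resolution of M, with
    augmentation e, and the N i are acyclic for Hom into T. Exactness at the
    last term is the case of N i.+2 being zero. *)
Record dual_res T M (e : {linear hom (N 0) T -> M}) : Prop := DualRes {
  dual_res_ext : forall i j, extS_zero T j (N i);
  dual_res_exact : forall i (h : {linear N i.+1 -> T}), (forall u, h (phi i u) = 0) ->
    exists g : {linear N i.+2 -> T}, forall u, h u = g (phi i.+1 u);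
  dual_res_onto : onto e;
  dual_res_ker : forall h, e h = 0 -> exists g : {linear N 1 -> T}, forall u, val h u = g (phi 0 u);
  dual_res_comp : forall h (g : {linear N 1 -> T}), (forall u, val h u = g (phi 0 u)) -> e h = 0 }.

(** When T has a socle element c, the complex N is exact in positive degrees
    and its cycles have no Ext into T. Going down from degree n: if phi i
    were not onto the cycles Z of degree i + 1, some non-zero map Z -> T
    with image spanned by c would kill the image of phi i. It extends to N
    i.+1 since Z is the kernel of a surjection onto a module with no Ext^1,
    and the extension factors through phi i.+1 by exactness of the dual,
    hence vanishes on Z. *)
Lemma dual_res_cycles T M (e : {linear hom (N 0) T -> M}) (c : T) : dual_res e -> c <> 0 ->
  (forall a : A, (a : A^o) \in m -> a *: c = 0) -> forall i,
  [/\ forall j, extS_zero T j (sub_mod (ker (phi i))),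
      forall j, extS_zero T j (sub_mod (ker (phi i.+1)))
    & forall z, exists u, phi i u = incl (ker (phi i.+1)) z].
Proof.
move=> he c0 mc i; have [k] : exists k, (n < i + k)%N by exists n.+1; rewrite addnS ltnS leq_addl.
elim: k i => [|k IH] i.
  rewrite addn0 => ni.
  have zi j : (n < j)%N -> zero_mod (sub_mod (ker (phi j))).
    by move=> nj u; apply: (@incl_inj A); exact: etrans (zN nj _) (esym (zN nj _)).
  split=> [j|j|z].
  - by apply: extS_zero_proj; apply: projective_zero; exact: zi.
  - by apply: extS_zero_proj; apply: projective_zero; apply: zi; exact: leqW.
  - by exists 0; exact: etrans (zN (leqW ni) _) (esym (zN (leqW ni) _)).
rewrite addnS -addSn => /IH [e1 e2 on].
have [q hq _] := cycles_ses on.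
have [||psi psiE] := factor_injective (j := incl (ker (phi i.+1))) (f := phi i).
- exact: incl_inj.
- move=> u; have /incl_ex [v vE] : phi i u \in ker (phi i.+1) by rewrite mem_ker phi2.
  by exists v.
have psis : onto psi.
  move=> z; apply: contrapT => no.
  have [|h [hk [v hv] _]] := residue_hom lA (c := c) (N := im psi)
    (fg_sub nA (ker (phi i.+1)) (fN _)) _ mc.
    by exists z; apply/negP => /mem_im [u uE]; apply: no; exists u.
  have [H HE] := e2 0 _ _ _ _ hq h.
  have [|g gE] := dual_res_exact he (h := H).
    by move=> u; rewrite -psiE HE; apply: hk; apply/mem_im; exists u.
  apply: c0; rewrite -hv -HE gE; have := incl_in v; rewrite mem_ker => /eqP ->.
  exact: linear0.
have onZ z : exists u, phi i u = incl (ker (phi i.+1)) z.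
  by have [u <-] := psis z; exists u; rewrite psiE.
have [q' hs _] := cycles_ses onZ.
split=> // j; exact: (extS_zero_sub nA hs (fN i) (dual_res_ext he i j) (e1 j.+1)).
Qed.

(** By dual_res_cycles, M is Hom (Z, T) with Z the cycles of degree 0, and a
    map from Z to the socle element of T gives a socle element of M. *)
Lemma dual_res_socfree T M (e : {linear hom (N 0) T -> M}) : dual_res e -> ~ zero_mod M ->
  socfree m M -> socfree m T.
Proof.
move=> he nz sM c mc; apply: contrapT => c0; apply: nz => w.
have [_ e1 on0] := dual_res_cycles he c0 mc 0.
have [_ e2 on1] := dual_res_cycles he c0 mc 1.
have [q0 h0 q0E] := cycles_ses on0; have [q1 h1 _] := cycles_ses on1.
have ext1 (H : {linear N 0 -> T}) : (forall z, H (incl (ker (phi 0)) z) = 0) ->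
    exists g : {linear N 1 -> T}, forall u, H u = g (phi 0 u).
  move=> H0; have [g1 g1E] := ses_fac_r h0 H0; have [g gE] := e2 0 _ _ _ _ h1 g1.
  by exists g => u; rewrite -q0E gE g1E.
have [h <-] := dual_res_onto he w.
have [f fE] := of_hom h.
suff z0 : zero_mod (sub_mod (ker (phi 0))).
  have [z|g gE] := ext1 f; first by rewrite [z]z0 !linear0.
  by apply: (dual_res_comp he (g := g)) => u; rewrite -fE.
apply: contrapT => nz0.
have [|r [_ [v vE] mr]] := residue_hom lA (c := c) (N := zero_sub _)
  (fg_sub nA (ker (phi 0)) (fN 0)) _ mc.
  apply: contrapT => no; apply: nz0 => u; apply: contrapT => u0; apply: no.
  by exists u; rewrite zero_subP; exact/eqP.
have [H HE] := e1 0 _ _ _ _ h0 r; have [t tE] := hom_of H.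
have : e t = 0.
  apply: sM => a am; rewrite -linearZ; have [aH aHE] := of_hom (a *: t).
  have [z|g gE] := ext1 aH; first by rewrite aHE hom_valZ tE HE mr.
  by apply: (dual_res_comp he (g := g)) => u; rewrite -aHE.
case/(dual_res_ker he) => g gE; apply: c0; rewrite -vE -HE -tE gE.
by have := incl_in v; rewrite mem_ker => /eqP ->; rewrite linear0.
Qed.

(** Maps N i -> T / xT lift to T because Ext^1 (N i, T) = 0, and the dual
    complex stays exact because x is regular on all its terms and on M. *)
Lemma dual_res_reduction T M (e : {linear hom (N 0) T -> M}) x T' M'
    (r : {linear T -> T'}) (s : {linear M -> M'}) : dual_res e ->
  regular_on x T -> regular_on x M -> is_reduction x r -> is_reduction x s ->
  exists e' : {linear hom (N 0) T' -> M'}, dual_res e'.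
Proof.
move=> he xT xM hr hs.
have [sx sxE hsx] := reduction_ses xT hr.
have lift i (h : {linear N i -> T'}) : exists g : {linear N i -> T}, forall u, r (g u) = h u.
  exact: ext1_zero_lift h (dual_res_ext he i 0) hsx.
have divi i (h : {linear N i -> T}) : (forall u, r (h u) = 0) ->
    exists v : {linear N i -> T}, forall u, h u = x *: v u.
  move=> rh; have [v vE] := ses_fac_l hsx rh.
  by exists v => u; rewrite -vE sxE.
have [rho rhoE] : exists rho : {linear hom (N 0) T -> hom (N 0) T'},
    forall h u, val (rho h) u = r (val h u).
  have ex_f (h : hom (N 0) T) : exists h' : hom (N 0) T', forall u, val h' u = r (val h u).
    have [g gE] := of_hom h; have [h' hE] := hom_of (r \o g).
    by exists h' => u; rewrite hE /= gE.
  have [f fE0] := choice ex_f.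
  have fE' h u : val (f h) u = r (val h u) by exact: fE0.
  have [|rho rhoE] := @linear_ex A (hom (N 0) T) (hom (N 0) T') f.
    move=> a h h'; apply: hom_eq => u.
    by rewrite [LHS]fE' !hom_valD !hom_valZ [in RHS]fE' [in RHS]fE' linearP.
  by exists rho => h u; rewrite rhoE fE'.
have rhos : onto rho.
  move=> h; have [f fE] := of_hom h; have [g gE] := lift 0 f; have [t tE] := hom_of g.
  by exists t; apply: hom_eq => u; rewrite rhoE tE gE fE.
have rho0 h : rho h = 0 -> exists v, h = x *: v.
  move=> rh; have [f fE] := of_hom h; have [u|v vE] := divi 0 f.
    by rewrite fE -rhoE rh.
  have [t tE] := hom_of v; exists t; apply: hom_eq => u.
  by rewrite hom_valZ tE -vE fE.
have [|e' eE] := factor_onto (f := s \o e) rhos.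
  by move=> h /rho0 [v ->]; rewrite /= linearZ (reduction_mul _ hs).
exists e'; split.
- move=> i j; apply: (extS_zero_reduction_target lA (fN i) xT hr (dual_res_ext he i j)).
  exact: dual_res_ext he i j.+1.
- move=> i h h0; have [g gE] := lift _ h.
  have [u|v vE] := divi i (g \o phi i); first by rewrite /= gE h0.
  have [w wE] : exists w : {linear N i.+1 -> T}, forall u, v u = w (phi i u).
    case: i => [|i] in h h0 g gE v vE *.
      have [t tE] := hom_of v.
      have /(dual_res_ker he) [w wE] : e t = 0.
        apply: xM; rewrite -linearZ; apply: (dual_res_comp he (g := g)) => u.
        by rewrite hom_valZ tE -vE.
      by exists w => u; rewrite -tE wE.
    apply: (dual_res_exact he) => u; apply: xT.
    by rewrite -vE /= phi2 linear0.
  have [xw xwE] : exists f : {linear N i.+1 -> T}, forall u, f u = x *: w u.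
    by exists (sx \o w) => u /=; rewrite sxE.
  have [d dE] := linear_diff g xw.
  have [|f fE] := dual_res_exact he (h := d).
    by move=> u; rewrite dE xwE -wE -vE /= subrr.
  exists (r \o f) => u /=; rewrite -fE dE linearB xwE (reduction_mul _ hr) subr0.
  by rewrite gE.
- move=> w; have [v <-] := reduction_onto hs w; have [h <-] := dual_res_onto he v.
  by exists (rho h); rewrite eE.
- move=> h; have [t <-] := rhos h; rewrite eE /= => /(reduction_ker hs) [v].
  have [t' <-] := dual_res_onto he v; rewrite -linearZ => /eqP; rewrite -subr_eq0 -linearB.
  move=> /eqP /(dual_res_ker he) [g gE]; exists (r \o g) => u.
  by rewrite rhoE /= -gE hom_valB hom_valZ linearB (reduction_mul _ hr) subr0.
- move=> h g gE; have [g' g'E] := lift 1 g; have [t tE] := hom_of (g' \o phi 0).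
  have -> : h = rho t by apply: hom_eq => u; rewrite rhoE tE /= g'E gE.
  by rewrite eE /= (dual_res_comp he tE) linear0.
Qed.

(** As M has positive depth, so has T by dual_res_socfree; a common regular
    element reduces the claim to T / xT and M / xM. *)
Lemma dual_res_depth_ge d T M (e : {linear hom (N 0) T -> M}) : dual_res e -> fin_gen T ->
  ~ zero_mod M -> depth_ge m d M -> depth_ge m d T.
Proof.
elim: d T M e => [//|d IH] T M e he fT nz dM.
have sM := depth_ge_socfree dM; have sT := dual_res_socfree he nz sM.
have fM : fin_gen M by apply: fg_surj (dual_res_onto he) _; exact: fg_hom nA (fN 0) fT.
have [x [xm xT xM]] := regular_ex2 lA fT fM sT sM.
have [T' [r hr]] := reduction_ex x T; have [M' [s hs]] := reduction_ex x M.
have [e' he'] := dual_res_reduction he xT xM hr hs.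
exists x; split=> //; exists T', r; split=> //.
apply: (IH T' M' e') => //; first exact: reduction_fg hr fT.
  move=> z; apply: nz; apply: (nakayama0 lA fM xm) => u.
  by apply/(reduction_ker hs); exact: z.
exact: (depth_ge_reduction lA fM dM xm xM hs).
Qed.

End Complex.

Lemma min_gensP M : fin_gen M -> generates (@min_gens A M).
Proof.
rewrite /min_gens /mu => fM; case: pselect => // h.
by case: ex_minnP => n /asboolP [g gg] _; case: xgetP => [g' _ //|/= no]; case: (no g).
Qed.

Lemma cover_onto M : fin_gen M -> onto (@cover A M).
Proof. by move=> /min_gensP gg u; have [c ->] := gg u; exists c. Qed.

Lemma syz_ses M : fin_gen M -> exists (k : {linear syz1 M -> 'rV[A]_(mu M)}),
  ses k (@cover A M : {linear _ -> _}).
Proof. by move=> /cover_onto cs; exists (incl (ker (@cover A M))); exact: ker_ses. Qed.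

Lemma fg_syz M i : fin_gen M -> fin_gen (syz M i).
Proof.
move=> fM; elim: i => [//|i IH]; have [k hk] := syz_ses IH.
exact: (fg_inj nA (ses_inj hk) (@fg_rV A _)).
Qed.

(** A map on the syzygy, composed with the next free cover, is a cocycle; it
    is a coboundary exactly if the map extends to the free module. *)
Lemma Ext_ext1_zero M T i : fin_gen M -> Ext_vanishes M T i.+1 -> ext1_zero T (syz M i).
Proof.
move=> fM ext0; have fs := fg_syz i fM; have fs1 := fg_syz i.+1 fM.
have hk := ker_ses (cover_onto fs).
apply: (ext1_zero_presentation (@projective_free A _) hk) => g.
have [f fE] := hom_of (g \o (@cover A (syz M i.+1) : {linear _ -> _})).
have fc : f \in cocycle M T i.+1.
  apply/eqP; apply: hom_eq => c.
  have -> : val (hom_comp (N := T) (@res_diff A M i.+1) f) c = val f (res_diff c) by [].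
  rewrite fE -[RHS]/(0 : T) /=.
  have -> : cover (res_diff c : 'rV_(mu (syz M i.+1))) = 0; last exact: linear0.
  by apply/eqP; exact: (valP (cover c : sub_mod (ker (@cover A (syz M i.+1))))).
have := ext0 (qmap _ (exist _ f fc : sub_mod (cocycle M T i.+1))).
move/qmap_eq0 => /asboolP [f' f'E].
have [h hE] := of_hom f'; exists h => b.
have [c <-] := cover_onto fs1 b.
rewrite hE -[LHS]/(val (hom_comp (N := T) (@res_diff A M i) f') c).
by rewrite -[g _]/((g \o (@cover A (syz M i.+1) : {linear _ -> _})) c) -fE -f'E.
Qed.

Lemma Ext_extS_zero M T : fin_gen M -> (forall i, (0 < i)%N -> Ext_vanishes M T i) ->
  forall i, extS_zero T i M.
Proof.
move=> fM e i; suff H j : extS_zero T i (syz M j) by exact: (H 0).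
elim: i j => [|i IH] j; first by apply: Ext_ext1_zero => //; exact: e.
have [k hk] := syz_ses (fg_syz j fM); exact: extS_zero_shift (@projective_free A _) hk (IH j.+1).
Qed.

(** The complex N is the dual of the given resolution G. Its own dual is G
    again by biduality, which is what dual_res asks for. *)
Lemma Gres_depth_ge d M n : has_Gres M n -> ~ zero_mod M -> depth_ge m d M ->
  depth_ge m d (A^o : lmodType A).
Proof.
move=> [G [dd [e [tr zG es ex0 ex]]]] nz dM.
pose N i := hom (G i) (A^o : lmodType A) : lmodType A.
pose phi i := hom_comp (N := A^o) (dd i) : {linear N i -> N i.+1}.
have fA : fin_gen (A^o : lmodType A) := noeth_fg nA.
have zN i : (n < i)%N -> zero_mod (N i).
  move=> ni h; apply: hom_eq => u; have [f fE] := of_hom h.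
  by rewrite -fE [u]zG // linear0.
have fG i : fin_gen (G i).
  case: (leqP i n) => [/tr [] //|ni]; apply: fg_zero; exact: zG.
have fN i : fin_gen (N i) by exact: fg_hom nA (fG i) fA.
have phiE i (f : N i) u : val (phi i f) u = val f (dd i u) by [].
have phi2 i u : phi i.+1 (phi i u) = 0.
  apply: hom_eq => v; rewrite !phiE hom_val0.
  have -> : dd i (dd i.+1 v) = 0 by apply/ex; exists v.
  by have [f <-] := of_hom u; rewrite linear0.
have bil i : exists b : {linear G i -> hom (N i) A^o}, forall x, b x = bidual x.
  apply: (@linear_ex A (G i) (hom (N i) A^o) (@bidual A (G i))) => a x y.
  apply: hom_eq => f; have [g gE] := of_hom f.
  rewrite hom_valD hom_valZ.
  have bE v : val (bidual v) f = g v by rewrite gE.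
  by rewrite !bE linearP.
have bij0 i : (i <= n)%N -> bijective (@bidual A (G i)) by case/tr.
have evN i j : extS_zero (A^o) j (N i).
  case: (leqP i n) => [/tr [_ _ _ e2]|ni]; first exact: Ext_extS_zero.
  by apply: extS_zero_proj; apply: projective_zero; exact: zN.
have [b0 b0E] := bil 0.
have b0i : injective b0.
  by move=> u v; rewrite !b0E; exact: (bij_inj (bij0 0 (leq0n n))).
have [||e' eE] := factor_onto (p := b0) (f := e).
- by move=> h; have [b bK Kb] := bij0 0 (leq0n n); exists (b h); rewrite b0E Kb.
- by move=> u /(injective_ker0 b0i) ->; exact: linear0.
have b0s (h : hom (N 0) A^o) : exists u, h = bidual u.
  by have [b bK Kb] := bij0 0 (leq0n n); exists (b h); rewrite Kb.
suff he : dual_res phi e' by exact: (dual_res_depth_ge fN zN phi2 he fA nz dM).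
split=> //.
- move=> i h h0; case: (leqP i.+1 n) => [ni|ni]; last first.
    by exists \0 => u; rewrite [u]zN // !linear0.
  have [t tE] := hom_of h; have [b bK Kb] := bij0 _ ni.
  have [g gE] : exists g, t = bidual g by exists (b t); rewrite Kb.
  have : dd i g = 0.
    apply: (bij_inj (bij0 _ (ltnW ni))); apply: hom_eq => f.
    transitivity (val (phi i f) g); first by [].
    transitivity (val t (phi i f)); first by rewrite gE.
    by rewrite tE h0; have [f' f'E] := of_hom f; rewrite /= -f'E linear0.
  move/ex => [g' g'E]; have [b1 b1E] := bil i.+2; have [f fE] := of_hom (b1 g').
  exists f => u; rewrite -tE gE fE b1E /= g'E; exact: erefl.
- by move=> w; have [u <-] := es w; exists (b0 u); rewrite eE.
- move=> h; have [u uE] := b0s h; rewrite uE -b0E eE => /ex0 [g' g'E].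
  have [b1 b1E] := bil 1%N; have [f fE] := of_hom (b1 g').
  exists f => v; rewrite b0E fE b1E /= g'E; exact: erefl.
- move=> h g gE; have [u uE] := b0s h; rewrite uE -b0E eE; apply/ex0.
  have [t tE] := hom_of g.
  case: (leqP 1 n) => [n1|n1].
    have [b bK Kb] := bij0 _ n1; exists (b t).
    apply: (bij_inj (bij0 0 (leq0n n))); apply: hom_eq => f.
    transitivity (val h f); first by rewrite uE.
    rewrite gE -tE -{1}(Kb t); exact: erefl.
  exists 0; rewrite linear0; apply: (bij_inj (bij0 0 (leq0n n))); apply: hom_eq => f.
  transitivity (val h f); first by rewrite uE.
  have -> : val h f = 0 by rewrite gE [phi 0 f]zN // linear0.
  by have [f' f'E] := of_hom f; rewrite /= -f'E linear0.
Qed.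

End Dual.

(** * Depth over a quotient ring *)

Section Transfer.
Variables (R S : comPzRingType) (sg : R -> S).
Hypothesis sgs : onto sg.
Variables (m : submodule R^o) (mS : submodule S^o).
Hypothesis mSE : forall a : R, ((sg a : S^o) \in mS) = ((a : R^o) \in m).

(** An isomorphism between a module over R and one over S along the
    surjection sg from R to S. *)
Definition semi_iso (M : lmodType R) (M' : lmodType S) (f : M -> M') :=
  [/\ forall u v, f (u + v) = f u + f v, forall (a : R) u, f (a *: u) = sg a *: f u & bijective f].

Lemma semi_iso0 (M : lmodType R) (M' : lmodType S) (f : M -> M') : semi_iso f -> f 0 = 0.
Proof. by case=> fD _ _; apply: (@addrI _ (f 0)); rewrite -fD !addr0. Qed.

Lemma semi_iso_reduction (M : lmodType R) (M' : lmodType S) (f : M -> M') (x : R)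
    (Q : lmodType R) (Q' : lmodType S) (q : {linear M -> Q}) (q' : {linear M' -> Q'}) :
  semi_iso f -> is_reduction x q -> is_reduction (sg x) q' -> exists g : Q -> Q', semi_iso g.
Proof.
move=> hf hq hq'; have f0 := semi_iso0 hf; case: hf => fD fZ bf.
have [fi fK Kf] := bf.
have fN u : f (- u) = - f u by apply: (@addrI _ (f u)); rewrite -fD !subrr.
have [s sE] := choice (reduction_onto hq).
have q'f u v : q u = q v -> q' (f u) = q' (f v).
  move=> /eqP; rewrite -subr_eq0 -linearB => /eqP /(reduction_ker hq) [w wE].
  apply/subr0_eq; rewrite -linearB -fN -fD wE fZ; exact: reduction_mul hq'.
exists (fun v => q' (f (s v))); split.
- by move=> u v; rewrite -linearD -fD; apply: q'f; rewrite sE linearD !sE.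
- by move=> a v; rewrite -linearZ -fZ; apply: q'f; rewrite sE linearZ /= sE.
have [s' sE'] := choice (reduction_onto hq').
exists (fun v => q (fi (s' v))).
- move=> v; rewrite -[RHS]sE; apply/subr0_eq; rewrite -linearB; apply/(reduction_ker hq).
  have /(reduction_ker hq') [w wE] : q' (s' (q' (f (s v))) - f (s v)) = 0.
    by rewrite linearB sE' subrr.
  exists (fi w); apply: (bij_inj bf); rewrite fZ Kf -wE fD fN Kf //.
- move=> v; rewrite -[RHS]sE'; transitivity (q' (f (fi (s' v)))); last by rewrite Kf.
  by apply: q'f; rewrite sE.
Qed.

(** Regular sequences over S lift to R and have the same effect on both
    modules. *)
Lemma depth_ge_semi n (M : lmodType R) (M' : lmodType S) (f : M -> M') :
  semi_iso f -> depth_ge m n M <-> depth_ge mS n M'.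
Proof.
elim: n M M' f => [//|n IH] M M' f hf; have f0 := semi_iso0 hf.
have [fD fZ bf] := hf; have [fi fK Kf] := bf.
have regE x : regular_on x M <-> regular_on (sg x) M'.
  split=> H u.
    by rewrite -[u]Kf -fZ -f0 => /(bij_inj bf) /H ->.
  by move=> xu; apply: (bij_inj bf); rewrite f0; apply: H; rewrite -fZ xu f0.
split=> [[x [xm xM [Q [q [hq dQ]]]]]|[y [ym yM [Q' [q' [hq' dQ]]]]]].
  have [Q' [q' hq']] := reduction_ex (sg x) M'.
  have [g hg] := semi_iso_reduction hf hq hq'.
  exists (sg x); split; [by rewrite mSE|exact/regE|].
  by exists Q', q'; split=> //; apply/(IH _ _ _ hg).
have [x xE] := sgs y; rewrite -xE in ym yM hq'.
have [Q [q hq]] := reduction_ex x M; have [g hg] := semi_iso_reduction hf hq hq'.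
exists x; split; [by rewrite -mSE|exact/regE|].
by exists Q, q; split=> //; apply/(IH _ _ _ hg).
Qed.

End Transfer.

(** * Prime chains and Ext of maximal Cohen-Macaulay quotients *)

Section Primes.
Variable R : comNzRingType.
Hypothesis nR : noeth_ring R.
Implicit Types (L M N P Q T X Y : lmodType R).

Lemma prime_idealr_ex (S : {pred R}) : idealr_closed S -> prime_idealr_closed S ->
  exists p : prime_idealr R, forall a, (a \in (p : {pred R})) = (a \in S).
Proof.
move=> h1 h2; pose H1 := isIdealr.Build R S h1; pose H2 := isPrimeIdealrClosed.Build R S h2.
pose p : prime_idealr R := HB.pack S H1 H2.
by exists p.
Qed.

(** An ideal maximal among those disjoint from S and containing I is prime;
    it exists by Noetherian induction. *)
Lemma prime_avoiding_ex (I : submodule R^o) (S : {pred R}) : 1 \in S ->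
  (forall a b, a \in S -> b \in S -> a * b \in S) ->
  (forall a, a \in S -> (a : R^o) \notin I) ->
  exists p : prime_idealr R, (forall a, (a : R^o) \in I -> a \in (p : {pred R})) /\
    forall a, a \in S -> a \notin (p : {pred R}).
Proof.
move=> S1 SM; move: I; apply: (noeth_ind nR) => I IH dis.
case: (pselect (exists a b : R, [/\ (a * b : R^o) \in I, (a : R^o) \notin I & (b : R^o) \notin I])).
  move=> [a [b [abI aI bI]]].
  have step (c : R) : (c : R^o) \notin I ->
      (forall s, s \in S -> (s : R^o) \notin add_cyclic I (c : R^o)) ->
      exists p : prime_idealr R, (forall a, (a : R^o) \in I -> a \in (p : {pred R})) /\
      forall a, a \in S -> a \notin (p : {pred R}).
    move=> cI /(IH (add_cyclic I (c : R^o)) (@add_cyclic_sub _ _ I _)) [].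
      by exists (c : R^o) => //; exact: add_cyclic_mem.
    by move=> p [p1 p2]; exists p; split=> // t tI; apply: p1; exact: add_cyclic_sub.
  apply: contrapT => no.
  have meet (c : R) : (c : R^o) \notin I -> exists s t : R, s \in S /\ (s - t * c : R^o) \in I.
    move=> cI; apply: contrapT => no'; apply: no; apply: (step c cI) => s sS.
    by apply/negP => /asboolP [t tI]; apply: no'; exists s, t.
  have [s [t [sS sI]]] := meet a aI; have [s' [t' [sS' sI']]] := meet b bI.
  have /negP := dis _ (SM _ _ sS sS'); apply.
  have -> : s * s' = s' * (s - t * a) + (t * a) * (s' - t' * b) + (t * t') * (a * b) by ring.
  exact: (rpredD (rpredD (rpredZ s' sI) (rpredZ (t * a) sI')) (rpredZ (t * t') abI)).
move=> pr; have [||p pE] := @prime_idealr_ex (submod_pred I).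
- split; [exact: rpred0|exact: dis|move=> a u v uI vI].
  by apply: rpredD vI; exact: (rpredZ a uI).
- move=> u v uvI; apply: contrapT => /negP; rewrite negb_or => /andP [uI vI].
  by apply: pr; exists u, v.
by exists p; split=> a; rewrite pE //; exact: dis.
Qed.

Lemma ann_sub M : exists I : submodule R^o, forall a : R,
  ((a : R^o) \in I) = (a \in annihilator M).
Proof.
have cl : GRing.subsemimod_closed (annihilator M : {pred R^o}).
  split; first split.
  - by apply/asboolP => u; exact: scale0r.
  - move=> a b /asboolP Ha /asboolP Hb; apply/asboolP => u.
    by rewrite scalerDl Ha Hb addr0.
  - move=> c a /asboolP Ha; apply/asboolP => u.
    rewrite -[_ *: a]/(c * a); by rewrite -scalerA Ha scaler0.
by exists (Submodule cl).
Qed.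

Lemma annP M (a : R) : a \in annihilator M <-> forall u : M, a *: u = 0.
Proof. by split=> /asboolP. Qed.

(** The chain is extended below p 0 by a prime q containing ann Y and not x.
    It is found by avoiding the products of a power of x with an element
    outside p 0, none of which kills Y as x is regular on Y and ann Y lies
    in p 0. Avoiding them puts q inside p 0. *)
Lemma chain_reduction (x : R) Y Y' (q : {linear Y -> Y'}) k p :
  regular_on x Y -> is_reduction x q ->
  prime_chain Y' k p -> exists p', prime_chain Y k.+1 p'.
Proof.
move=> xY hq [sub incl].
have [I IE] := ann_sub Y.
(* none of these elements kills Y, and all elements outside p 0 are among
   them *)
pose S : {pred R} := fun a => `[< exists k s, s \notin (p 0 : {pred R}) /\ a = x ^+ k * s >].
have annY' a : (forall u : Y, a *: u = 0) -> a \in (p 0 : {pred R}).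
  move=> H; apply: sub; apply/annP => v; have [u <-] := reduction_onto hq v.
  by rewrite -linearZ H linear0.
have xp0 : x \in (p 0 : {pred R}).
  apply: sub; apply/annP => v; have [u <-] := reduction_onto hq v.
  rewrite -linearZ; exact: reduction_mul hq.
have [|||r [Ir rS]] := @prime_avoiding_ex I S.
- by apply/asboolP; exists 0, 1; rewrite expr0 mulr1; split=> //; rewrite idealr1.
- move=> _ _ /asboolP [i [s [sp ->]]] /asboolP [j [t [tp ->]]]; apply/asboolP.
  exists (i + j)%N, (s * t); split; last by rewrite exprD mulrACA.
  by rewrite prime_idealrM negb_or sp tp.
- move=> _ /asboolP [i [s [sp ->]]]; rewrite IE; apply/negP => /annP H.
  move/negP: sp; apply; apply: annY' => u.
  elim: i H => [|i IHi] H; first by have := H u; rewrite expr0 mul1r.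
  apply: IHi => v; apply: xY; have := H v.
  by rewrite exprS -mulrA -scalerA.
exists (fun i => if i is i'.+1 then p i' else r); split.
  by move=> a aY; apply: Ir; rewrite IE.
case=> [|i] ik; last exact: incl.
split.
  move=> a ar; apply: contrapT => /negP ap.
  suff /negP : a \notin (r : {pred R}) by [].
  by apply: rS; apply/asboolP; exists 0, a; rewrite expr0 mul1r.
exists x => //; apply: rS; apply/asboolP; exists 1%N, 1.
by rewrite expr1 mulr1; split=> //; rewrite idealr1.
Qed.

Lemma prime_ann M : ~ zero_mod M -> exists p, prime_chain M 0 p.
Proof.
move=> nz; have [I IE] := ann_sub M; have [|||p [pI _]] := @prime_avoiding_ex I (pred1 1).
- by rewrite inE.
- by move=> a b; rewrite !inE => /eqP -> /eqP ->; rewrite mulr1.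
- move=> a; rewrite inE IE => /eqP ->; apply/negP => /annP H; apply: nz => u.
  by rewrite -[u]scale1r H.
by exists (fun _ => p); split=> // a aM; apply: pI; rewrite IE.
Qed.

Variable m : submodule R^o.
Hypothesis lR : noeth_local m.

Lemma depth_ge_chain n L : fin_gen L -> ~ zero_mod L -> depth_ge m n L ->
  exists p, prime_chain L n p.
Proof.
elim: n L => [|n IH] L fL nz; first by move=> _; exact: prime_ann.
move=> [x [xm xL [Q [q [hq dQ]]]]]; have [|p pc] := IH Q (reduction_fg hq fL) _ dQ.
  by move=> z; apply: nz; apply: (nakayama0 lR fL xm) => u; apply/(reduction_ker hq); exact: z.
exact: chain_reduction xL hq pc.
Qed.

(** Otherwise some prime containing ann Y avoids the powers of a, so it lies
    strictly below m. *)
Lemma dim0_nil Y (y : Y) : (forall v : Y, exists a : R, v = a *: y) ->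
  (forall l p, prime_chain Y l p -> (l <= 0)%N) ->
  forall a : R, (a : R^o) \in m -> exists k, a ^+ k *: y = 0.
Proof.
move=> gy d0 a am; apply: contrapT => no.
have [I IE] := ann_sub Y.
pose S : {pred R} := fun b => `[< exists k, b = a ^+ k >].
have [|||p [pI pS]] := @prime_avoiding_ex I S.
- by apply/asboolP; exists 0; rewrite expr0.
- by move=> _ _ /asboolP [i ->] /asboolP [j ->]; apply/asboolP; exists (i + j)%N; rewrite exprD.
- by move=> _ /asboolP [k ->]; rewrite IE; apply/negP => /annP H; apply: no; exists k.
have [||pm pmE] := @prime_idealr_ex (submod_pred m).
- split; [exact: rpred0|exact: local_proper lR|move=> b u v um vm].
  by apply: rpredD vm; exact: (rpredZ b um).
- move=> u v uv; apply: contrapT => /negP; rewrite negb_or => /andP [/(local_unit lR) [b bE] vm].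
  by move/negP: vm; apply; rewrite -[v]mul1r -bE -mulrA; exact: (rpredZ b uv).
have : prime_chain Y 1 (fun i => if i is 0 then p else pm).
  split; first by move=> b bY; apply: pI; rewrite IE.
  case=> [|//] _; split.
    move=> b bp; rewrite pmE; apply: contrapT => /negP /(local_unit lR) [c cb].
    by have := @idealMr _ p c b bp; rewrite cb idealr1.
  by exists a; rewrite ?pmE //; apply: pS; apply/asboolP; exists 1%N; rewrite expr1.
by move/d0.
Qed.

(** Cut Y, X and R by a common regular element until Y, initially R, has
    depth 0; the hypotheses on depth and dimension of Y then give it a socle
    and make m nilpotent on it. The bound k, increasing by one at each cut,
    records that Y has acquired one more step of projective dimension. The
    vanishing for the last X follows from extS_zero_nil_from and is lifted
    by extS_zero_nakayama. *)
Lemma extS_zero_quotient n0 T : (forall N i, (n0 <= i)%N -> extS_zero T i N) -> fin_gen T ->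
  forall n k Y X (s : {linear Y -> X}) (y : Y), onto s ->
  (forall v : Y, exists a : R, v = a *: y) ->
  (n = 0%N \/ socfree m (R^o : lmodType R)) ->
  depth_ge m n Y -> depth_ge m n X -> ~ depth_ge m n.+1 Y ->
  (forall l p, prime_chain Y l p -> (l <= n)%N) ->
  (forall i, (k <= i)%N -> extS_zero T i Y) -> forall i, (k <= i)%N -> extS_zero T i X.
Proof.
move=> big fT; elim=> [|n IH] k Y X s y ss gy sR dY dX ndY dimY eY.
  have fY : fin_gen Y.
    have [f fE] := orbit_map y; apply: (fg_surj (f := f)) (noeth_fg nR) => v.
    by have [a ->] := gy v; exists a; rewrite fE.
  have [c [c0 mc]] : exists c : Y, c <> 0 /\ forall a : R, (a : R^o) \in m -> a *: c = 0.
    apply: contrapT => no; apply: ndY.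
    have [|x xm xY] := regular_ex lR fY.
      by move=> u mu; apply: contrapT => u0; apply: no; exists u.
    by exists x; split=> //; have [Q [q hq]] := reduction_ex x Y; exists Q, q.
  have ny := dim0_nil gy dimY.
  move=> i ki; apply: (extS_zero_nil_from lR big fY c0 mc _ eY ki (u := s y)).
  - by exists y.
  - by move=> v; have [u <-] := ss v; have [a ->] := gy u; exists a; rewrite linearZ.
  - by move=> a /ny [l lE]; exists l; rewrite -linearZ lE linear0.
have fY : fin_gen Y.
  have [f fE] := orbit_map y; apply: (fg_surj (f := f)) (noeth_fg nR) => v.
  by have [a ->] := gy v; exists a; rewrite fE.
have fX := fg_surj ss fY.
case: sR => [//|sR].
have [x [xm xR xY xX]] :=
  regular_ex3 lR (noeth_fg nR) fY fX sR (depth_ge_socfree dY) (depth_ge_socfree dX).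
have [Y' [q hq]] := reduction_ex x Y; have [X' [r hr]] := reduction_ex x X.
have [s' sE] := reduction_map s hq hr.
have eX' : forall i, (k.+1 <= i)%N -> extS_zero T i X'.
  apply: (IH k.+1 Y' X' s' (q y)).
  - by move=> v; have [u <-] := reduction_onto hr v; have [w <-] := ss u; exists (q w); rewrite sE.
  - by move=> v; have [u <-] := reduction_onto hq v; have [a ->] := gy u; exists a; rewrite linearZ.
  - by right.
  - exact: (depth_ge_reduction lR fY dY xm xY hq).
  - exact: (depth_ge_reduction lR fX dX xm xX hr).
  - by move=> dY'; apply: ndY; exists x; split=> //; exists Y', q.
  - by move=> l p /(chain_reduction xY hq) [p' /dimY].
  - case=> [//|i ki]; apply: (extS_zero_reduction lR fY xY hq); apply: eY => //; exact: leqW.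
by move=> i ki; apply: (extS_zero_nakayama lR xR fX fT xm xX hr); exact: eX'.
Qed.

End Primes.

(** * Maximal Cohen-Macaulay modules and delta invariants *)

Section MaximalCohenMacaulay.
Variable R : comNzRingType.
Variable m : submodule R^o.
Hypothesis lR : noeth_local m.
Implicit Types (L M N P Q T X Y : lmodType R).
Let nR := local_noeth lR.

(** The regularity condition of regular_seq, expressed by elements of M
    instead of its quotients. *)
Definition reg_list M (s : seq R) := forall i, (i < size s)%N -> forall u : M,
  s`_i *: u \in smul M [in take i s] -> u \in smul M [in take i s].

Lemma reg_listP M s : reg_list M s <-> forall i, (i < size s)%N ->
  forall u : quot_mod (smul M [in take i s]), s`_i *: u = 0 -> u = 0.
Proof.
split=> H i is_ u; first have [v <-] := qmap_onto u.
  by rewrite -linearZ => /qmap_eq0 /H => /(_ is_) ?; apply/qmap_eq0.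
by move=> su; apply/qmap_eq0; apply: H => //; rewrite -linearZ; apply/qmap_eq0.
Qed.

Lemma smul_nil M u : (u \in smul M [in [::]]) = (u == 0).
Proof.
apply/asboolP/eqP => [[[|p t] sA ->]|->].
- by rewrite big_nil.
- by have := sA p (mem_head _ _); rewrite inE.
- by exists [::] => //; rewrite big_nil.
Qed.

Lemma smul_subset M (I J : {pred R}) u : {subset I <= J} -> u \in smul M I -> u \in smul M J.
Proof. by move=> IJ /asboolP [s sI ->]; apply/asboolP; exists s => // p /sI /IJ. Qed.

Lemma smul_cons M Q (q : {linear M -> Q}) x s u : is_reduction x q ->
  (u \in smul M [in x :: s]) = (q u \in smul Q [in s]).
Proof.
move=> hq; apply/idP/idP.
  move=> /asboolP [t tA ->]; rewrite linear_sum big_seq; apply: rpred_sum => p pt.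
  rewrite linearZ /=; have := tA p pt; rewrite inE => /orP [/eqP ->|ps].
    by rewrite -linearZ (reduction_mul _ hq); exact: (rpred0 (smul Q [in s])).
  by have := @mem_smul _ Q [in s] p.1 (q p.2); apply.
case/(smul_lift (reduction_onto hq)) => v vs vE.
have /(reduction_ker hq) [w wE] : q (u - v) = 0 by rewrite linearB vE subrr.
rewrite -[u](subrK v) wE; apply: rpredD; first by apply: mem_smul; rewrite inE eqxx.
by apply: smul_subset vs => a; rewrite !inE => ->; rewrite orbT.
Qed.

Lemma reg_list_cons M Q (q : {linear M -> Q}) x s : is_reduction x q ->
  reg_list M (x :: s) <-> regular_on x M /\ reg_list Q s.
Proof.
move=> hq; split=> [H|[H1 H2]].
  split=> [u xu|i is_ v].
    suff : u \in smul M [in take 0 (x :: s)] by rewrite take0 smul_nil => /eqP.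
    by apply: (H 0) => //; rewrite [_ *: _]xu; exact: rpred0.
  have [u <-] := reduction_onto hq v; rewrite -linearZ -!(smul_cons _ _ hq).
  exact: (H i.+1).
case=> [_ u|i is_ u] /=.
  by rewrite !smul_nil => /eqP /H1 ->.
by rewrite !(smul_cons _ _ hq) linearZ; exact: H2.
Qed.

Lemma reg_list_depth_ge M s : {subset s <= (m : {pred R})} -> reg_list M s -> depth_ge m (size s) M.
Proof.
elim: s M => [//|x s IH] M sm rs; have [Q [q hq]] := reduction_ex x M.
have /(reg_list_cons s hq) [xM rQ] := rs.
exists x; split=> //; first by apply: sm; exact: mem_head.
exists Q, q; split=> //; apply: IH rQ => a sa; apply: sm; by rewrite inE sa orbT.
Qed.

Lemma depth_ge_reg_list n M : depth_ge m n M -> exists s, [/\ size s = n,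
  {subset s <= (m : {pred R})} & reg_list M s].
Proof.
elim: n M => [|n IH] M; first by exists [::].
move=> [x [xm xM [Q [q [hq /IH [s [ss sm rs]]]]]]]; exists (x :: s); split.
- by rewrite /= ss.
- by move=> a; rewrite inE => /orP [/eqP ->|/sm].
- exact/(reg_list_cons s hq).
Qed.

Lemma depth_ge_regular_seq n M : fin_gen M -> ~ zero_mod M -> depth_ge m n M ->
  exists s, [/\ size s = n, {subset s <= (m : {pred R})} & regular_seq M s].
Proof.
move=> fM nz /depth_ge_reg_list [s [ss sm rs]]; exists s; split=> //; split.
  exact/reg_listP.
apply: contrapT => no; apply: nz => u; apply/eqP; rewrite -zero_subP.
apply: (nakayama lR fM) => v; exists 0; first exact: rpred0.
rewrite subr0; have : v \in smul M [in s].
  by apply/qmap_eq0; apply: contrapT => v0; apply: no; exists (qmap (smul M [in s]) v); exact/eqP.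
by apply: smul_subset => a; exact: sm.
Qed.

Lemma regular_seq_depth_ge M s :
  {subset s <= (m : {pred R})} -> regular_seq M s -> depth_ge m (size s) M.
Proof. by move=> sm [rs _]; apply: reg_list_depth_ge sm _; apply/reg_listP. Qed.

Lemma is_dim_uniq M n k : is_dim M n -> is_dim M k -> n = k.
Proof.
move=> [[p pn] nb] [[p' pk] kb]; apply/eqP; rewrite eqn_leq.
by rewrite (kb _ _ pn) (nb _ _ pk).
Qed.

Lemma MCM_depth_ge d M : is_dim R^o d -> MCM m M -> fin_gen M /\ depth_ge m d M.
Proof.
move=> dR [[fM [n [dn [[s [ss sm rs]] _]]]] [k [dk dRk]]]; split=> //.
rewrite (is_dim_uniq dR dRk) (is_dim_uniq dk dn) -ss; exact: regular_seq_depth_ge.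
Qed.

Lemma chain_ring M k p : prime_chain M k p -> prime_chain (R^o : lmodType R) k p.
Proof.
move=> [sub incl]; split=> // a /annP H; apply: sub; apply/annP => u.
have -> : a = 0 by have := H (1 : R); rewrite -[LHS]/(a * 1) mulr1.
exact: scale0r.
Qed.

(** A module of depth d has a prime chain of length d, and no longer one
    exists as dim R = d. *)
Lemma depth_ge_MCM d M : is_dim R^o d -> fin_gen M -> ~ zero_mod M -> depth_ge m d M -> MCM m M.
Proof.
move=> dR fM nz dM; have [[p0 c0] bd] := dR.
have dimM : is_dim M d.
  split; first exact: (depth_ge_chain nR lR fM nz dM).
  by move=> k p /chain_ring /bd.
split; last by exists d.
split=> //; exists d; split=> //; split; first exact: depth_ge_regular_seq.
move=> s sm rs; have [p pc] := depth_ge_chain nR lR fM nz (regular_seq_depth_ge sm rs).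
exact: (dimM.2 _ _ pc).
Qed.

Lemma depth_ring d : CM m R^o -> is_dim R^o d ->
  depth_ge m d (R^o : lmodType R) /\ ~ depth_ge m d.+1 (R^o : lmodType R).
Proof.
move=> [fR [n [dn [[s [ss sm rs]] mx]]]] dR; rewrite (is_dim_uniq dR dn).
split; first by rewrite -ss; exact: regular_seq_depth_ge.
move=> dS; have [|t [tn tm rt]] := depth_ge_regular_seq fR _ dS.
  by move=> z; have := oner_neq0 R; rewrite (z (1 : R)) eqxx.
by have := mx t tm rt; rewrite tn ltnn.
Qed.

Lemma gen_min M n (g : 'I_n -> M) : generates g -> (mu M <= n)%N.
Proof.
move=> gg; rewrite /mu; case: pselect => // h; case: ex_minnP => k _; apply.
by apply/asboolP; exists g.
Qed.

(** A relation with an invertible coefficient expresses one generator by the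
    others. *)
Lemma gen_drop M k (g : 'I_k.+1 -> M) (c : 'rV[R]_k.+1) i (b : R) : generates g ->
  \sum_j c 0 j *: g j = 0 -> b * c 0 i = 1 -> generates (fun j => g (lift i j)).
Proof.
move=> gg c0 bc x; have [d ->] := gg x.
exists (\row_j (d 0 (lift i j) - d 0 i * b * c 0 (lift i j))).
have E : \sum_j (d 0 j - d 0 i * b * c 0 j) *: g j = \sum_j d 0 j *: g j.
  under eq_bigr => j _ do rewrite scalerBl -scalerA.
  by rewrite sumrB -scaler_sumr c0 scaler0 subr0.
rewrite -E (bigD1_ord i) //= -mulrA bc mulr1 subrr scale0r add0r.
by apply: eq_bigr => j _; rewrite mxE.
Qed.

(** The free cover has the least possible rank, so relations have
    coefficients in m. *)
Lemma cover_min M (c : 'rV[R]_(mu M)) i : fin_gen M -> cover c = 0 -> (c 0 i : R^o) \in m.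
Proof.
move=> fM; move: (@gen_min M) (min_gensP fM) c i; rewrite /cover.
move: (@min_gens R M); case: (mu M) => [|k] g mn gg c i c0; first by case: i.
apply: contrapT => /negP /(local_unit lR) [b bc].
by have := mn _ _ (gen_drop gg c0 bc); rewrite ltnn.
Qed.

(** The generator e of the summand has its coordinates in m by minimality of
    the cover. So R would have depth d + 1. *)
Lemma syz_no_free_summand d N : fin_gen N -> depth_ge m d (R^o : lmodType R) ->
  ~ depth_ge m d.+1 (R^o : lmodType R) -> depth_ge m d N -> no_free_summand (syz1 N).
Proof.
move=> fN dR ndR dN n N' f bf; case: n f bf => // n f bf; case: ndR.
have [f' fK Kf] := bf.
have [|r0 r0E] := @linear_ex R ('rV[R]_n.+1 * N')%type (R^o : lmodType R) (fun z => z.1 0 0).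
  by move=> a u v; rewrite !mxE.
have [||r rE] := factor_onto (p := f) (f := r0).
- by move=> v; exists (f' v).
- by move=> u /(injective_ker0 (bij_inj bf)) ->; exact: linear0.
pose e : syz1 N := f (delta_mx 0 0, 0).
have re : r e = (1 : R) by rewrite rE r0E /= mxE eqxx.
have hs := ker_ses (cover_onto fN).
have [psi psiE] := choice (fun j : 'I_(mu N) => orbit_map (delta_mx 0 j : 'rV[R]_(mu N))).
pose k := incl (ker (@cover R N : {linear _ -> _})).
apply: (minimal_syzygy_retract lR (e := e) (r := r) (a := fun j => k e 0 j) (psi := psi) hs).
- exact: fg_rV.
- exact: noeth_fg.
- by move=> y; exists (y : R); rewrite re; exact: esym (mulr1 _).
- move=> j; apply: (cover_min _ fN); apply/eqP; exact: (incl_in e).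
- rewrite [LHS]row_sum_delta; apply: eq_bigr => j _.
  by rewrite psiE re scale1r.
- exact: dR.
- exact: dN.
Qed.

Lemma mu_zero M : zero_mod M -> mu M = 0%N.
Proof.
move=> z; apply/eqP; rewrite -leqn0; apply: (@gen_min M 0 (fun _ => 0)) => x.
by exists 0; rewrite big_ord0 [LHS]z.
Qed.

Lemma delta_zero M : (forall u : M, u \in cm_part m M) -> delta m M = 0%N.
Proof.
move=> H; apply: mu_zero => v; have [u <-] := qmap_onto v; exact/qmap_eq0.
Qed.

(** A non-zero syzygy is itself among the modules whose images span the
    cm-part. *)
Theorem delta_i_eq0 d M : CM m R^o -> is_dim R^o d -> fin_gen M -> depth_ge m d M ->
  forall i, (1 <= i)%N -> delta_i m i M = 0%N.
Proof.
move=> cmR dR fM dM; have [deR ndR] := depth_ring cmR dR.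
have dS i : depth_ge m d (syz M i).
  elim: i => [//|i IH]; have [k hk] := syz_ses (fg_syz lR i fM).
  exact: (depth_ge_ker lR hk (@fg_rV R _) (depth_ge_rV lR _ deR) IH).
case=> // i _; apply: delta_zero => u.
case: (pselect (zero_mod (syz M i.+1))) => [z|nz]; first by rewrite [u]z rpred0.
apply/asboolP; exists [:: u]; last by rewrite big_seq1.
move=> v; rewrite inE => /eqP ->; exists (syz M i.+1), idfun, u; split=> //.
  exact: depth_ge_MCM dR (fg_syz lR _ fM) nz (dS _).
exact: (syz_no_free_summand (fg_syz lR i fM) deR ndR (dS i)).
Qed.

Lemma fin_inj_dim_extS_zero M : fin_inj_dim M ->
  exists n, forall N i, (n <= i)%N -> extS_zero M i N.
Proof.
move=> [n [E [e [dd [iE zE ei ex0 ex]]]]]; exists n.+1 => N i; apply: fin_inj_extS_zero.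
have iE' j : inj_mod (E j) by move=> B C f g fi; exact: iE.
by apply: (fin_inj_res iE' zE ex ei ex0); rewrite add0n.
Qed.

End MaximalCohenMacaulay.

(** * Local rings and their quotients *)

Section LocalRing.
Variable R : comNzRingType.

Lemma max_ideal_ex (I : submodule R^o) : noeth_ring R -> (1 : R^o) \notin I ->
  exists2 n : submodule R^o, maximal_ideal n & {subset I <= n}.
Proof.
move=> nR; move: I; apply: (noeth_ind nR) => I IH I1.
case: (pselect (maximal_ideal I)) => [mI|nmI]; first by exists I.
have [K [IK K1 [u uK uI]]] : exists K : submodule R^o, [/\ {subset I <= K}, (1 : R^o) \notin K
    & exists2 u, u \in K & u \notin I].
  apply: contrapT => no; apply: nmI; split=> // K IK K1 u uK.
  by apply: contrapT => /negP uI; apply: no; exists K; split=> //; exists u.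
have [|n mn Kn] := IH K IK _ K1; first by exists u.
by exists n => // t /IK /Kn.
Qed.

(** A proper ideal lies in a maximal one; applied to the principal ideal of
    a non-unit. *)
Lemma noeth_local_of_local (m : submodule R^o) : noetherian R -> local_ring m -> noeth_local m.
Proof.
move=> nR [[m1 mm] mu]; split=> // a am.
have [f fE] := orbit_map (a : R^o).
apply: contrapT => no.
have [|n mn In] := @max_ideal_ex (im f) nR.
  apply/negP => /mem_im [b bE]; apply: no; exists b; exact: esym (etrans bE (fE b)).
move/negP: am; apply; rewrite -(mu n mn); apply: In; apply/mem_im; exists (1 : R).
rewrite fE; exact: esym (mul1r a).
Qed.

Lemma qmap_mul (J : submodule R^o) (a b : R) :
  (qmap J a : quot_ring J) * qmap J b = qmap J (a * b).
Proof. exact: pi_mul. Qed.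

Lemma unit_notin (m J : submodule R^o) : noeth_local m -> (1 : R^o) \notin J ->
  forall a : R, (a : R^o) \in J -> (a : R^o) \in m.
Proof.
move=> lR J1 a aJ; apply: contrapT => /negP /(local_unit lR) [b ba].
by move/negP: J1; apply; rewrite -ba; exact: (rpredZ b aJ).
Qed.

Lemma noeth_local_quot_ring (m J : submodule R^o) : noeth_local m -> (1 : R^o) \notin J ->
  exists2 mS : submodule (quot_ring J)^o, noeth_local mS &
    forall a : R, ((qmap J a : (quot_ring J)^o) \in mS) = ((a : R^o) \in m).
Proof.
move=> lR J1; have Jm := unit_notin lR J1.
pose S := quot_ring J.
pose pm : {pred S^o} := fun x => `[< exists2 a : R, (a : R^o) \in m & x = (qmap J a : S) >].
have pmc : GRing.subsemimod_closed pm.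
  split; first split.
  - by apply/asboolP; exists 0; [exact: rpred0|exact: esym (linear0 (qmap J))].
  - move=> _ _ /asboolP [a am ->] /asboolP [b bm ->]; apply/asboolP.
    exists (a + b); first exact: rpredD.
    exact: esym (linearD (qmap J) a b).
  - move=> c _ /asboolP [a am ->]; have [c' <-] := @qmap_onto _ _ J c; apply/asboolP.
    exists (c' * a); first exact: (rpredZ c' am).
    exact: qmap_mul.
pose mS := Submodule pmc.
have mSE (a : R) : ((qmap J a : S^o) \in mS) = ((a : R^o) \in m).
  apply/asboolP/idP => [[b bm E]|am]; last by exists a.
  rewrite -[a](subrK b); apply: rpredD bm; apply: Jm; apply/qmap_eq0.
  by rewrite linearB; apply/eqP; rewrite subr_eq0; apply/eqP.
exists mS => //; split.
- move=> K.
  pose pk : {pred R^o} := fun a => (qmap J a : S^o) \in K.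
  have pkc : GRing.subsemimod_closed pk.
    split; first split.
    + have -> : (0 \in pk) = ((qmap J (0 : R^o) : S^o) \in K) by [].
      by rewrite [qmap J 0]linear0; exact: (rpred0 K).
    + move=> a b aK bK.
      have -> : (a + b \in pk) = ((qmap J (a + b) : S^o) \in K) by [].
      by rewrite [qmap J (a + b)]linearD; exact: (@rpredD _ K (qmap J a : S^o) (qmap J b : S^o)).
    + move=> c a aK.
      have -> : (c *: a \in pk) = ((qmap J (c * a : R) : S^o) \in K) by [].
      by rewrite -qmap_mul; exact: (@rpredZ _ _ K (qmap J c : S) (qmap J a : S^o)).
  have [n /asboolP [g gg]] := local_noeth lR (Submodule pkc).
  have gK i : (qmap J (incl _ (g i)) : S^o) \in K by exact: (incl_in (g i)).
  have [h hE] := choice (fun i => incl_ex (gK i)).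
  exists n; apply/asboolP; exists h => x.
  have [a aE] := @qmap_onto _ _ J (incl K x).
  have aK : (a : R^o) \in Submodule pkc.
    have -> : (a \in Submodule pkc) = ((qmap J a : S^o) \in K) by [].
    by rewrite aE; exact: (incl_in x).
  have [y yE] := incl_ex aK; have [c cE] := gg y.
  exists (\row_i (qmap J (c 0 i) : S)); apply: (@incl_inj S).
  rewrite linear_sum -aE -yE cE linear_sum.
  transitivity (\sum_i (qmap J (c 0 i *: incl _ (g i)) : S)).
    by rewrite linear_sum; apply: eq_bigr => i _; congr (qmap J _); exact: linearZ.
  apply: eq_bigr => i _; have hi : incl K (h i) = qmap J (incl _ (g i)) := hE i.
  by rewrite [RHS]linearZ /= hi mxE; exact: esym (qmap_mul _ _ _).
- have -> : (1 : S^o) = qmap J (1 : R) by [].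
  by rewrite mSE; exact: local_proper lR.
- move=> x; have [a <-] := @qmap_onto _ _ J x; rewrite mSE => /(local_unit lR) [b ba].
  exists (qmap J b : S); rewrite -[LHS]/((qmap J b : S) * qmap J a) qmap_mul ba.
  by [].
Qed.

(** Both sides have the same underlying set, with scalars in R and in R / J. *)
Lemma semi_iso_red (J : submodule R^o) (M : lmodType R) :
  semi_iso (qmap J : R -> quot_ring J) (M := quot_mod (smul M J)) (M' := red_mod J M) id.
Proof.
split=> //; last by exists id.
move=> a u; have [x <-] := qmap_onto u; rewrite -linearZ; exact: esym (pi_red_scale _ _ _).
Qed.

Lemma semi_iso_ring (J : submodule R^o) :
  semi_iso (qmap J : R -> quot_ring J) (M := quot_mod J) (M' := (quot_ring J)^o) id.
Proof.
split=> //; last by exists id.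
move=> a u; have [x <-] := qmap_onto u; rewrite -linearZ; exact: esym (qmap_mul _ _ _).
Qed.

End LocalRing.

(** * The theorem *)

Theorem corollary4p2 (R : comNzRingType) (m : submodule R^o) (d : nat)
    (omega : lmodType R) (I J : submodule R^o)
    (noethR : noetherian R) (localR : local_ring m) (cmR : CM m R^o)
    (dimR : is_dim R^o d) (omegaP : canonical_module m omega) :
  (colon omega I =i smul omega J -> MCM m (quot_mod I) ->
     forall i, (1 <= i)%N -> delta_i m i (sub_mod (smul omega J)) = 0%N)
  /\
  (colon omega I =i smul omega J -> colon omega J =i smul omega I ->
     MCM m (quot_mod I) -> Gdim (red_mod J omega) <> None ->
     forall i, (1 <= i)%N -> delta_i m i (sub_mod (smul omega I)) = 0%N).
Proof.
have lR := noeth_local_of_local noethR localR.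
have nR := local_noeth lR.
case: omegaP => mcmO _ injO.
have [fO dO] := MCM_depth_ge dimR mcmO.
have [n0 big] := fin_inj_dim_extS_zero injO.
have [deR ndR] := depth_ring lR cmR dimR.
have evQ (K : submodule R^o) : depth_ge m d (quot_mod K) ->
    forall i, extS_zero omega i (quot_mod K).
  move=> dK i.
  apply: (extS_zero_quotient nR lR big fO (n := d) (k := 0) (Y := R^o) (s := qmap K)
            (y := 1 : R)) => //.
  - exact: qmap_onto.
  - by move=> v; exists (v : R); exact: esym (mulr1 _).
  - by case: (d) deR => [|d'] deR; [left|right; exact: depth_ge_socfree deR].
  - exact: dimR.2.
  - by move=> j _; apply: extS_zero_proj; exact: projective_regular.
split.
- move=> cIJ mcmI; have [_ dI] := MCM_depth_ge dimR mcmI.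
  have [dJ _] := depth_ge_colon lR fO dO (evQ I dI) cIJ.
  by apply: (delta_i_eq0 lR cmR dimR _ dJ); exact: (fg_sub nR _ fO).
- move=> cIJ cJI mcmI gd; have [_ dI] := MCM_depth_ge dimR mcmI.
  have [_ dQ] := depth_ge_colon lR fO dO (evQ I dI) cIJ.
  (* once R / J has depth d, the argument for the first part applies with
     I and J exchanged *)
  suff dJ : depth_ge m d (quot_mod J).
    have [dI' _] := depth_ge_colon lR fO dO (evQ J dJ) cJI.
    by apply: (delta_i_eq0 lR cmR dimR _ dI'); exact: (fg_sub nR _ fO).
  (* if J = R, the module R / J is zero and has every depth *)
  case: (boolP ((1 : R^o) \in J)) => [J1|J1].
    apply: depth_ge_zero => v; have [a <-] := qmap_onto v; apply/qmap_eq0.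
    by have := rpredZ (a : R) J1; rewrite [_ *: _](mulr1 a).
  have [mS lS mSE] := noeth_local_quot_ring lR J1.
  have qs : onto (qmap J : R -> quot_ring J) by exact: qmap_onto.
  apply/(depth_ge_semi qs mSE d (semi_iso_ring J)).
  have dS := (depth_ge_semi qs mSE d (semi_iso_red J omega)).1 dQ.
  have [n gres] : exists n, has_Gres (red_mod J omega) n.
    by move: gd; rewrite /Gdim; case: pselect => // -[n /asboolP gn] _; exists n.
  apply: (Gres_depth_ge lS gres) dS => z.
  have [[_ [k [_ [[s [_ sm [_ [u /eqP u0]]]] _]]]] _] := mcmO.
  (* omega is not zero, so omega / J omega is not zero by Nakayama *)
  apply: u0; have [v <-] := qmap_onto u; apply/qmap_eq0.
  have -> : v = 0; last exact: rpred0.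
  apply/eqP; rewrite -zero_subP; apply: (nakayama lR fO) => w; exists 0; first exact: rpred0.
  rewrite subr0; apply: (@smul_subset R _ J); first exact: (unit_notin lR J1).
  by apply/qmap_eq0; exact: z.
Qed.
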